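(* Let $\Omega\subset\mathbb R^n$ be open, let $f\in BV_{\mathrm{loc}}(\Omega)$ and let $\tau\in[0,1)$. Then $$p_f^\tau(x)=\sup_{u\in\mathrm{Tan}^\tau(f,x)}\mathrm{Osc}(u,Q_0)$$ for every $x\in\operatorname{spt}(|Df|)$.
   Context: A cube means an open cube in $\mathbb R^n$ with arbitrary orientation; $\ell(Q)$ is the sidelength of $Q$ and $x_Q$ its center; $Q_0=(-\frac12,\frac12)^n$. For $\tau\in[0,1]$, $\tau Q$ is the concentric cube with center $x_Q$, sidelength $\tau\ell(Q)$ and faces parallel to those of $Q$ (for $\tau=0$, the point $x_Q$). Functions are real-valued. Mean oscillation: $\mathrm{Osc}(f,Q)=\frac1{|Q|}\int_Q\big|f(x)-\frac1{|Q|}\int_Q f\big|\,dx$. Local Poincaré constants: for a cube $Q\subset\Omega$ with $|Df|(Q)>0$ set $P_f(Q)=\ell(Q)^{n-1}\mathrm{Osc}(f,Q)/|Df|(Q)$. For $x\in\operatorname{spt}(|Df|)$ set $P_f^\tau(x,\varepsilon)=\sup\{P_f(Q):\ Q\subset\Omega,\ x\in\tau Q,\ \ell(Q)\le\varepsilon\}$ and $p_f^\tau(x)=\lim_{\varepsilon\to0}P_f^\tau(x,\varepsilon)$. Rescalings: an oriented cube is a cube $Q$ together with an $n$-tuple $(b_1,\dots,b_n)$ of centers of faces of $Q$ such that the vectors $b_i-x_Q$ are pairwise orthogonal; $T_Q:\mathbb R^n\to\mathbb R^n$ is the unique angle-preserving affine map with $T_Q(Q_0)=Q$ and $T_Q(\frac12e_i)=b_i$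 for all $i$. For an oriented cube $Q\subset\Omega$ with $|Df|(Q)>0$, set $$f_Q(y)=\frac{\ell(Q)^{n-1}}{|Df|(Q)}\Big(f(T_Qy)-\frac1{|Q|}\int_Qf\Big),\qquad y\in Q_0.$$ For $x\in\operatorname{spt}(|Df|)$, $\mathrm{Tan}^\tau(f,x)$ is the set of all strong $L^1(Q_0)$-limits of sequences $(f_{Q_j})_j$, where $(Q_j)_j$ are oriented cubes contained in $\Omega$ with $x\in\tau Q_j$ and $\ell(Q_j)\to0$. *)

(* Defs.v *)
From HB Require Import structures.
From mathcomp Require Import all_boot all_order all_algebra.
From mathcomp Require Import all_classical all_reals all_analysis.

Set Implicit Arguments.
Unset Strict Implicit.
Unset Printing Implicit Defensive.

Import Order.TTheory GRing.Theory Num.Theory.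
Import numFieldNormedType.Exports.

Local Open Scope classical_set_scope.
Local Open Scope ring_scope.

(* R^n is 'rV[R]_n.  Its sigma-algebra is generated by the coordinate maps,   *)
(* as the library does for tuples; since R is second countable this is the    *)
(* Borel sigma-algebra.                                                       *)
Section measurable_rV.
Context {R : realType} (n : nat).

Let coord (i : 'I_n) (v : 'rV[R]_n) : R := v ord0 i.

Let rV_set0 : g_sigma_preimage coord set0.
Proof. exact: sigma_algebra0. Qed.

Let rV_setC A : g_sigma_preimage coord A -> g_sigma_preimage coord (~` A).
Proof. exact: sigma_algebraC. Qed.

Let rV_bigcup (F : (set 'rV[R]_n)^nat) :
  (forall i, g_sigma_preimage coord (F i)) ->
  g_sigma_preimage coord (\bigcup_i (F i)).
Proof. exact: sigma_algebra_bigcup. Qed.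

HB.instance Definition _ := @isMeasurable.Build default_measure_display
  'rV[R]_n (g_sigma_preimage coord) rV_set0 rV_setC rV_bigcup.

Lemma measurable_coord (i : 'I_n) :
  measurable_fun setT (fun v : 'rV[R]_n => v ord0 i).
Proof.
move=> _ Y mY; rewrite setTI; apply: sub_sigma_algebra => /=.
rewrite -bigcup_seq/=; exists i => /=; first by rewrite mem_index_enum.
by exists Y => //; rewrite setTI.
Qed.

Lemma measurable_fun_coordP d (T : measurableType d) (f : T -> 'rV[R]_n) :
  measurable_fun setT f <->
  forall i, measurable_fun setT (fun t => f t ord0 i).
Proof.
split=> [mf i|mf].
  exact: (measurableT_comp (measurable_coord i) mf).
have sfS : g_sigma_preimage coord `<=` [set A | measurable (f @^-1` A)].
  apply: smallest_sub.
    split=> /=.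
    - by rewrite preimage_set0.
    - by move=> A mA; rewrite setTD preimage_setC; exact: measurableC.
    - by move=> F mF; rewrite preimage_bigcup; exact: bigcupT_measurable.
  rewrite -bigcup_seq => A [i _ [B mB <-]] /=.
  by have := mf i measurableT B mB; rewrite !setTI.
by move=> _ A mA; rewrite setTI; exact: sfS.
Qed.

End measurable_rV.

(* measurableTypeR R is R, with the sigma-algebra carrying lebesgue_measure. *)
Definition cons_rV {R : realType} {n : nat} (p : measurableTypeR R * 'rV[R]_n) :
    'rV[R]_n.+1 :=
  \row_i (if unlift ord0 i is Some j then p.2 ord0 j else p.1).

Section cons_rV_theory.
Context {R : realType} (n : nat).

Let uncons (v : 'rV[R]_n.+1) : measurableTypeR R * 'rV[R]_n :=
  (v ord0 ord0, \row_j v ord0 (lift ord0 j)).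

Let cons_rVK : cancel cons_rV uncons.
Proof.
move=> [a v]; rewrite /uncons /cons_rV mxE unlift_none; congr pair.
by apply/rowP => j; rewrite !mxE liftK.
Qed.

Let measurable_uncons : measurable_fun setT uncons.
Proof.
apply: measurable_fun_pair; first exact: measurable_coord.
apply/measurable_fun_coordP => i.
by under eq_fun do rewrite mxE; exact: measurable_coord.
Qed.

Lemma measurable_cons_rV : measurable_fun setT (@cons_rV R n).
Proof.
apply/measurable_fun_coordP => i; under eq_fun do rewrite mxE.
case: unliftP => [j _|_]; last exact: measurable_fst.
exact: (measurableT_comp (measurable_coord j) measurable_snd).
Qed.

Variable mu : {sigma_finite_measure set 'rV[R]_n -> \bar R}.

Definition lebesgue_cons : set 'rV[R]_n.+1 -> \bar R :=
  pushforward (@lebesgue_measure R \x mu)%E cons_rV.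

Let lebesgue_cons0 : lebesgue_cons set0 = 0%E.
Proof. by rewrite /lebesgue_cons /pushforward preimage_set0 measure0. Qed.

Let lebesgue_cons_ge0 A : (0 <= lebesgue_cons A)%E.
Proof. by rewrite /lebesgue_cons /pushforward measure_ge0. Qed.

Let lebesgue_cons_sigma_additive : semi_sigma_additive lebesgue_cons.
Proof.
move=> F mF tF mUF; rewrite /lebesgue_cons /pushforward preimage_bigcup.
apply: measure_semi_sigma_additive.
- by move=> k; rewrite -[X in measurable X]setTI; exact: measurable_cons_rV.
- apply/trivIsetP => /= i j _ _ ij; rewrite -preimage_setI.
  by move/trivIsetP : tF => /(_ _ _ _ _ ij) ->//; rewrite preimage_set0.
- rewrite -preimage_bigcup -[X in measurable X]setTI.
  exact: measurable_cons_rV.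
Qed.

HB.instance Definition _ := isMeasure.Build _ _ _ lebesgue_cons
  lebesgue_cons0 lebesgue_cons_ge0 lebesgue_cons_sigma_additive.

Let lebesgue_cons_sigma_finite : sigma_finite setT lebesgue_cons.
Proof.
have /sigma_finiteP[F [FT ndF Foo]] := sigma_finiteT (@lebesgue_measure R).
have /sigma_finiteP[G [GT ndG Goo]] := sigma_finiteT mu.
exists (fun k => uncons @^-1` (F k `*` G k)).
  rewrite -preimage_bigcup (_ : \bigcup_k _ = setT) ?preimage_setT//.
  rewrite -setXTT FT GT predeqE => -[x y]; split.
    by move=> [k _ []/= ? ?]; split; exists k.
  move=> [/= [k _ Fkx] [l _ Gly]]; exists (maxn k l) => //; split.
  - by move: x Fkx; exact/subsetPset/ndF/leq_maxl.
  - by move: y Gly; exact/subsetPset/ndG/leq_maxr.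
move=> k; have [mF Fk] := Foo k; have [mG Gk] := Goo k; split.
  rewrite -[X in measurable X]setTI; apply: measurable_uncons => //.
  exact: measurableX.
rewrite /lebesgue_cons /pushforward -comp_preimage.
rewrite (_ : uncons \o _ = id); last by apply/funext => p /=; rewrite cons_rVK.
by rewrite preimage_id product_measure1E// lte_mul_pinfty// ge0_fin_numE.
Qed.

HB.instance Definition _ := Measure_isSigmaFinite.Build _ _ _
  lebesgue_cons lebesgue_cons_sigma_finite.

End cons_rV_theory.

Fixpoint lebesgue_rV_rec (R : realType) (n : nat) :
    {sigma_finite_measure set 'rV[R]_n -> \bar R} :=
  match n with
  | 0 => \d_(0 : 'rV[R]_0)
  | n'.+1 => lebesgue_cons (lebesgue_rV_rec R n')
  end.

Definition lebesgue_rV {R : realType} {n : nat} :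
    {sigma_finite_measure set 'rV[R]_n -> \bar R} :=
  lebesgue_rV_rec R n.

Lemma lebesgue_rV_box {R : realType} (n : nat) (A : 'I_n -> set R) :
  (forall i, measurable (A i)) ->
  lebesgue_rV [set v : 'rV[R]_n | forall i, A i (v ord0 i)] =
  (\prod_(i < n) lebesgue_measure (A i))%E.
Proof.
elim: n A => [|n IHn] A mA.
  rewrite big_ord0 /lebesgue_rV /= diracE mem_set//= => i; by case: i.
have mB : measurable
    [set v : 'rV[R]_n | forall j, A (lift ord0 j) (v ord0 j)].
  rewrite (_ : [set _ | _] = \bigcap_(j in [set: 'I_n])
      ((fun v : 'rV[R]_n => v ord0 j) @^-1` A (lift ord0 j))); last first.
    by apply/seteqP; split => v /= vA j; [move=> _|]; exact: vA.
  apply: fin_bigcap_measurable => //= j _.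
  by rewrite -[X in measurable X]setTI; exact: measurable_coord.
rewrite big_ord_recl -IHn//.
rewrite -[in RHS](@product_measure1E _ _ _ _ _ lebesgue_measure lebesgue_rV)//;
  last exact: mA.
rewrite /lebesgue_rV/= /lebesgue_cons /pushforward.
congr (_ _); apply/seteqP; split => -[a v]/=.
  move=> vA; split=> [|j].
    by have := vA ord0; rewrite mxE unlift_none.
  by have := vA (lift ord0 j); rewrite mxE liftK.
by move=> [aA vA] i; rewrite mxE; case: unliftP => [j ->|->].
Qed.

(* The Euclidean inner product; the library norm on 'rV[R]_n is the sup norm. *)
Definition dotr {R : realType} {n : nat} (u v : 'rV[R]_n) : R :=
  \sum_(i < n) u ord0 i * v ord0 i.

Definition divergence {R : realType} {n : nat} (phi : 'rV[R]_n -> 'rV[R]_n)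
    (x : 'rV[R]_n) : R :=
  \sum_(i < n) 'D_(delta_mx ord0 i) (fun y => phi y ord0 i) x.

Definition C1c {R : realType} {n : nat} (U : set 'rV[R]_n)
    (phi : 'rV[R]_n -> 'rV[R]_n) :=
  [/\ forall x, differentiable phi x,
      forall i : 'I_n, continuous ('D_(delta_mx ord0 i) phi) &
      exists K, [/\ compact K, K `<=` U & forall x, ~ K x -> phi x = 0]].

(* |Df|(U) for U open: for f in L^1_loc(U) with Df a measure, this supremum   *)
(* is the total variation on U of the R^n-valued measure Df, the Euclidean    *)
(* norm being used on R^n.  |Df| is only ever evaluated on open sets.         *)
Definition variation {R : realType} {n : nat} (f : 'rV[R]_n -> R)
    (U : set 'rV[R]_n) : \bar R :=
  ereal_sup [set (\int[lebesgue_rV]_(x in U) (f x * divergence phi x)%:E)%E |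
    phi in [set phi | C1c U phi /\ forall x, dotr (phi x) (phi x) <= 1]].

(* f is a Borel representative of its class modulo null sets. *)
Definition L1loc {R : realType} {n : nat} (Omega : set 'rV[R]_n)
    (f : 'rV[R]_n -> R) :=
  measurable_fun Omega f /\
  forall K, compact K -> K `<=` Omega ->
    (\int[lebesgue_rV]_(x in K) `|f x|%:E < +oo)%E.

Definition BVloc {R : realType} {n : nat} (Omega : set 'rV[R]_n)
    (f : 'rV[R]_n -> R) :=
  L1loc Omega f /\
  forall U, open U -> compact (closure U) -> closure U `<=` Omega ->
    (variation f U < +oo)%E.

Definition spt_variation {R : realType} {n : nat} (Omega : set 'rV[R]_n)
    (f : 'rV[R]_n -> R) : set 'rV[R]_n :=
  [set x | Omega x /\
    forall U, open U -> U `<=` Omega -> U x -> (0 < variation f U)%E].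

(* An oriented cube is given by its center x_Q, its side length l(Q) and the  *)
(* chosen face centers b_i: the b_i - x_Q are pairwise orthogonal of length   *)
(* l(Q)/2.  The underlying open cube is [carrier Q] below, and every cube,    *)
(* with arbitrary orientation, is the carrier of some oriented cube.          *)
Record ocube (R : realType) (n : nat) := OCube {
  center : 'rV[R]_n;
  side : R;
  face : 'I_n -> 'rV[R]_n;
  side_gt0 : 0 < side;
  face_orthogonal : forall i j : 'I_n,
    dotr (face i - center) (face j - center) = (side / 2) ^+ 2 *+ (i == j)
}.

(* t Q_0, where Q_0 = Q_(1) is the open unit cube centered at 0 *)
Definition dilate_Q0 {R : realType} {n : nat} (t : R) : set 'rV[R]_n :=
  if t == 0 then [set 0] else [set y | forall i, `|y ord0 i| < t / 2].

Definition Q0 {R : realType} {n : nat} : set 'rV[R]_n := dilate_Q0 1.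

Definition ocube_map {R : realType} {n : nat} (Q : ocube R n) (y : 'rV[R]_n) :
    'rV[R]_n :=
  center Q + \sum_(i < n) (2 * y ord0 i) *: (face Q i - center Q).

Lemma ocube_map_face {R : realType} {n : nat} (Q : ocube R n) (i : 'I_n) :
  ocube_map Q (2^-1 *: delta_mx ord0 i) = face Q i.
Proof.
rewrite /ocube_map (bigD1 i)//= big1 => [|j ji].
  by rewrite !mxE !eqxx mulr1 divff ?pnatr_eq0// scale1r addr0 addrC subrK.
by rewrite !mxE (negbTE ji) andbF !mulr0 scale0r.
Qed.

Definition dilate {R : realType} {n : nat} (t : R) (Q : ocube R n) :
    set 'rV[R]_n :=
  ocube_map Q @` dilate_Q0 t.

Definition carrier {R : realType} {n : nat} (Q : ocube R n) : set 'rV[R]_n :=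
  dilate 1 Q.

Definition mean {R : realType} {n : nat} (f : 'rV[R]_n -> R)
    (A : set 'rV[R]_n) : R :=
  (fine (lebesgue_rV A))^-1 * \int[lebesgue_rV]_(x in A) f x.

Definition osc {R : realType} {n : nat} (f : 'rV[R]_n -> R)
    (A : set 'rV[R]_n) : \bar R :=
  ((fine (lebesgue_rV A))^-1%:E *
   \int[lebesgue_rV]_(x in A) `|f x - mean f A|%:E)%E.

(* If |Df|(Q) = +oo, which can occur only for Q not relatively compact in     *)
(* Omega, the quotient is 0; such cubes are absent once eps is small.         *)
Definition poincare {R : realType} {n : nat} (f : 'rV[R]_n -> R)
    (Q : ocube R n) : \bar R :=
  ((side Q ^+ n.-1)%:E * osc f (carrier Q) / variation f (carrier Q))%E.

(* The supremum is over cubes; [poincare f Q] and [dilate tau Q] do not       *)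
(* depend on the choice of the face centers.                                  *)
Definition poincare_sup {R : realType} {n : nat} (Omega : set 'rV[R]_n)
    (f : 'rV[R]_n -> R) (tau : R) (x : 'rV[R]_n) (eps : R) : \bar R :=
  ereal_sup [set poincare f Q | Q in [set Q : ocube R n |
    [/\ carrier Q `<=` Omega, dilate tau Q x & side Q <= eps]]].

Definition poincare_lim {R : realType} {n : nat} (Omega : set 'rV[R]_n)
    (f : 'rV[R]_n -> R) (tau : R) (x : 'rV[R]_n) : \bar R :=
  lim (poincare_sup Omega f tau x eps @[eps --> (0 : R)^'+]).

Definition rescale {R : realType} {n : nat} (f : 'rV[R]_n -> R)
    (Q : ocube R n) (y : 'rV[R]_n) : R :=
  side Q ^+ n.-1 / fine (variation f (carrier Q)) *
  (f (ocube_map Q y) - mean f (carrier Q)).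

(* For x in the support of |Df| and tau < 1, the condition |Df|(Q) > 0        *)
(* follows from x being in tau Q.                                             *)
Definition Tan {R : realType} {n : nat} (Omega : set 'rV[R]_n)
    (f : 'rV[R]_n -> R) (tau : R) (x : 'rV[R]_n) : set ('rV[R]_n -> R) :=
  [set u | lebesgue_rV.-integrable Q0 (EFin \o u) /\
    exists Q : nat -> ocube R n,
      [/\ forall j, carrier (Q j) `<=` Omega,
          forall j, dilate tau (Q j) x,
          side (Q j) @[j --> \oo] --> (0 : R) &
          (\int[lebesgue_rV]_(y in Q0) `|rescale f (Q j) y - u y|%:E)%E
            @[j --> \oo] --> 0%E]].

(* Main.v *)
Require Import Defs.
From mathcomp Require Import all_boot all_order all_algebra.
From mathcomp Require Import all_classical all_reals all_analysis.
From mathcomp Require Import measurable_realfun.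
Import Defs.

(** That the supremum is at most the limit follows from a change of variables:
    for every small cube [Q] around [x] one has [poincare f Q = osc (rescale f Q) Q0]
    ([poincare_rescale]), and the mean oscillation is Lipschitz for the L^1 norm
    ([osc_Q0_lipschitz]); so if the rescalings along [Q_j] converge to [u], then
    [osc u Q0] is the limit of admissible values [poincare f Q_j]
    ([osc_Tan_le]).

    The converse is a compactness argument.  If [y] is below the limit of the
    Poincare suprema, there are cubes [Q_j] around [x], with sides tending to
    [0], for which [osc (rescale f Q_j) Q0 > y].  Each [rescale f Q_j] has mean
    zero on the unit cube and total variation at most one; since mean-zero
    functions of bounded variation are compact in L^1, a subsequence
    converges to some tangent [u], and [osc u Q0 >= y]
    ([lt_poincare_lim_Tan]).  The hypothesis on [x] enters through
    [small_cubes]: small cubes around [x] are relatively compact in the domain,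
    so that the variation on them is finite, and it is positive since [x] lies
    in the support.

    The compactness theorem [weak_variation_compact] is proved by duality, from
    the bounds |int g d_i phi| <= sup |phi| only.  Cut each side of the unit cube
    into [N] intervals.  A test function [psi] of product type is modified one
    coordinate at a time: its primitive in that coordinate is replaced by a
    smooth interpolation between the grid points, and the error is the partial
    derivative of a test function of size O(1/N) ([discretize]).  After all
    coordinates have been treated, what remains of [psi] is a combination of
    [N^n] fixed bumps with bounded coefficients ([grid_expansion]).  Taking the
    supremum over [psi] ([test_norming]) shows that the L^1 norm of [g] is at
    most O(1/N) plus a constant times the sum of the pairings of [g] with these
    bumps ([L1norm_estimate]).  For [N = 1] this is a Poincare inequality and
    gives boundedness in L^1; along an ultrafilter the finitely many pairings
    converge for every [N], which makes the sequence Cauchy.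

    That the rescaled functions satisfy the bounds is seen by transporting a
    test function [phi] of the unit cube to the vector field
    phi o T_Q^-1 times the unit vector of the i-th edge of [Q]; it is admissible
    in the definition of |Df|(Q), and its divergence is the transported partial
    derivative ([pairing_rescale_le1]).  Changing variables under the
    similarities [T_Q] requires the scaling law of the Lebesgue measure, which is
    obtained from Tonelli's theorem ([lebesgue_rV_linear]). *)

Set Implicit Arguments.
Unset Strict Implicit.
Unset Printing Implicit Defensive.

Import Order.TTheory GRing.Theory Num.Theory.
Import numFieldNormedType.Exports.

Local Open Scope classical_set_scope.
Local Open Scope ring_scope.

(** * Topology and measurability of R^n *)

Section rV_topology.
Context {R : realType} {n : nat}.
Implicit Types (v w : 'rV[R]_n) (U : set 'rV[R]_n).

Lemma rV_norm_leP v (c : R) : 0 <= c ->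
  (`|v| <= c) <-> (forall i, `|v ord0 i| <= c).
Proof.
move=> c0; rewrite [`|v|]/Num.Def.normr/= mx_normrE; split=> [/bigmax_leP[_ H] i|H].
  by have /(_ (ord0, i)) := H; apply.
by apply/bigmax_leP; split => // -[i j] _ /=; rewrite ord1.
Qed.

Lemma rV_norm_coord v i : `|v ord0 i| <= `|v|.
Proof. by move: i; apply/rV_norm_leP. Qed.

Lemma measurable_coordwise (A : 'I_n -> set R) :
  (forall i, measurable (A i)) ->
  measurable [set v : 'rV[R]_n | forall i, A i (v ord0 i)].
Proof.
move=> mA; rewrite (_ : [set _ | _] = \bigcap_(i in [set: 'I_n])
    ((fun v : 'rV[R]_n => v ord0 i) @^-1` A i)); last first.
  by apply/seteqP; split => v /= vA j; [move=> _|]; exact: vA.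
apply: fin_bigcap_measurable => //= i _.
by rewrite -[X in measurable X]setTI; exact: measurable_coord.
Qed.

(** The sigma-algebra is generated by the coordinates; an open set belongs to it
    since it is a countable union of boxes with rational centers. *)
Lemma open_measurable_rV U : open U -> measurable U.
Proof.
move=> oU.
pose box (q : {ffun 'I_n -> rat} * nat) : set 'rV[R]_n :=
  [set v | forall i, ball (ratr (q.1 i) : R) q.2.+1%:R^-1 (v ord0 i)].
have mbox q : measurable (box q).
  apply: (@measurable_coordwise (fun i => ball (ratr (q.1 i) : R) q.2.+1%:R^-1)).
  by move=> i; exact: measurable_ball.
pose F q := if `[< box q `<=` U >] then box q else set0.
rewrite (_ : U = \bigcup_q F q).
  apply: (@countable_bigcupT_measurable _ _ _ F) => [|q].
    exact: countableP.
  by rewrite /F; case: ifP.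
apply/seteqP; split => [v Uv|v [q _]]; last by rewrite /F; case: asboolP => // qU /qU.
have /nbhs_ballP[e /= e0 eU] : nbhs v U by exact: open_nbhs_nbhs.
have [k ke] : exists k : nat, k.+1%:R^-1 < e / 2.
  exists (Num.truncn (e / 2)^-1); rewrite invf_plt ?posrE ?divr_gt0//.
  by rewrite truncnS_gt.
have k0 : (0 : R) < k.+1%:R^-1 by rewrite invr_gt0.
have H i : exists q : rat, v ord0 i < ratr q < v ord0 i + k.+1%:R^-1.
  have [|q] := @rat_in_itvoo _ (v ord0 i) (v ord0 i + k.+1%:R^-1).
    by rewrite ltrDl.
  by rewrite in_itv/= => ?; exists q.
pose q := ([ffun i => projT1 (cid (H i))], k).
have Hq i : `|ratr (q.1 i) - v ord0 i| < k.+1%:R^-1.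
  rewrite ffunE; case: cid => r /= /andP[r1 r2].
  by rewrite gtr0_norm ?subr_gt0// ltrBlDl.
exists q => //; rewrite /F; case: asboolP => [_|]; first exact: Hq.
case=> w bw; apply: eU; split => // i j; rewrite ord1 /ball/=.
rewrite -(subrKA (ratr (q.1 j))) (le_lt_trans (ler_normD _ _))//.
rewrite (splitr e) ltrD//.
  by rewrite distrC (lt_trans (Hq j)).
exact: (lt_trans (bw j)).
Qed.

Lemma continuous_measurable_rV (f : 'rV[R]_n -> R) :
  continuous f -> measurable_fun setT f.
Proof.
move=> /continuousP cf; apply: (measurability _ (RGenOpens.measurableE R)) => //.
move=> _ [_ [a [b ->]] <-]; rewrite setTI; apply: open_measurable_rV.
by apply: cf; exact: interval_open.
Qed.

Lemma measurable_rV_gen : @measurable _ 'rV[R]_n =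
  <<s [set B | exists a : 'I_n -> R * R,
     B = [set v : 'rV[R]_n | forall i, (a i).1 < v ord0 i <= (a i).2] ] >>.
Proof.
set G := [set B | _].
apply/seteqP; split; last first.
  apply: smallest_sub; first exact: sigma_algebra_measurable.
  by move=> _ [a ->]; apply: (@measurable_coordwise (fun i => [set` `](a i).1, (a i).2]])).
apply: smallest_sub; first exact: smallest_sigma_algebra.
rewrite -bigcup_seq => A [i _ [B mB <-]] /=.
pose S := [set B : set R | <<s G >> ((fun v : 'rV[R]_n => v ord0 i) @^-1` B)].
suff: measurable `<=` S by rewrite setTI; apply.
apply: smallest_sub.
  split.
  - by rewrite /S /= preimage_set0; exact: sigma_algebra0.
  - move=> C; rewrite /S /= setTD preimage_setC -setTD.
    exact: sigma_algebraCD.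
  - by move=> C SC; rewrite /S /= preimage_bigcup; exact: sigma_algebra_bigcup.
move=> C [/= [a b] _ <-]; rewrite /S/=.
rewrite (_ : _ @^-1` _ = \bigcup_k [set v : 'rV[R]_n | forall j,
   (if j == i then a else - k%:R) < v ord0 j <= (if j == i then b else k%:R)]).
  apply: sigma_algebra_bigcup => k; apply: sub_sigma_algebra.
  by exists (fun j => (if j == i then a else - k%:R, if j == i then b else k%:R)).
apply/seteqP; split => [v /= vi|v [k _ /(_ i)]]; last by rewrite eqxx /= in_itv.
exists (Num.truncn `|v|).+1 => //= j.
case: eqVneq => [->|ji]; first by move: vi; rewrite in_itv.
have := rV_norm_coord v j; rewrite ler_norml => /andP[h1 h2].
have := truncnS_gt `|v| => h3.
by rewrite (lt_le_trans _ h1) ?ltrN2//= (le_trans h2)// ltW.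
Qed.

(** Half-open boxes are stable under intersection, generate the sigma-algebra and
    exhaust the space. *)
Lemma measure_box_unique (m1 m2 : {measure set 'rV[R]_n -> \bar R}) :
  (forall a : 'I_n -> R * R,
     let B := [set v : 'rV[R]_n | forall i, (a i).1 < v ord0 i <= (a i).2] in
     (m1 B < +oo)%E /\ m1 B = m2 B) ->
  forall A, measurable A -> m1 A = m2 A.
Proof.
move=> H; apply: (measure_unique _ (fun k : nat =>
   [set v : 'rV[R]_n | forall i, - k%:R < v ord0 i <= k%:R]) measurable_rV_gen).
- move=> _ _ [a ->] [b ->]; exists (fun i => (Num.max (a i).1 (b i).1, Num.min (a i).2 (b i).2)).
  apply/seteqP; split => [v [va vb] i|v vab].
    have := va i; have := vb i; rewrite /= => /andP[b1 b2] /andP[a1 a2].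
    by rewrite gt_max le_min b1 b2 a1 a2.
  split => i; have := vab i; rewrite /= gt_max le_min.
    by case/andP => /andP[-> ?] /andP[-> ?].
  by case/andP => /andP[? ->] /andP[? ->].
- by move=> k; exists (fun=> (- k%:R, k%:R)).
- apply/seteqP; split => // v _; exists (Num.truncn `|v|).+1 => //= j.
  have := rV_norm_coord v j; rewrite ler_norml => /andP[h1 h2].
  have := truncnS_gt `|v| => h3.
  by rewrite (lt_le_trans _ h1) ?ltrN2//= (le_trans h2)// ltW.
- by move=> _ [a ->]; have [] := H a.
- by move=> k; have [] := H (fun=> (- k%:R, k%:R)).
Qed.

End rV_topology.

(** * Lebesgue measure under translations and linear maps *)

Section lebesgue_rV_affine.
Context {R : realType} {n : nat}.
Notation mu := (@lebesgue_rV R n).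
Implicit Types (A B : set 'rV[R]_n) (M : 'M[R]_n) (v w : 'rV[R]_n).

Lemma measurable_mulmx M : measurable_fun setT (fun v : 'rV[R]_n => v *m M).
Proof.
apply/measurable_fun_coordP => i; under eq_fun do rewrite mxE.
apply: measurable_sum => j; apply: measurable_funM => //.
exact: measurable_coord.
Qed.

Lemma measurable_rVD d (T : measurableType d) (f g : T -> 'rV[R]_n) :
  measurable_fun setT f -> measurable_fun setT g ->
  measurable_fun setT (fun t => f t + g t).
Proof.
move=> /measurable_fun_coordP mf /measurable_fun_coordP mg.
apply/measurable_fun_coordP => i; under eq_fun do rewrite mxE.
exact: measurable_funD.
Qed.

Lemma measurable_rV_preimage (f : 'rV[R]_n -> 'rV[R]_n) A :
  measurable_fun setT f -> measurable A -> measurable (f @^-1` A).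
Proof. by move=> mf mA; rewrite -[X in measurable X]setTI; exact: mf. Qed.

Lemma lebesgue_rV_oc_box (a : 'I_n -> R * R) :
  mu [set v | forall i, (a i).1 < v ord0 i <= (a i).2] =
  (\prod_(i < n) Num.max ((a i).2 - (a i).1) 0)%:E.
Proof.
transitivity (\prod_(i < n) lebesgue_measure [set` `](a i).1, (a i).2]])%E.
  by rewrite -lebesgue_rV_box//; congr (_ _).
rewrite -prodEFin; apply: eq_bigr => i _.
rewrite lebesgue_measure_itv/= lte_fin.
case: ltP => h; first by rewrite max_l// subr_ge0 ltW.
by rewrite max_r// subr_le0.
Qed.

Lemma lebesgue_rV_shift w A : measurable A ->
  mu [set v | A (v + w)] = mu A.
Proof.
move=> mA.
have mf : measurable_fun setT (fun v : 'rV[R]_n => v + w).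
  by apply: measurable_rVD => //; exact: measurable_cst.
rewrite -[LHS]/(pushforward mu (fun v => v + w) A).
apply/esym.
apply: (@measure_box_unique _ _ mu
  (measure_function_pushforward__canonical__measure_function_Measure mu mf) _ A mA).
move=> a B; suff : (mu B < +oo)%E /\ mu B = pushforward mu (fun v => v + w) B by [].
rewrite /B (lebesgue_rV_oc_box a) ltry; split => //.
rewrite /= /pushforward /=.
transitivity (mu [set v | forall i, (a i).1 - w ord0 i < v ord0 i <= (a i).2 - w ord0 i]).
  rewrite (@lebesgue_rV_oc_box (fun i => ((a i).1 - w ord0 i, (a i).2 - w ord0 i)))/=.
  by congr (_%:E); apply: eq_bigr => i _; rewrite opprB addrA subrK.
congr (_ _); apply/seteqP; split => v + i => /(_ i);
  by rewrite /= mxE ltrBlDr lerBrDr.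
Qed.

Lemma integral_indic_set A (f : 'rV[R]_n -> R) : measurable A ->
  (forall x, f x = \1_A x) -> (\int[mu]_x (f x)%:E = mu A)%E.
Proof.
by move=> mA fA; under eq_integral do rewrite fA; rewrite integral_indic// setIT.
Qed.

(** This symmetric relation replaces the determinant: it says that the ratio of
    the measures of a set and of its preimage does not depend on the set.
    Both sides compute, by Tonelli's theorem and invariance under translations,
    the product measure of the pairs (x, y) with x in [A] and y M + x in [B].
    The symmetry of [A] absorbs the sign created by exchanging the roles. *)
Lemma lebesgue_rV_linear M A B : M \in unitmx ->
  measurable A -> (forall v, A (- v) <-> A v) -> measurable B ->
  (mu A * mu [set y | B (y *m M)] = mu [set y | A (y *m M)] * mu B)%E.
Proof.
move=> uM mA As mB.
have mMx : measurable_fun setT (fun y : 'rV[R]_n => y *m M) := @measurable_mulmx M.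
have mMA : measurable [set y | A (y *m M)] by exact: (measurable_rV_preimage mMx).
have mMB : measurable [set y | B (y *m M)] by exact: (measurable_rV_preimage mMx).
pose F : set ('rV[R]_n * 'rV[R]_n) := [set p | A p.1 /\ B (p.2 *m M + p.1)].
pose G : set ('rV[R]_n * 'rV[R]_n) := [set p | A (p.1 - p.2 *m M) /\ B p.1].
have msnd : measurable_fun setT (fun p : 'rV[R]_n * 'rV[R]_n => p.2 *m M).
  by apply: (measurableT_comp mMx); exact: measurable_snd.
have mF : measurable F.
  apply: measurableI.
    rewrite -[X in measurable X]setTI; exact: measurable_fst.
  rewrite -[X in measurable X]setTI.
  by apply: (measurable_rVD msnd) => //; exact: measurable_fst.
have mN : measurable_fun setT (fun p : 'rV[R]_n * 'rV[R]_n => p.1 - p.2 *m M).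
  apply: measurable_rVD; first exact: measurable_fst.
  apply/measurable_fun_coordP => i; under eq_fun do rewrite mxE.
  by apply: measurable_funN; move/measurable_fun_coordP : msnd; exact.
have mG : measurable G.
  apply: measurableI; rewrite -[X in measurable X]setTI; first exact: mN.
  exact: measurable_fst.
have mxS (S : set ('rV[R]_n * 'rV[R]_n)) x : measurable S ->
    measurable [set y | S (x, y)].
  move=> mS; have := measurable_xsection x mS; congr (measurable _).
  by apply/seteqP; split => y; rewrite /xsection/= inE.
have myS (S : set ('rV[R]_n * 'rV[R]_n)) y : measurable S ->
    measurable [set x | S (x, y)].
  move=> mS; have := measurable_ysection y mS; congr (measurable _).
  by apply/seteqP; split => x; rewrite /ysection/= inE.
have fub (S : set ('rV[R]_n * 'rV[R]_n)) : measurable S ->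
    (\int[mu]_x mu [set y | S (x, y)] = \int[mu]_y mu [set x | S (x, y)])%E.
  move=> mS; transitivity (\int[mu]_x \int[mu]_y (\1_S (x, y))%:E)%E.
    apply: eq_integral => x _; apply/esym/integral_indic_set; first exact: mxS.
    by move=> y; rewrite !indicE; congr (_%:R); apply/idP/idP; rewrite !inE.
  rewrite (@fubini_tonelli _ _ _ _ _ mu mu (fun p => (\1_S p)%:E))//.
    apply: eq_integral => y _; apply/integral_indic_set; first exact: myS.
    by move=> x; rewrite !indicE; congr (_%:R); apply/idP/idP; rewrite !inE.
  by apply/measurable_EFinP; exact: measurable_indic.
have intZ (C : set 'rV[R]_n) (c : \bar R) : measurable C -> (0 <= c)%E ->
    (\int[mu]_x ((\1_C x)%:E * c) = mu C * c)%E.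
  move=> mC c0; rewrite ge0_integralZr//.
  - by rewrite integral_indic// setIT.
  - by apply/measurable_EFinP; exact: measurable_indic.
transitivity (\int[mu]_x mu [set y | F (x, y)])%E.
  rewrite -intZ//; apply: eq_integral => x _; rewrite indicE.
  have [xA|xA] := boolP (x \in A).
    rewrite mul1e -(@lebesgue_rV_shift (x *m invmx M))//.
    congr (_ _); apply/seteqP; split => y /=; rewrite mulmxDl mulmxKV//.
      by move=> yB; split => //; rewrite inE in xA.
    by case.
  rewrite mul0e (_ : [set y | _] = set0) ?measure0//.
  by apply/seteqP; split => y //= -[xA' _]; move: xA; rewrite notin_setE.
rewrite fub//.
transitivity (\int[mu]_y mu [set x | G (x, y)])%E.
  apply: eq_integral => y _.
  rewrite -(@lebesgue_rV_shift (y *m M) [set x | G (x, y)]); last exact: myS.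
  congr (_ _); apply/seteqP; split => x /=; rewrite /F /G /= addrK addrC//.
rewrite -fub// muleC -intZ//; apply: eq_integral => x _; rewrite indicE.
have [xB|xB] := boolP (x \in B).
  rewrite mul1e -(@lebesgue_rV_shift (- (x *m invmx M)) [set y | A (y *m M)])//.
  congr (_ _); apply/seteqP; split => y /=; rewrite mulmxDl mulNmx mulmxKV//.
    by case=> Ay _; rewrite -As opprB.
  by rewrite -As opprB => Ay; split => //; rewrite inE in xB.
rewrite mul0e (_ : [set y | _] = set0) ?measure0//.
by apply/seteqP; split => y //= -[_ xB']; move: xB; rewrite notin_setE.
Qed.

End lebesgue_rV_affine.

(** * Change of variables for oriented cubes *)

Section similarities.
Context {R : realType} {n : nat}.
Notation mu := (@lebesgue_rV R n).
Implicit Types (A B : set 'rV[R]_n) (M : 'M[R]_n) (v w : 'rV[R]_n).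

Definition cube (r : R) : set 'rV[R]_n := [set v | forall i, `|v ord0 i| < r].

Lemma Q0E : @Q0 R n = cube (1 / 2).
Proof. by rewrite /Q0 /dilate_Q0 oner_eq0. Qed.

Lemma lebesgue_rV_cube (r : R) : 0 <= r ->
  mu (cube r) = ((2 * r) ^+ n)%:E.
Proof.
move=> r0; transitivity (\prod_(i < n) lebesgue_measure [set` `](- r), r[%R])%E.
  rewrite -lebesgue_rV_box//; congr (_ _).
  by apply/seteqP; split => v + i => /(_ i); rewrite /= in_itv/= ltr_norml.
rewrite -[X in _ ^+ X](card_ord n) -prodr_const -prodEFin; apply: eq_bigr => i _.
rewrite lebesgue_measure_itv/= lte_fin -subr_gt0 opprK -mulr2n -[in RHS]mulr_natl.
case: ltP => h; first by rewrite -EFinD -mulr2n mulr1 mulr_natl.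
congr (_%:E); apply/eqP; rewrite mulr1 mulr_natl eq_le h mulrn_wge0//.
Qed.

Lemma lebesgue_rV_Q0 : mu Q0 = 1%E.
Proof. by rewrite Q0E lebesgue_rV_cube ?divr_ge0// mulrC divfK ?pnatr_eq0// expr1n. Qed.

Lemma measurable_cube (r : R) : measurable (cube r).
Proof.
rewrite (_ : cube r = [set v : 'rV[R]_n | forall i, [set` `](- r), r[] (v ord0 i)]).
  by apply: (@measurable_coordwise _ _ (fun i => [set` `](- r), r[])).
by apply/seteqP; split => v + i => /(_ i); rewrite /= in_itv/= ltr_norml.
Qed.

Lemma measurable_Q0 : measurable (@Q0 R n).
Proof. by rewrite Q0E; exact: measurable_cube. Qed.

Lemma lebesgue_rV_le A B : measurable A -> measurable B -> A `<=` B ->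
  (mu A <= mu B)%E.
Proof. by move=> mA mB; apply: le_measure; exact: mem_set. Qed.

Lemma dotr_mulmx v w : dotr v w = (v *m w^T) ord0 ord0.
Proof. by rewrite mxE; apply: eq_bigr => i _; rewrite mxE. Qed.

Let ball_ (r : R) : set 'rV[R]_n := [set v | dotr v v < r].

Let mball_ r : measurable (ball_ r).
Proof.
rewrite -[X in measurable X]setTI.
have : measurable_fun setT (fun v : 'rV[R]_n => dotr v v).
  by apply: measurable_sum => i; apply: measurable_funM; exact: measurable_coord.
move=> mf; rewrite (_ : ball_ r = (fun v => dotr v v) @^-1` [set` `]-oo, r[]).
  exact: mf.
by apply/seteqP; split => v; rewrite /ball_ /= in_itv.
Qed.

Let ball_pos : (0 < mu (ball_ 1))%E.
Proof.
pose c : R := n.+1%:R^-1; have c0 : 0 < c by rewrite invr_gt0.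
have c1 : c <= 1 by rewrite invf_le1// ler1n.
apply: (@lt_le_trans _ _ (mu (cube c))).
  by rewrite lebesgue_rV_cube ?ltW// lte_fin exprn_gt0// mulr_gt0.
apply: lebesgue_rV_le => //; first exact: measurable_cube.
move=> v /= vc; rewrite /ball_ /= /dotr.
apply: (@le_lt_trans _ _ (\sum_(i < n) c)).
  apply: ler_sum => i _; have /ltW h := vc i.
  rewrite -[leLHS]ger0_norm -?expr2 ?sqr_ge0// normrX expr2.
  by rewrite -[leRHS]mulr1 ler_pM// (le_trans h).
rewrite sumr_const card_ord -mulr_natl /c ltr_pdivrMr// mul1r.
by rewrite ltr_nat.
Qed.

Let ball_fin : (mu (ball_ 1) < +oo)%E.
Proof.
apply: (@le_lt_trans _ _ (mu (cube 2))); last first.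
  by rewrite lebesgue_rV_cube// ltry.
apply: lebesgue_rV_le => //; first exact: measurable_cube.
move=> v; rewrite /ball_ /= /dotr => v1 i.
rewrite ltNge; apply/negP => v2; move: v1; apply/negP; rewrite -leNgt.
rewrite (bigD1 i)//= -[leLHS]addr0 lerD//; last first.
  by apply: sumr_ge0 => j _; rewrite -expr2 sqr_ge0.
rewrite -[leRHS]ger0_norm -?expr2 ?sqr_ge0// normrX expr2.
by rewrite -[leLHS]mulr1 ler_pM//; apply: le_trans v2; rewrite ler1n.
Qed.

Lemma mule_fin_inj (b x y : \bar R) : b \is a fin_num -> (0 < b)%E ->
  (b * x = b * y -> x = y)%E.
Proof.
case: b => // b _ b0 E; have H z : ((b^-1)%:E * (b%:E * z) = z)%E.
  by rewrite muleA -EFinM mulVf ?mul1e// gt_eqF.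
by rewrite -(H x) E H.
Qed.

(** The factor is identified on the Euclidean unit ball, whose preimage under
    [M] is the one under the homothety of ratio [l]; for a homothety the factor
    can be read off on the unit cube. *)
Lemma lebesgue_rV_similarity M (l : R) B : 0 < l -> M *m M^T = (l ^+ 2)%:M ->
  measurable B -> mu [set y | B (y *m M)] = ((l^-1 ^+ n)%:E * mu B)%E.
Proof.
move=> l0 MM mB.
have uM : M \in unitmx.
  have : M *m (l ^- 2 *: M^T) = 1%:M.
    by rewrite -scalemxAr MM scale_scalar_mx mulVf// expf_neq0// gt_eqF.
  by case/mulmx1_unit.
have ball_sym v : ball_ 1 (- v) <-> ball_ 1 v.
  rewrite /ball_ /= (_ : dotr (- v) (- v) = dotr v v)//.
  by apply: eq_bigr => i _; rewrite !mxE mulrNN.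
have E1 := lebesgue_rV_linear uM (mball_ 1) ball_sym mB.
have ul : (l%:M : 'M[R]_n) \in unitmx by rewrite unitmxE det_scalar unitfE expf_neq0// gt_eqF.
have Q0_sym (v : 'rV[R]_n) : Q0 (- v) <-> Q0 v.
  by rewrite Q0E; split => + i => /(_ i); rewrite mxE normrN.
have := lebesgue_rV_linear ul measurable_Q0 Q0_sym (mball_ 1).
rewrite lebesgue_rV_Q0 mul1e (_ : [set y | Q0 (y *m _)] = cube (l^-1 / 2)); last first.
  apply/seteqP; split => v; rewrite Q0E /= => + i => /(_ i);
  by rewrite mul_mx_scalar mxE normrM (gtr0_norm l0) -ltr_pdivlMl// div1r.
rewrite lebesgue_rV_cube ?divr_ge0 ?invr_ge0 ?ltW// (mulrC 2) divfK ?pnatr_eq0//.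
rewrite (_ : [set y | ball_ 1 (y *m l%:M)] = [set y | ball_ 1 (y *m M)]); last first.
  have dE v : dotr (v *m l%:M) (v *m l%:M) = dotr (v *m M) (v *m M).
    rewrite !dotr_mulmx !trmx_mul !mulmxA -(mulmxA v M) MM -(mulmxA v).
    by rewrite tr_scalar_mx -scalar_mxM expr2.
  by apply/seteqP; split => v; rewrite /ball_ /= dE.
move=> E2; move: E1; rewrite E2 => E1.
have bf : mu (ball_ 1) \is a fin_num by rewrite ge0_fin_numE// ltW.
by apply: (mule_fin_inj bf ball_pos); rewrite E1 muleCA muleA.
Qed.

Implicit Types (Q : ocube R n).

(** The edge vectors of [Q], as the rows of the linear part of [ocube_map Q]. *)
Definition frame Q : 'M[R]_n :=
  \matrix_(i, j) (2 * (face Q i - center Q) ord0 j).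

Lemma ocube_mapE Q y : ocube_map Q y = center Q + y *m frame Q.
Proof.
rewrite /ocube_map; congr (_ + _); apply/rowP => j; rewrite !mxE summxE.
by apply: eq_bigr => i _; rewrite !mxE mulrA (mulrC 2).
Qed.

Lemma frame_conformal Q : frame Q *m (frame Q)^T = (side Q ^+ 2)%:M.
Proof.
apply/matrixP => i j; rewrite !mxE.
transitivity (4 * dotr (face Q i - center Q) (face Q j - center Q)).
  by rewrite /dotr mulr_sumr; apply: eq_bigr => k _; rewrite !mxE mulrACA -natrM.
rewrite face_orthogonal mulrnAr; congr (_ *+ _).
by rewrite expr_div_n -natrX mulrC divfK// pnatr_eq0.
Qed.

Lemma frame_conformalT Q : (frame Q)^T *m frame Q = (side Q ^+ 2)%:M.
Proof.
have s0 : side Q ^+ 2 != 0 by rewrite expf_neq0// gt_eqF// side_gt0.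
have : frame Q *m (side Q ^- 2 *: (frame Q)^T) = 1%:M.
  by rewrite -scalemxAr frame_conformal scale_scalar_mx mulVf.
move=> /mulmx1C; rewrite -scalemxAl => /(congr1 (fun C : 'M[R]_n => side Q ^+ 2 *: C)).
by rewrite scalerA mulfV// scale1r scalemx1.
Qed.

Definition ocube_unmap Q (x : 'rV[R]_n) : 'rV[R]_n :=
  side Q ^- 2 *: ((x - center Q) *m (frame Q)^T).

Lemma ocube_mapK Q : cancel (ocube_map Q) (ocube_unmap Q).
Proof.
move=> y; rewrite /ocube_unmap ocube_mapE addrAC subrr add0r -mulmxA.
rewrite frame_conformal mul_mx_scalar scalerA mulVf ?scale1r//.
by rewrite expf_neq0// gt_eqF// side_gt0.
Qed.

Lemma ocube_unmapK Q : cancel (ocube_unmap Q) (ocube_map Q).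
Proof.
move=> x; rewrite /ocube_unmap ocube_mapE -scalemxAl -mulmxA frame_conformalT.
rewrite mul_mx_scalar scalerA mulVf ?scale1r ?subrKC//.
by rewrite expf_neq0// gt_eqF// side_gt0.
Qed.

Lemma carrier_preimage Q : ocube_map Q @^-1` carrier Q = Q0.
Proof.
apply/seteqP; split => [y [z z0 /(can_inj (@ocube_mapK Q)) <-]//|y y0].
by exists y.
Qed.

Lemma measurable_ocube_map Q : measurable_fun setT (ocube_map Q).
Proof.
rewrite (_ : ocube_map Q = (fun y => center Q + y *m frame Q)); last first.
  by apply/funext => y; rewrite ocube_mapE.
by apply: measurable_rVD; [exact: measurable_cst|exact: measurable_mulmx].
Qed.

Lemma measurable_carrier Q : measurable (carrier Q).
Proof.
rewrite (_ : carrier Q = ocube_unmap Q @^-1` Q0); last first.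
  apply/seteqP; split => [x [y y0 <-]|x x0]; first by rewrite /= ocube_mapK.
  by exists (ocube_unmap Q x) => //; rewrite ocube_unmapK.
apply: measurable_rV_preimage; last exact: measurable_Q0.
rewrite (_ : ocube_unmap Q = (fun x => (x + - center Q) *m (side Q ^- 2 *: (frame Q)^T))).
  apply: (measurableT_comp (measurable_mulmx _)).
  by apply: measurable_rVD => //; exact: measurable_cst.
by apply/funext => x; rewrite /ocube_unmap scalemxAr.
Qed.

Lemma lebesgue_rV_ocube_map Q B : measurable B ->
  mu (ocube_map Q @^-1` B) = ((((side Q)^-1) ^+ n)%:E * mu B)%E.
Proof.
move=> mB; rewrite -(lebesgue_rV_shift (center Q) mB).
rewrite -(lebesgue_rV_similarity (side_gt0 Q) (frame_conformal Q)).
  by congr (_ _); apply/seteqP; split => y /=; rewrite ocube_mapE addrC.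
apply: (@measurable_rV_preimage _ _ (fun v => v + center Q)) => //.
by apply: measurable_rVD => //; exact: measurable_cst.
Qed.

Lemma lebesgue_rV_carrier Q : mu (carrier Q) = (side Q ^+ n)%:E.
Proof.
have := lebesgue_rV_ocube_map Q (@measurable_carrier Q).
rewrite carrier_preimage lebesgue_rV_Q0 => /(congr1 (fun z => (side Q ^+ n)%:E * z)%E).
rewrite mule1 muleA -EFinM -exprMn mulfV ?expr1n ?mul1e//.
by rewrite gt_eqF// side_gt0.
Qed.

Lemma ge0_integral_ocube_map Q (F : 'rV[R]_n -> \bar R) :
  measurable_fun (carrier Q) F -> (forall x, 0 <= F x)%E ->
  (\int[mu]_(x in carrier Q) F x =
   (side Q ^+ n)%:E * \int[mu]_(y in Q0) F (ocube_map Q y))%E.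
Proof.
move=> mF F0.
have k0 : 0 <= (side Q)^-1 ^+ n by rewrite exprn_ge0// invr_ge0 ltW// side_gt0.
have mT := measurable_ocube_map Q.
rewrite -(carrier_preimage Q) -[X in (_ * X)%E](ge0_integral_pushforward mT)//; last first.
  exact: measurable_carrier.
pose m1 := measure_function_pushforward__canonical__measure_function_Measure mu mT.
rewrite (@eq_measure_integral _ _ _ _ (mscale (NngNum k0) mu) m1); last first.
  by move=> A mA _; rewrite /= /pushforward /mscale/= lebesgue_rV_ocube_map.
rewrite ge0_integral_mscale//=; last exact: measurable_carrier.
rewrite muleA -EFinM -exprMn mulfV ?expr1n ?mul1e//.
by rewrite gt_eqF// side_gt0.
Qed.

Lemma integrable_ocube_map Q (F : 'rV[R]_n -> \bar R) :
  mu.-integrable (carrier Q) F -> mu.-integrable Q0 (F \o ocube_map Q).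
Proof.
move=> /integrableP[mF iF]; apply/integrableP; split.
  rewrite -(carrier_preimage Q) => mQ Y mY.
  rewrite (_ : _ `&` _ = ocube_map Q @^-1` (carrier Q `&` F @^-1` Y))//.
  apply: (measurable_rV_preimage (measurable_ocube_map Q)).
  by apply: mF => //; exact: measurable_carrier.
move: iF; rewrite (@ge0_integral_ocube_map Q (fun x => `|F x|%E))//; last first.
  exact: measurableT_comp.
have s0 := exprn_gt0 n (side_gt0 Q).
case: (\int[mu]_(x in Q0) _)%E => [r _| |//]; first exact: ltry.
by rewrite gt0_muley// lte_fin.
Qed.

Lemma integral_ocube_map Q (F : 'rV[R]_n -> \bar R) :
  mu.-integrable (carrier Q) F ->
  (\int[mu]_(x in carrier Q) F x =
   (side Q ^+ n)%:E * \int[mu]_(y in Q0) F (ocube_map Q y))%E.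
Proof.
move=> iF; have /integrableP[mF _] := iF.
have iT := integrable_ocube_map iF.
rewrite integralE [in RHS]integralE.
rewrite (ge0_integral_ocube_map (measurable_funepos mF))//.
rewrite (ge0_integral_ocube_map (measurable_funeneg mF))//.
rewrite [RHS]muleBr//; last first.
  apply: fin_num_adde_defl; rewrite fin_numN.
  rewrite ge0_fin_numE ?integral_ge0//.
  by apply: integral_funeneg_lt_pinfty => //; exact: measurable_Q0.
by congr (_ * _ - _ * _)%E; apply: eq_integral => y _; rewrite ?funeposE ?funenegE.
Qed.

End similarities.

(** * One-variable calculus and a smooth step *)

Section one_variable.
Context {R : realType}.
Notation leb := (@lebesgue_measure R).
Implicit Types (f F a : R -> R) (t u c M : R).

Lemma is_derive_continuous f (df : R -> R) :
  (forall t : R, is_derive t 1 f (df t)) -> continuous f.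
Proof.
move=> h t; apply: differentiable_continuous; apply/derivable1_diffP.
by have [] := h t.
Qed.

(** Vanishing of [f] on a left half-line selects the antiderivative and lets it
    be defined globally from integrals over segments. *)
Lemma antiderivative_exists f c : continuous f -> (forall t, t <= c -> f t = 0) ->
  exists F, (forall t : R, is_derive t 1 F (f t)) /\ (forall t, t <= c -> F t = 0).
Proof.
move=> cf f0.
pose F t := \int[leb]_(s in `[c - 1, t]) f s.
have F0 t : t <= c -> F t = 0.
  move=> tc; rewrite /F; under eq_Rintegral => s.
    rewrite inE/= in_itv/= => /andP[_ st]; rewrite f0 ?(le_trans st)//; over.
  by rewrite /Rintegral integral0_eq.
exists F; split => // t.
have [tc|ct] := ltP t c.
  rewrite f0 ?ltW//; apply: (@near_eq_is_derive _ _ _ (cst 0)).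
    by near=> s; rewrite F0// ltW//; near: s; exact: lt_nbhsl.
have ct1 : c - 1 < t by rewrite ltrBlDr (le_lt_trans ct)// ltrDl.
have [||||dF F'] := @continuous_FTC1_closed _ f (c - 1) t (t + 1).
- by rewrite ltrDl.
- apply: continuous_compact_integrable; first exact: segment_compact.
  exact: continuous_subspaceT.
- by [].
- exact: cf.
by apply: DeriveDef; [exact: dF|rewrite -derive1E F'].
Unshelve. all: by end_near. Qed.

Lemma MVT_le F f u t M : u <= t -> (forall s : R, is_derive s 1 F (f s)) ->
  (forall s, u < s < t -> `|f s| <= M) -> 0 <= M -> `|F t - F u| <= M * (t - u).
Proof.
rewrite le_eqVlt => /predU1P[->|ut] dF fM M0; first by rewrite !subrr normr0 mulr0.
have [|c + ->] := @MVT _ F f u t ut (fun s _ => dF s).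
  exact/continuous_subspaceT/(is_derive_continuous dF).
rewrite in_itv/= => /fM fc; rewrite normrM ler_pM//.
by rewrite gtr0_norm// subr_gt0.
Qed.

Lemma antiderivative_const F f u t : (forall s : R, is_derive s 1 F (f s)) ->
  (forall s, u < s < t -> f s = 0) -> u <= t -> F t = F u.
Proof.
move=> dF f0 ut; apply/eqP; rewrite -subr_eq0 -normr_le0.
rewrite -(mul0r (t - u)); apply: (MVT_le ut dF) => // s /f0 ->.
by rewrite normr0.
Qed.

Lemma antiderivative_homo F f u t : (forall s : R, is_derive s 1 F (f s)) ->
  (forall s, u < s < t -> 0 <= f s) -> u <= t -> F u <= F t.
Proof.
rewrite le_eqVlt => dF f0 /predU1P[->//|ut].
have [|c + E] := @MVT _ F f u t ut (fun s _ => dF s).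
  exact/continuous_subspaceT/(is_derive_continuous dF).
rewrite in_itv/= => /f0 fc; rewrite -subr_ge0 E mulr_ge0//.
by rewrite subr_ge0 ltW.
Qed.

Lemma antiderivative_lt F f u t : (forall s : R, is_derive s 1 F (f s)) ->
  (forall s, u < s < t -> 0 < f s) -> u < t -> F u < F t.
Proof.
move=> dF f0 ut.
have [|c + E] := @MVT _ F f u t ut (fun s _ => dF s).
  exact/continuous_subspaceT/(is_derive_continuous dF).
rewrite in_itv/= => /f0 fc; rewrite -subr_gt0 E mulr_gt0//.
by rewrite subr_gt0.
Qed.

Definition C1 a := exists2 a' : R -> R, continuous a' & forall t : R, is_derive t 1 a (a' t).

Lemma C1_continuous a : C1 a -> continuous a.
Proof. by move=> [a' _ /is_derive_continuous]. Qed.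

Lemma C1_cst c : C1 (cst c).
Proof. by exists (cst 0) => [|t]; [exact: cst_continuous|exact: is_derive_cst]. Qed.

Lemma C1D a b : C1 a -> C1 b -> C1 (fun t => a t + b t).
Proof.
move=> [a' ca da] [b' cb db]; exists (fun t => a' t + b' t).
  by move=> t; apply: cvgD; [exact: ca|exact: cb].
by move=> t; exact: is_deriveD.
Qed.

Lemma C1M a b : C1 a -> C1 b -> C1 (fun t => a t * b t).
Proof.
move=> C1a C1b; have [a' ca da] := C1a; have [b' cb db] := C1b.
exists (fun t => a t * b' t + b t * a' t).
  move=> t; apply: cvgD; apply: cvgM.
  - exact: C1_continuous.
  - exact: cb.
  - exact: C1_continuous.
  - exact: ca.
move=> t; exact: is_deriveM.
Qed.

Lemma is_derive_affine a (a' : R) k c t : is_derive (k * t + c) 1 a a' ->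
  is_derive t 1 (fun s => a (k * s + c)) (k * a').
Proof.
move=> da; rewrite mulrC; apply: (@is_derive1_comp _ a (fun s => k * s + c)).
have : is_derive t 1 (fun s : R => k *: s + c) (k *: 1 + 0).
  by apply: is_deriveD; apply: is_deriveZ.
by rewrite addr0 [k *: 1]mulr1.
Qed.

Lemma C1_affine a k c : C1 a -> C1 (fun t => a (k * t + c)).
Proof.
move=> [a' ca da]; exists (fun t => k * a' (k * t + c)).
  move=> t; apply: cvgM; first exact: cvg_cst.
  apply: (@continuous_comp _ _ _ (fun t => k * t + c) a'); last exact: ca.
  by apply: cvgD; [apply: cvgM => //; exact: cvg_cst|exact: cvg_cst].
by move=> t; apply: is_derive_affine.
Qed.

Lemma C1_sum (I : Type) (r : seq I) (h : I -> R -> R) :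
  (forall i, C1 (h i)) -> C1 (fun t => \sum_(i <- r) h i t).
Proof.
move=> Ch; elim: r => [|i r IH].
  by under eq_fun do rewrite big_nil; exact: C1_cst.
by under eq_fun do rewrite big_cons; exact: C1D.
Qed.

(** A C^2 step from 0 to 1 carried by the middle half of the unit interval. *)
Definition is_step (S s : R -> R) (C : R) :=
  [/\ forall t : R, is_derive t 1 S (s t), C1 s,
      forall t, t <= 1 / 4 -> S t = 0 /\ s t = 0,
      forall t, 3 / 4 <= t -> S t = 1 /\ s t = 0 &
      [/\ forall t, 0 <= S t <= 1, forall t, `|s t| <= C & 0 < s (1 / 2)]].

(** The derivative of the step is a normalized product of two functions
    p(t - 1/4) p(3/4 - t), where [p] is the C^1 function t_+^2 / 2. *)
Lemma step_exists : exists S s C, is_step S s C.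
Proof.
have [p [dp p0]] : exists p, (forall t : R, is_derive t 1 p (Num.max t 0)) /\
    (forall t, t <= 0 -> p t = 0).
  apply: antiderivative_exists => [|t t0]; last exact: max_r.
  by move=> t; apply: continuous_max; [exact: cvg_id|exact: cst_continuous].
have pp t : 0 < t -> 0 < p t.
  move=> t0; rewrite -(p0 0 (lexx _)).
  apply: (antiderivative_lt dp) => // s /andP[s0 _].
  by rewrite lt_max s0.
have pge t : 0 <= p t.
  by have [/p0->//|/pp/ltW] := leP t 0.
have C1p : C1 p.
  exists (fun t => Num.max t 0) => // t.
  by apply: continuous_max; [exact: cvg_id|exact: cst_continuous].
pose s0 t := p (1 * t + - (1 / 4)) * p (- 1 * t + 3 / 4).
have C1s0 : C1 s0 by apply: C1M; exact: C1_affine.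
have s0l t : t <= 1 / 4 -> s0 t = 0.
  by move=> t4; rewrite /s0 p0 ?mul0r// mul1r subr_le0.
have s0r t : 3 / 4 <= t -> s0 t = 0.
  by move=> t4; rewrite /s0 mulrC p0 ?mul0r// mulN1r addrC subr_le0.
have s0p t : 1 / 4 < t < 3 / 4 -> 0 < s0 t.
  move=> /andP[t1 t2]; rewrite /s0 mulr_gt0//; apply: pp.
    by rewrite mul1r subr_gt0.
  by rewrite mulN1r addrC subr_gt0.
have s0ge t : 0 <= s0 t by rewrite mulr_ge0.
have [S0 [dS0 S00]] := antiderivative_exists (C1_continuous C1s0) s0l.
have l13 : (1 / 4 : R) < 3 / 4 by rewrite ltr_pM2r ?invr_gt0// ltr1n.
pose Z := S0 (3 / 4); have Z0 : 0 < Z.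
  rewrite -(S00 (1 / 4) (lexx _)).
  by apply: (antiderivative_lt dS0) => // t; exact: s0p.
have [c _ cmax] := @EVT_max _ s0 (1 / 4) (3 / 4) (ltW l13)
  (continuous_subspaceT (C1_continuous C1s0)).
exists (fun t => Z^-1 *: S0 t), (fun t => Z^-1 * s0 t), (Z^-1 * s0 c).
have S0r t : 3 / 4 <= t -> S0 t = Z.
  move=> tr; apply: (antiderivative_const dS0) => // s /andP[/ltW/s0r-> //].
split.
- by move=> t; apply: is_deriveZ.
- by apply: C1M; [exact: C1_cst|].
- by move=> t t4; rewrite S00// s0l// scaler0 mulr0.
- by move=> t t4; rewrite S0r// s0r// mulr0 /GRing.scale/= mulVf// gt_eqF.
split.
- move=> t; rewrite /GRing.scale/=; have h : 0 <= S0 t <= Z.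
    have [t1|t1] := leP t (1 / 4); first by rewrite S00// lexx ltW.
    have [t2|t2] := leP (3 / 4) t; first by rewrite S0r// lexx ltW.
    rewrite -{1}(S00 (1 / 4) (lexx _)) /Z.
    by apply/andP; split; apply: (antiderivative_homo dS0); rewrite // ltW.
  case/andP: h => h1 h2; rewrite mulr_ge0 ?invr_ge0 ?(ltW Z0)//=.
  by rewrite mulrC ler_pdivrMr// mul1r.
- move=> t; rewrite ger0_norm ?mulr_ge0 ?invr_ge0 ?(ltW Z0)//.
  rewrite ler_wpM2l ?invr_ge0 ?(ltW Z0)//.
  have [t1|t1] := leP t (1 / 4); first by rewrite s0l.
  have [t2|t2] := leP (3 / 4) t; first by rewrite s0r.
  by apply: cmax; rewrite in_itv/= !ltW.
- rewrite mulr_gt0 ?invr_gt0// s0p//; apply/andP; split.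
    by rewrite ltr_pM2l// ltf_pV2 ?posrE// ltr_nat.
  have E4 : (4 : R) = 2 * 2 by rewrite -natrM.
  by rewrite ltr_pdivlMr// E4 mulrA divfK ?pnatr_eq0// mul1r ltr_nat.
Qed.

End one_variable.

(** * Test functions of product type *)

Section tensor_functions.
Context {R : realType} {n : nat}.
Implicit Types (x y v : 'rV[R]_n) (i k : 'I_n) (a b : 'I_n -> R -> R).
Implicit Types (phi psi : 'rV[R]_n -> R).

Definition C1_rV phi := (forall x, differentiable phi x) /\
  (forall i, continuous ('D_(delta_mx ord0 i) phi)).

Lemma C1_rV_continuous phi : C1_rV phi -> continuous phi.
Proof. by move=> [d _] x; exact: differentiable_continuous. Qed.

Lemma C1_rV_derivable phi x v : C1_rV phi -> derivable phi x v.
Proof. by move=> [d _]; exact: diff_derivable. Qed.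

Lemma C1_rV_cst (c : R) : C1_rV (fun=> c).
Proof.
split=> [x|i]; first exact: differentiable_cst.
rewrite (_ : 'D_ _ _ = cst 0); first exact: cst_continuous.
by apply/funext => x; rewrite derive_cst.
Qed.

Lemma derive_rVD phi psi x v : C1_rV phi -> C1_rV psi ->
  'D_v (fun y => phi y + psi y) x = 'D_v phi x + 'D_v psi x.
Proof. by move=> C1p C1q; apply: deriveD; exact: C1_rV_derivable. Qed.

Lemma derive_rVM phi psi x v : C1_rV phi -> C1_rV psi ->
  'D_v (fun y => phi y * psi y) x = phi x * 'D_v psi x + psi x * 'D_v phi x.
Proof. by move=> C1p C1q; apply: deriveM; exact: C1_rV_derivable. Qed.

Lemma C1_rVD phi psi : C1_rV phi -> C1_rV psi -> C1_rV (fun x => phi x + psi x).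
Proof.
move=> C1p C1q; split=> [x|i].
  by apply: differentiableD; [exact: C1p.1|exact: C1q.1].
rewrite (_ : 'D_ _ _ = fun x => 'D_(delta_mx ord0 i) phi x + 'D_(delta_mx ord0 i) psi x).
  by move=> x; exact: (cvgD (C1p.2 i x) (C1q.2 i x)).
by apply/funext => x; rewrite derive_rVD.
Qed.

Lemma C1_rVM phi psi : C1_rV phi -> C1_rV psi -> C1_rV (fun x => phi x * psi x).
Proof.
move=> C1p C1q; split=> [x|i].
  by apply: differentiableM; [exact: C1p.1|exact: C1q.1].
rewrite (_ : 'D_ _ _ = fun x => phi x * 'D_(delta_mx ord0 i) psi x +
    psi x * 'D_(delta_mx ord0 i) phi x).
  move=> x; have cp : {for x, continuous phi} by exact: C1_rV_continuous.
  have cq : {for x, continuous psi} by exact: C1_rV_continuous.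
  exact: (cvgD (cvgM cp (C1q.2 i x)) (cvgM cq (C1p.2 i x))).
by apply/funext => x; rewrite derive_rVM.
Qed.

Lemma derive_coord k v (f f' : R -> R) x :
  (forall t : R, is_derive t 1 f (f' t)) ->
  'D_v (fun y : 'rV[R]_n => f (y ord0 k)) x = v ord0 k * f' (x ord0 k).
Proof.
move=> df; pose c := fun y : 'rV[R]_n => y ord0 k.
have dc : differentiable c x by exact: differentiable_coord.
have dfx : differentiable f (c x).
  by apply/derivable1_diffP; have [] := df (c x).
have -> : (fun y : 'rV[R]_n => f (y ord0 k)) = f \o c by [].
rewrite deriveE; last exact: differentiable_comp.
rewrite diff_comp//= deriv1E; last by have [] := df (c x).
rewrite derive1E; have [_ ->] := df (c x).
have -> : 'd c x v = v ord0 k; last by [].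
rewrite -deriveE// /derive; apply/cvg_lim => //.
apply: cvg_near_cst.
near=> h; rewrite /c/= !mxE addrK scalerA mulVf ?scale1r//.
by near: h; exact: nbhs_dnbhs_neq.
Unshelve. all: by end_near. Qed.

Lemma C1_rV_coord k (f : R -> R) : C1 f -> C1_rV (fun x => f (x ord0 k)).
Proof.
move=> C1f; have [f' cf' df] := C1f; split=> [x|i].
  apply: (@differentiable_comp _ _ _ _ (fun y : 'rV[R]_n => y ord0 k) f).
    exact: differentiable_coord.
  by apply/derivable1_diffP; have [] := df (x ord0 k).
rewrite (_ : 'D_ _ _ = fun x : 'rV[R]_n => (delta_mx ord0 i : 'rV[R]_n) ord0 k * f' (x ord0 k)).
  move=> x; have h : {for x, continuous (fun y : 'rV[R]_n => f' (y ord0 k))}.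
    apply: (@continuous_comp _ _ _ (fun y : 'rV[R]_n => y ord0 k) f').
      exact: coord_continuous.
    exact: cf'.
  exact: (cvgM (cvg_cst _) h).
by apply/funext => x; exact: derive_coord.
Qed.

Definition tensor a x : R := \prod_i a i (x ord0 i).

Lemma C1_rV_tensor a : (forall k, C1 (a k)) -> C1_rV (tensor a).
Proof.
move=> Ca; rewrite /tensor; elim: (index_enum _) => [|k r IH].
  by under eq_fun do rewrite big_nil; exact: C1_rV_cst.
by under eq_fun do rewrite big_cons; apply: C1_rVM => //; exact: C1_rV_coord.
Qed.

Definition subst x i (t : R) : 'rV[R]_n := \row_k (if k == i then t else x ord0 k).

Lemma substE x i t k : subst x i t ord0 k = if k == i then t else x ord0 k.
Proof. by rewrite mxE. Qed.

Lemma subst_id x i : subst x i (x ord0 i) = x.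
Proof. by apply/rowP => k; rewrite substE; case: eqVneq => // ->. Qed.

Lemma subst_subst x i t s : subst (subst x i t) i s = subst x i s.
Proof. by apply/rowP => k; rewrite !substE; case: eqVneq. Qed.

(** A partial derivative is the derivative of the restriction to a line. *)
Lemma derive_subst phi x i d :
  is_derive (x ord0 i) 1 (fun s : R => phi (subst x i s)) d ->
  'D_(delta_mx ord0 i) phi x = d.
Proof.
move=> [_ <-]; rewrite /derive; set F := fun h : R => h^-1 *: _; set G := fun h : R => h^-1 *: _.
suff -> : F = G by [].
apply/funext => h; rewrite /F /G /=; congr (_ *: (phi _ - phi _)).
  apply/rowP => k; rewrite substE !mxE eqxx/= [h *: 1]mulr1.
  by case: eqVneq => [->|_]; rewrite ?mulr1// mulr0 add0r.
by rewrite subst_id.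
Qed.

Definition upd a i (f : R -> R) : 'I_n -> R -> R := fun k => if k == i then f else a k.

Lemma tensor_upd a i f x :
  tensor (upd a i f) x = f (x ord0 i) * \prod_(k | k != i) a k (x ord0 k).
Proof.
rewrite /tensor (bigD1 i)//= /upd eqxx; congr (_ * _).
by apply: eq_bigr => k /negbTE ->.
Qed.

Lemma tensor_upd_subst a i f x t :
  tensor (upd a i f) (subst x i t) = f t * \prod_(k | k != i) a k (x ord0 k).
Proof.
rewrite tensor_upd substE eqxx; congr (_ * _).
by apply: eq_bigr => k /negbTE ki; rewrite substE ki.
Qed.

Lemma tensor_split a i x :
  tensor a x = a i (x ord0 i) * \prod_(k | k != i) a k (x ord0 k).
Proof. by rewrite /tensor (bigD1 i). Qed.

(** Sums of products of one-variable functions: an operation in a single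
    coordinate acts on a single factor, which is what the discretization uses. *)
Inductive tensor_span (P : 'I_n -> (R -> R) -> Prop) : ('rV[R]_n -> R) -> Prop :=
| TensorSpan c a : (forall k, P k (a k)) -> tensor_span P (fun x => c * tensor a x)
| TensorSpanD phi psi : tensor_span P phi -> tensor_span P psi ->
    tensor_span P (fun x => phi x + psi x).

Lemma tensor_spanS (P P' : 'I_n -> (R -> R) -> Prop) phi :
  (forall k f, P k f -> P' k f) -> tensor_span P phi -> tensor_span P' phi.
Proof.
move=> PP'; elim=> [c a Pa|]; last by move=> *; exact: TensorSpanD.
by apply: TensorSpan => k; exact: PP'.
Qed.

Lemma tensor_spanZ P (c : R) phi : tensor_span P phi ->
  tensor_span P (fun x => c * phi x).
Proof.
elim=> [d a Pa|f g _ IHf _ IHg].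
  by under eq_fun do rewrite mulrA; exact: TensorSpan.
by under eq_fun do rewrite mulrDr; exact: TensorSpanD.
Qed.

Lemma tensor_spanM (P : 'I_n -> (R -> R) -> Prop) phi psi :
  (forall k f g, P k f -> P k g -> P k (fun t => f t * g t)) ->
  tensor_span P phi -> tensor_span P psi ->
  tensor_span P (fun x => phi x * psi x).
Proof.
move=> PM + spsi; elim=> [c a Pa|f g _ IHf _ IHg]; last first.
  by under eq_fun do rewrite mulrDl; exact: TensorSpanD.
elim: spsi => [d b Pb|f g _ IHf _ IHg]; last first.
  by under eq_fun do rewrite mulrDr; exact: TensorSpanD.
rewrite (_ : (fun _ => _) = fun x => c * d * tensor (fun k t => a k t * b k t) x).
  by apply: TensorSpan => k; exact: PM.
by apply/funext => x; rewrite /tensor big_split/= mulrACA.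
Qed.

Lemma tensor_span_C1 (P : 'I_n -> (R -> R) -> Prop) phi :
  (forall k f, P k f -> C1 f) -> tensor_span P phi -> C1_rV phi.
Proof.
move=> PC; elim=> [c a Pa|f g _ IHf _ IHg]; last exact: C1_rVD.
by apply: C1_rVM; [exact: C1_rV_cst|apply: C1_rV_tensor => k; exact/PC/Pa].
Qed.

Definition bump (f : R -> R) :=
  C1 f /\ exists2 r, r < 1 / 2 & forall t, r <= `|t| -> f t = 0.

Lemma bumpM f g : bump f -> bump g -> bump (fun t => f t * g t).
Proof.
move=> [Cf [r r2 fr]] [Cg _]; split; first exact: C1M.
by exists r => // t /fr ->; rewrite mul0r.
Qed.

Lemma bumpMr f g : bump f -> C1 g -> bump (fun t => f t * g t).
Proof.
move=> [Cf [r r2 fr]] Cg; split; first exact: C1M.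
by exists r => // t /fr ->; rewrite mul0r.
Qed.

Definition test := tensor_span (fun=> bump).

Lemma test_C1 phi : test phi -> C1_rV phi.
Proof. by apply: tensor_span_C1 => k f []. Qed.

Lemma testM phi psi : test phi -> test psi -> test (fun x => phi x * psi x).
Proof. by apply: tensor_spanM => _; exact: bumpM. Qed.

Lemma test_supp phi : test phi ->
  exists2 r, r < 1 / 2 & forall x i, r <= `|x ord0 i| -> phi x = 0.
Proof.
have h0 : (0 : R) < 1 / 2 by rewrite divr_gt0.
elim=> [c a Pa|f g _ [r r2 fr] _ [s s2 gs]].
  pose r k := projT1 (cid2 (Pa k).2).
  have rP k : r k < 1 / 2 /\ forall t, r k <= `|t| -> a k t = 0.
    by rewrite /r; case: cid2.
  exists (\big[Num.max/0]_k r k).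
    by apply: bigmax_lt => // k _; have [] := rP k.
  move=> x k xr; rewrite (tensor_split a k) (rP k).2 ?mul0r ?mulr0//.
  by apply: le_trans xr; exact: le_bigmax.
exists (Num.max r s) => [|x i]; first by rewrite gt_max r2.
by rewrite ge_max => /andP[/fr -> /gs ->]; rewrite addr0.
Qed.

Lemma test_out phi x : test phi -> ~ Q0 x -> phi x = 0.
Proof.
move=> /test_supp[r r2 rphi] xQ0.
have [i] : exists i, ~ `|x ord0 i| < 1 / 2.
  by apply/existsNP; rewrite Q0E in xQ0.
by move=> /negP; rewrite -leNgt => /(le_trans (ltW r2)); exact: rphi.
Qed.

End tensor_functions.

(** * Discretization of test functions *)

Section discretization.
Context {R : realType} {n : nat}.
Variables (S s : R -> R) (C : R) (N : nat).
Hypotheses (stepS : is_step S s C) (N0 : (0 < N)%N).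
Implicit Types (x y v : 'rV[R]_n) (i : 'I_n) (k m : nat) (t : R).

Let N0R : (0 : R) < N%:R. Proof. by rewrite ltr0n. Qed.
Let N0' : (N%:R : R) != 0. Proof. by rewrite gt_eqF. Qed.

(** Affine coordinate mapping the m-th of the [N] cells of [-1/2, 1/2] to
    the unit interval, and its left end point. *)
Definition arg (m : nat) (t : R) : R := N%:R * t + (N%:R / 2 - m%:R).
Definition node (m : nat) : R := m%:R / N%:R - 1 / 2.

Lemma arg_node_sub m t : arg m t = N%:R * (t - node m).
Proof.
rewrite /arg /node [RHS]mulrBr mulrBr opprB [N%:R * (m%:R / _)]mulrC divfK//.
by rewrite [N%:R * (1 / 2)]mulrA mulr1.
Qed.

Lemma arg_node m k : arg m (node k) = k%:R - m%:R.
Proof. by rewrite arg_node_sub /node opprB addrA subrK -mulrBl mulrC divfK. Qed.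

Lemma node0 : node 0 = - (1 / 2). Proof. by rewrite /node mul0r sub0r. Qed.

Lemma nodeN : node N = 1 / 2.
Proof. by rewrite /node mulfV// [X in X - _](splitr 1) addrK. Qed.

Lemma nodeS m : node m.+1 - node m = N%:R^-1.
Proof. by rewrite /node opprB addrA subrK -mulrBl -natrB// subSnn mul1r. Qed.

Lemma node_le m k : (m <= k)%N -> node m <= node k.
Proof. by move=> mk; rewrite /node lerD2r ler_pM2r ?invr_gt0// ler_nat. Qed.

Lemma arg_lt0 m t : t <= node m -> arg m t <= 1 / 4.
Proof.
move=> tm; apply: (@le_trans _ _ 0); last by rewrite divr_ge0.
by rewrite arg_node_sub pmulr_rle0// subr_le0.
Qed.

Lemma arg_gt1 m t : node m.+1 <= t -> 3 / 4 <= arg m t.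
Proof.
move=> tm; apply: (@le_trans _ _ 1); first by rewrite ler_pdivrMr// mul1r ler_nat.
by rewrite arg_node_sub -ler_pdivrMl// mulr1 -(nodeS m) lerD2r.
Qed.

Lemma C_ge0 : 0 <= C.
Proof. by have [_ _ _ _ [_ H _]] := stepS; exact: le_trans (H 0). Qed.

(** Smooth interpolation of [A] between its values at the nodes, constant near
    each node. *)
Definition interp (A : R -> R) (t : R) : R :=
  \sum_(m < N) (A (node m.+1) - A (node m)) * S (arg m t).

Definition dinterp (A : R -> R) (t : R) : R :=
  \sum_(m < N) (A (node m.+1) - A (node m)) * (N%:R * s (arg m t)).

Lemma is_derive_interp (A : R -> R) t : is_derive t 1 (interp A) (dinterp A t).
Proof.
have [dS _ _ _ _] := stepS.
rewrite /interp /dinterp.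
have h (m : 'I_N) : is_derive t 1
    (fun t => (A (node m.+1) - A (node m)) * S (arg m t))
    ((A (node m.+1) - A (node m)) * (N%:R * s (arg m t))).
  by apply: is_deriveZ; apply: is_derive_affine.
have := @is_derive_sum _ _ _ N (fun (m : 'I_N) t => (A (node m.+1) - A (node m)) * S (arg m t)) t 1 _ h.
by congr (is_derive _ _ _ _); apply/funext => u; rewrite fct_sumE.
Qed.

Lemma interp_left A t (k : nat) : (forall m, (m < k)%N -> node m.+1 <= t) ->
  \sum_(m < k) (A (node m.+1) - A (node m)) * S (arg m t) = A (node k) - A (node 0).
Proof.
have [_ _ _ Sr _] := stepS => kt.
transitivity (\sum_(m < k) (A (node m.+1) - A (node m))).
  by apply: eq_bigr => m _; have [->//] := Sr _ (arg_gt1 (kt m (ltn_ord m))); rewrite mulr1.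
by rewrite -(big_mkord xpredT (fun m => A (node m.+1) - A (node m))) telescope_sumr.
Qed.

(** In the cell containing [t] both functions start from the same value, and
    neither moves by more than [M / N] on the cell. *)
Lemma interp_bound A a M t : (forall u : R, is_derive u 1 A (a u)) ->
  (forall u, `|a u| <= M) -> node 0 <= t <= node N -> A (node 0) = 0 ->
  `|A t - interp A t| <= 2 * M / N%:R.
Proof.
move=> dA aM /andP[t0 tN] A0.
have M0 : 0 <= M := le_trans (normr_ge0 _) (aM 0).
have [_ _ Sl Sr [S01 _ _]] := stepS.
suff /(_ N tN) : forall k, t <= node k ->
    `|A t - \sum_(m < k) (A (node m.+1) - A (node m)) * S (arg m t)| <= 2 * M / N%:R.
  by [].
elim=> [t0'|k IH tk].
  have -> : t = node 0 by apply/eqP; rewrite eq_le t0 t0'.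
  by rewrite big_ord0 A0 subrr normr0 divr_ge0 ?mulr_ge0// ltW.
rewrite big_ord_recr/=; have [tk'|/ltW tk'] := leP t (node k).
  by have [-> _] := Sl _ (arg_lt0 tk'); rewrite mulr0 addr0; exact: IH.
rewrite interp_left ?A0 ?subr0; last first.
  by move=> m mk; apply: le_trans tk'; exact: node_le.
have h1 : `|A t - A (node k)| <= M / N%:R.
  apply: le_trans (MVT_le tk' dA (fun u _ => aM u) M0) _.
  by rewrite ler_wpM2l// -(nodeS k) lerD2r.
have h2 : `|A (node k.+1) - A (node k)| <= M / N%:R.
  apply: le_trans (MVT_le (node_le (leqnSn k)) dA (fun u _ => aM u) M0) _.
  by rewrite nodeS.
rewrite opprD addrA (le_trans (ler_normB _ _))// -mulrA mulr_natl mulr2n lerD//.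
rewrite normrM (le_trans _ h2)// -[leRHS]mulr1 ler_wpM2l//.
by have /andP[s0 s1] := S01 (arg k t); rewrite ger0_norm.
Qed.

(** The bumps have disjoint supports, so the sum has at most one non-zero term. *)
Lemma sum_bumps_bound t : \sum_(m < N) `|s (arg m t)| <= C.
Proof.
have [_ _ Sl Sr [_ sC _]] := stepS.
suff /(_ N) [] : forall k, \sum_(m < k) `|s (arg m t)| <= C /\
    (node k <= t -> \sum_(m < k) `|s (arg m t)| = 0) by [].
elim=> [|k [IH IH0]]; first by rewrite big_ord0; split => //; exact: C_ge0.
rewrite big_ord_recr/=; split.
  have [tk'|/ltW tk'] := leP t (node k).
    by have [_ ->] := Sl _ (arg_lt0 tk'); rewrite normr0 addr0.
  by rewrite IH0// add0r.
move=> kt; rewrite IH0 ?add0r; last by apply: le_trans kt; exact: node_le.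
by have [_ ->] := Sr _ (arg_gt1 kt); rewrite normr0.
Qed.

Lemma dinterp_bound A a M t : (forall u : R, is_derive u 1 A (a u)) ->
  (forall u, `|a u| <= M) -> `|dinterp A t| <= C * M.
Proof.
move=> dA aM; have M0 : 0 <= M := le_trans (normr_ge0 _) (aM 0).
apply: le_trans (ler_norm_sum _ _ _) _.
apply: (@le_trans _ _ (\sum_(m < N) `|s (arg m t)| * M)); last first.
  by rewrite -mulr_suml ler_wpM2r// sum_bumps_bound.
apply: ler_sum => m _; rewrite normrM mulrC normrM (gtr0_norm N0R).
rewrite [X in X * _]mulrC -mulrA ler_wpM2l//.
rewrite -ler_pdivlMl// mulrC.
apply: le_trans (MVT_le (node_le (leqnSn m)) dA (fun u _ => aM u) M0) _.
by rewrite nodeS.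
Qed.

Definition discrete (f : R -> R) :=
  exists c : 'I_N -> R, forall t, f t = \sum_(m < N) c m * s (arg m t).

(** The outermost bumps stay a quarter of a cell away from the faces of the cube,
    so their products are test functions. *)
Let margin : R := 1 / 2 - 1 / 4 / N%:R.

Let margin_lt : margin < 1 / 2.
Proof. by rewrite /margin ltrBlDr ltrDl !divr_gt0. Qed.

Let margin_ge0 : 0 <= margin.
Proof.
rewrite /margin subr_ge0 ler_pdivrMr// (@le_trans _ _ (1 / 2))//.
  by rewrite !mul1r lef_pV2 ?posrE// ler_nat.
by rewrite -[leLHS]mulr1 ler_wpM2l ?divr_ge0// ler1n.
Qed.

Lemma arg_marginl t m : margin <= `|t| -> t <= 0 -> arg m t <= 1 / 4.
Proof.
move=> mt t0; rewrite ler0_norm// in mt.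
apply: (@le_trans _ _ (arg m (- margin))).
  by rewrite /arg lerD2r ler_wpM2l// lerNr.
rewrite /arg /margin mulrN mulrBr [X in - (_ - X)]mulrCA mulfV// mulr1 mul1r.
by rewrite opprB addrA subrK lerBlDr lerDl.
Qed.

Lemma arg_marginr t m : (m < N)%N -> margin <= `|t| -> 0 <= t -> 3 / 4 <= arg m t.
Proof.
move=> mN mt t0; rewrite ger0_norm// in mt.
apply: (@le_trans _ _ (arg m margin)); last by rewrite /arg lerD2r ler_wpM2l.
rewrite /arg /margin mulrBr [X in _ - X]mulrCA mulfV// mulr1 mul1r.
have E : (3 / 4 : R) = 1 - 1 / 4.
  rewrite -[X in X - _](@mulfV _ 4) ?pnatr_eq0// -mulrBl; congr (_ / _).
  by apply/eqP; rewrite eq_sym subr_eq -natr1.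
have -> : N%:R / 2 - 1 / 4 + (N%:R / 2 - m%:R) = N%:R - m%:R - 1 / 4 :> R.
  by rewrite addrACA -splitr addrA addrAC.
rewrite E lerD2r.
by rewrite lerBrDr -[1]/(1%:R) -natrD ler_nat add1n.
Qed.

(** Neither [A] nor its interpolation vanishes near the right end of the
    interval when the integral of [f] is not zero, but both are equal there to
    the same constant; hence the difference is again a bump. *)
Lemma bump_interp (f : R -> R) : bump f ->
  exists A, [/\ forall t : R, is_derive t 1 A (f t), A (node 0) = 0,
    bump (fun t => A t - interp A t), bump (dinterp A) & discrete (dinterp A)].
Proof.
have [dS C1s Sl Sr _] := stepS.
move=> [Cf [r r2 fr]].
pose r' := Num.max r 0.
have r'2 : r' < 1 / 2 by rewrite gt_max r2 divr_gt0.
have fr' t : r' <= `|t| -> f t = 0 by rewrite ge_max => /andP[/fr].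
have r'0 : 0 <= r' by rewrite le_max lexx orbT.
have [A [dA A0]] : exists A, (forall t : R, is_derive t 1 A (f t)) /\
    (forall t, t <= - r' -> A t = 0).
  apply: antiderivative_exists; first exact: C1_continuous.
  by move=> t tr; rewrite fr'// ler0_norm 1?lerNr// (le_trans tr)// oppr_le0.
have A1 t : r' <= t -> A t = A (1 / 2).
  suff H u : r' <= u -> A u = A r' by move=> h; rewrite H// H// ltW.
  move=> ru; apply: (antiderivative_const dA) => // w /andP[rw _].
  by rewrite fr'// ger0_norm ltW// (le_lt_trans r'0).
have A00 : A (node 0) = 0 by rewrite A0// node0 lerN2 ltW.
have rr : Num.max r' margin < 1 / 2 by rewrite gt_max r'2.
exists A; split => //.
- split.
    apply: C1D; first by exists f => //; exact: C1_continuous.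
    rewrite (_ : (fun t => _) = fun t => -1 * interp A t); last first.
      by apply/funext => t; rewrite mulN1r.
    apply: C1M; first exact: C1_cst.
    apply: C1_sum => m; apply: C1M; first exact: C1_cst.
    by apply: C1_affine; exists s => //; exact: C1_continuous.
  exists (Num.max r' margin) => // t; rewrite ge_max => /andP[rt mt].
  have [t0|/ltW t0] := leP t 0.
    rewrite A0; last by rewrite lerNr -(ler0_norm t0).
    rewrite /interp big1 ?subr0// => m _.
    by have [-> _] := Sl _ (arg_marginl m mt t0); rewrite mulr0.
  rewrite A1; last by rewrite -(ger0_norm t0).
  rewrite /interp; under eq_bigr => m _.
    have [-> _] := Sr _ (arg_marginr (ltn_ord m) mt t0).
    by rewrite mulr1; over.
  rewrite -(big_mkord xpredT (fun m => A (node m.+1) - A (node m))) telescope_sumr//.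
  by rewrite nodeN A00 subr0 subrr.
- split.
    apply: C1_sum => m; apply: C1M; first exact: C1_cst.
    by apply: C1M; [exact: C1_cst|exact: C1_affine].
  exists margin => // t mt; rewrite /dinterp big1// => m _.
  have [t0|/ltW t0] := leP t 0.
    by have [_ ->] := Sl _ (arg_marginl m mt t0); rewrite !mulr0.
  by have [_ ->] := Sr _ (arg_marginr (ltn_ord m) mt t0); rewrite !mulr0.
- exists (fun m => (A (node m.+1) - A (node m)) * N%:R) => t.
  by apply: eq_bigr => m _; rewrite mulrA.
Qed.

(** The intermediate stage of the discretization, after [j] coordinates. *)
Definition partially_discrete (j : nat) (k : 'I_n) (f : R -> R) :=
  bump f /\ ((k < j)%N -> discrete f).

(** The primitive [Psi] in the i-th coordinate is not a test function, since
    it need not vanish on the right face; its difference with its interpolation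
    is one, and the derivative of the interpolation is a combination of bumps in
    that coordinate. *)
Lemma discretize_antiderivative (i : 'I_n) (psi : 'rV[R]_n -> R) :
  tensor_span (partially_discrete i) psi ->
  exists Psi : 'rV[R]_n -> R,
  [/\ forall x (t : R), is_derive t 1 (fun u => Psi (subst x i u)) (psi (subst x i t)),
      forall x, Psi (subst x i (node 0)) = 0,
      test (fun x => Psi x - interp (fun u => Psi (subst x i u)) (x ord0 i)) &
      tensor_span (partially_discrete i.+1)
        (fun x => dinterp (fun u => Psi (subst x i u)) (x ord0 i))].
Proof.
elim=> [c a Pa|f g _ [F [dF F0 JF hF]] _ [G [dG G0 JG hG]]].
  have [A [dA A0 bJ bh dh]] := bump_interp (Pa i).1.
  have sub_tensor x u (B : R -> R) : c * tensor (upd a i B) (subst x i u) =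
      (c * \prod_(k | k != i) a k (x ord0 k)) * B u.
    by rewrite tensor_upd_subst mulrCA mulrC.
  have tensorE x (B : R -> R) : c * tensor (upd a i B) x =
      (c * \prod_(k | k != i) a k (x ord0 k)) * B (x ord0 i).
    by rewrite -sub_tensor subst_id.
  exists (fun x => c * tensor (upd a i A) x); split.
  - move=> x t; under eq_fun do rewrite sub_tensor.
    rewrite (_ : c * tensor a _ = (c * \prod_(k | k != i) a k (x ord0 k)) * a i t).
      by apply: is_deriveZ.
    rewrite -sub_tensor; congr (_ * _).
    rewrite tensor_upd (tensor_split a i) substE eqxx; congr (_ * _).
  - by move=> x; rewrite sub_tensor A0 mulr0.
  - rewrite (_ : (fun x => _) = fun x => c * tensor (upd a i (fun t => A t - interp A t)) x).
      apply: TensorSpan => k; rewrite /upd; case: eqP => // _; exact: (Pa k).1.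
    apply/funext => x; rewrite !tensorE mulrBr; congr (_ - _).
    rewrite /interp mulr_sumr; apply: eq_bigr => m _.
    by rewrite !sub_tensor -mulrBr -mulrA.
  - rewrite (_ : (fun x => _) = fun x => c * tensor (upd a i (dinterp A)) x).
      apply: TensorSpan => k; rewrite /upd; case: eqP => [->|/eqP ki]; first by split.
      split; first exact: (Pa k).1.
      by rewrite ltnS leq_eqVlt => /predU1P[/val_inj/eqP|/(Pa k).2//]; rewrite (negbTE ki).
    apply/funext => x; rewrite tensorE /dinterp mulr_sumr; apply: eq_bigr => m _.
    by rewrite !sub_tensor -mulrBr; exact/esym/mulrA.
exists (fun x => F x + G x); split.
- by move=> x t; apply: is_deriveD.
- by move=> x; rewrite F0 G0 addr0.
- rewrite (_ : (fun x => _) = fun x =>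
    (F x - interp (fun u => F (subst x i u)) (x ord0 i)) +
    (G x - interp (fun u => G (subst x i u)) (x ord0 i))); first exact: TensorSpanD.
  apply/funext => x; rewrite addrACA -opprD; congr (_ - _).
  by rewrite /interp -big_split/=; apply: eq_bigr => m _; rewrite opprD addrACA mulrDl.
- rewrite (_ : (fun x => _) = fun x =>
    dinterp (fun u => F (subst x i u)) (x ord0 i) +
    dinterp (fun u => G (subst x i u)) (x ord0 i)); first exact: TensorSpanD.
  apply/funext => x.
  by rewrite /dinterp -big_split/=; apply: eq_bigr => m _; rewrite opprD addrACA mulrDl.
Qed.

(** [J] is the primitive in the i-th coordinate minus its interpolation, and [h]
    is the derivative of the interpolation. *)
Lemma discretize_coordinate (i : 'I_n) (psi : 'rV[R]_n -> R) (M : R) :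
  tensor_span (partially_discrete i) psi -> (forall x, `|psi x| <= M) ->
  exists J h : 'rV[R]_n -> R,
  [/\ test J, tensor_span (partially_discrete i.+1) h,
      forall x, psi x = 'D_(delta_mx ord0 i) J x + h x,
      forall x, `|J x| <= 2 * M / N%:R & forall x, `|h x| <= C * M].
Proof.
move=> Ppsi psiM; have M0 : 0 <= M := le_trans (normr_ge0 _) (psiM 0).
have [F [dF F0 tJ th]] := discretize_antiderivative Ppsi.
exists (fun x => F x - interp (fun u => F (subst x i u)) (x ord0 i)),
  (fun x => dinterp (fun u => F (subst x i u)) (x ord0 i)); split => //.
- move=> x; apply/eqP; rewrite -subr_eq; apply/eqP/esym/derive_subst.
  have h : (fun u : R => F (subst x i u) -
      interp (fun w => F (subst (subst x i u) i w)) (subst x i u ord0 i)) =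
    (fun u => F (subst x i u) - interp (fun w => F (subst x i w)) u).
    apply/funext => u; rewrite substE eqxx; congr (_ - interp _ _).
    by apply/funext => w; rewrite subst_subst.
  rewrite h; apply: is_deriveB; last exact: is_derive_interp.
  by have := dF x (x ord0 i); rewrite subst_id.
- move=> x; have [xi|xi] := ltP `|x ord0 i| (1 / 2).
    rewrite -{1}(subst_id x i).
    apply: (@interp_bound (fun u => F (subst x i u)) (fun t => psi (subst x i t))) => //.
    by rewrite node0 nodeN -ler_norml ltW.
  rewrite (test_out tJ) ?normr0 ?divr_ge0 ?mulr_ge0// Q0E => /(_ i).
  by rewrite ltNge xi.
- move=> x; apply: (@dinterp_bound _ (fun t => psi (subst x i t))) => //.
Qed.

(** One coordinate after the other, by [discretize_coordinate].  The sup norm may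
    grow by a factor [C] each time; with [Num.max C 1] the last bound covers all
    the stages. *)
Lemma discretize (psi : 'rV[R]_n -> R) (M : R) : test psi ->
  (forall x, `|psi x| <= M) ->
  exists (J : 'I_n -> 'rV[R]_n -> R) (h : 'rV[R]_n -> R),
  [/\ forall i, test (J i), tensor_span (partially_discrete n) h,
      forall x, psi x = \sum_i 'D_(delta_mx ord0 i) (J i) x + h x,
      forall i x, `|J i x| <= 2 * (Num.max C 1 ^+ n * M) / N%:R &
      forall x, `|h x| <= Num.max C 1 ^+ n * M].
Proof.
move=> tpsi psiM; have M0 : 0 <= M := le_trans (normr_ge0 _) (psiM 0).
pose C' := Num.max C 1.
have C'1 : 1 <= C' by rewrite le_max lexx orbT.
have C'0 : 0 <= C' := le_trans ler01 C'1.
suff main : forall j, (j <= n)%N ->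
  exists (J : 'I_n -> 'rV[R]_n -> R) (h : 'rV[R]_n -> R),
  [/\ forall i, test (J i), tensor_span (partially_discrete j) h,
      forall x, psi x = \sum_(i < n | (i < j)%N) 'D_(delta_mx ord0 i) (J i) x + h x,
      forall i x, `|J i x| <= 2 * (C' ^+ n * M) / N%:R &
      forall x, `|h x| <= C' ^+ j * M].
  have [J [h [tJ th E bJ bh]]] := main n (leqnn n); exists J, h; split => // x.
  by rewrite E; congr (_ + _); apply: eq_bigl => i; rewrite ltn_ord.
elim=> [_|j IH jn].
  exists (fun _ _ => 0), psi; split => //.
  - move=> i; rewrite (_ : (fun _ => _) = fun x : 'rV[R]_n => 0 * psi x).
      exact: tensor_spanZ.
    by apply/funext => x; rewrite mul0r.
  - by apply: tensor_spanS tpsi => k f bf; split.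
  - by move=> x; rewrite big1 ?add0r.
  - by move=> i x; rewrite normr0 divr_ge0 ?mulr_ge0// exprn_ge0.
  - by move=> x; rewrite expr0 mul1r.
have [J [h [tJ th E bJ bh]]] := IH (ltnW jn).
pose i0 := Ordinal jn.
have [J' [h' [tJ' th' E' bJ' bh']]] := @discretize_coordinate i0 h _ th bh.
exists (fun i => if i == i0 then J' else J i), h'; split => //.
- by move=> i; case: ifP.
- move=> x; rewrite E E' addrA; congr (_ + _).
  rewrite [RHS](bigD1 i0)//= eqxx addrC; congr (_ + _).
  rewrite [LHS](eq_bigl (fun i : 'I_n => (i < j.+1)%N && (i != i0))); last first.
    move=> i; rewrite ltnS [(i <= j)%N]leq_eqVlt -val_eqE/=.
    by case: ltngtP.
  by apply: eq_bigr => i /andP[_ /negbTE ->].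
- move=> i x; case: ifP => // _; apply: le_trans (bJ' x) _.
  rewrite ler_pM2r ?invr_gt0// ler_pM2l// ler_wpM2r//.
  by rewrite ler_weXn2l// ltnW.
- move=> x; apply: le_trans (bh' x) _.
  rewrite mulrA exprS ler_wpM2r// ler_wpM2r ?exprn_ge0//.
  by rewrite le_max lexx.
Qed.

(** Normalized to take the value 1 at the center of the cell [m]. *)
Definition grid_bump (m : {ffun 'I_n -> 'I_N}) : 'rV[R]_n -> R :=
  tensor (fun (k : 'I_n) t => s (arg (m k) t) / s (1 / 2)).

Let mid (m : nat) : R := node m + 1 / 2 / N%:R.

Lemma arg_mid m k : arg m (mid k) = k%:R - m%:R + 1 / 2.
Proof.
rewrite arg_node_sub /mid addrAC mulrDr -arg_node_sub arg_node; congr (_ + _).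
by rewrite mulrC divfK.
Qed.

Lemma bump_mid m k : s (arg m (mid k)) = if m == k then s (1 / 2) else 0.
Proof.
have [_ _ Sl Sr _] := stepS.
rewrite arg_mid; case: ltngtP => [mk|km|->]; last by rewrite subrr add0r.
  have [] // := Sr (k%:R - m%:R + 1 / 2); apply: (@le_trans _ _ 1).
    by rewrite ler_pdivrMr// mul1r ler_nat.
  rewrite -[leLHS]addr0 lerD ?divr_ge0// lerBrDr -[1]/(1%:R) -natrD ler_nat.
  by rewrite add1n.
have [] // := Sl (k%:R - m%:R + 1 / 2); apply: (@le_trans _ _ 0); last by rewrite divr_ge0.
rewrite -subr_ge0 sub0r opprD opprB subr_ge0 (@le_trans _ _ 1)//.
  by rewrite ler_pdivrMr// mul1r ler1n.
by rewrite lerBrDr -[1]/(1%:R) -natrD ler_nat add1n.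
Qed.

(** The bumps have disjoint supports, so the coefficients of a combination of
    bumps are its values at the centers of the cells; this is why they are
    bounded by the supremum of [h]. *)
Lemma grid_expansion (h : 'rV[R]_n -> R) :
  tensor_span (partially_discrete n) h ->
  forall x, h x = \sum_(m : {ffun 'I_n -> 'I_N})
    h (\row_k mid (m k)) * grid_bump m x.
Proof.
have [_ _ _ _ [_ _ s0]] := stepS.
elim=> [c a Pa|f g _ IHf _ IHg] x; last first.
  by rewrite IHf IHg -big_split/=; apply: eq_bigr => m _; rewrite mulrDl.
have aE (k : 'I_n) t : a k t = \sum_(m < N) a k (mid m) * (s (arg m t) / s (1 / 2)).
  have [e eP] := (Pa k).2 (ltn_ord k).
  rewrite eP; apply: eq_bigr => m _; rewrite eP (bigD1 m)//= bump_mid eqxx big1.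
    by rewrite addr0 -mulrA; congr (_ * _); rewrite mulrCA mulfV ?mulr1// gt_eqF.
  move=> m' m'm; rewrite bump_mid; case: eqP => [/val_inj mm|_]; last by rewrite mulr0.
  by rewrite mm eqxx in m'm.
rewrite {1}/tensor (eq_bigr _ (fun (k : 'I_n) _ => aE k (x ord0 k))) bigA_distr_bigA/=.
rewrite mulr_sumr; apply: eq_bigr => m _; rewrite big_split/= mulrA; congr (_ * _ * _).
by apply: eq_bigr => k _; rewrite mxE.
Qed.

Lemma test_grid_bump (m : {ffun 'I_n -> 'I_N}) : test (grid_bump m).
Proof.
have [_ C1s Sl Sr _] := stepS.
rewrite (_ : grid_bump m = fun x => 1 * grid_bump m x); last first.
  by apply/funext => x; rewrite mul1r.
apply: TensorSpan => k; split.
  by apply: C1M; [exact: C1_affine|exact: C1_cst].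
exists margin => // t mt.
have [t0|/ltW t0] := leP t 0.
  by have [_ ->] := Sl _ (arg_marginl (m k) mt t0); rewrite !mul0r.
by have [_ ->] := Sr _ (arg_marginr (ltn_ord (m k)) mt t0); rewrite !mul0r.
Qed.

End discretization.

(** * Test functions are norming for L^1 *)

Section density.
Context {R : realType} {n : nat}.
Notation mu := (@lebesgue_rV R n).
Variables (S s : R -> R) (C : R).
Hypothesis stepS : is_step S s C.
Variable w : 'rV[R]_n -> R.
Hypothesis iw : mu.-integrable Q0 (EFin \o w).
Implicit Types (f g h chi : 'rV[R]_n -> R) (A B : set 'rV[R]_n) (e : R).

Let mQ0 : measurable (@Q0 R n) := @measurable_Q0 R n.

Let mw : measurable_fun Q0 w.
Proof. by move/integrableP : iw => [/measurable_EFinP]. Qed.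

Let eq_refl_le (a b : R) : a = b -> a <= b. Proof. by move=> ->. Qed.

(** The L^1 norm for the finite measure |w| dx. *)
Let weight f : \bar R := (\int[mu]_(x in Q0) (`|f x| * `|w x|)%:E)%E.

Let measurable_weight f : measurable_fun setT f ->
  measurable_fun Q0 (fun x => (`|f x| * `|w x|)%:E).
Proof.
move=> mf; apply/measurable_EFinP; apply: measurable_funM.
  by apply: measurableT_comp => //; exact: measurable_funTS.
exact: measurableT_comp.
Qed.

Let weight_le f g h : measurable_fun setT f -> measurable_fun setT g ->
  measurable_fun setT h -> (forall x, Q0 x -> `|f x| <= `|g x| + `|h x|) ->
  (weight f <= weight g + weight h)%E.
Proof.
move=> mf mg mh fgh.
have -> : (weight g + weight h =
    \int[mu]_(x in Q0) ((`|g x| * `|w x|)%:E + (`|h x| * `|w x|)%:E))%E.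
  rewrite ge0_integralD// => *; rewrite ?lee_fin ?mulr_ge0//;
  exact: measurable_weight.
apply: ge0_le_integral => //.
- exact: measurable_weight.
- by apply: emeasurable_funD; exact: measurable_weight.
- by move=> x Qx; rewrite -EFinD lee_fin -mulrDl ler_wpM2r// fgh.
Qed.

Let weight_cvg (f_ : nat -> 'rV[R]_n -> R) f :
  (forall k, measurable_fun setT (f_ k)) -> measurable_fun setT f ->
  (forall k x, `|f_ k x| <= 1) -> (forall x, `|f x| <= 1) ->
  (forall x, Q0 x -> f_ k x @[k --> \oo] --> f x) ->
  forall e, 0 < e -> exists k, (weight (fun x => f_ k x - f x)%R < e%:E)%E.
Proof.
move=> mf_ mf f_1 f1 f_f e e0.
have mfk k : measurable_fun setT (fun x => f_ k x - f x) by exact: measurable_funB.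
have [] := @dominated_convergence _ _ _ mu Q0 mQ0
  (fun k x => (`|f_ k x - f x| * `|w x|)%:E) (cst 0%E)
  (fun x => (2 * `|w x|)%:E).
- by move=> k; exact: measurable_weight.
- exact: measurable_cst.
- apply: aeW => x Qx; apply: cvg_EFin; first by near=> k.
  have : (`|f_ k x - f x| * `|w x|) @[k --> \oo] --> `|f x - f x| * `|w x|.
    apply: cvgM; last exact: cvg_cst.
    by apply: cvg_norm; apply: cvgB; [exact: f_f|exact: cvg_cst].
  by rewrite subrr normr0 mul0r.
- exact: (integrableZl mQ0 2 (integrable_norm iw)).
- apply: aeW => x k Qx; rewrite gee0_abs ?lee_fin ?mulr_ge0// ler_wpM2r//.
  by rewrite (le_trans (ler_normB _ _))// -[2]/(1 + 1) lerD.
move=> _ _; rewrite integral0 => /= h.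
have : \forall k \near \oo, (\int[mu]_(x in Q0) (`|f_ k x - f x| * `|w x|)%:E < e%:E)%E.
  by apply: (h [set y : \bar R | (y < e%:E)%E]); apply: open_ereal_lt'; rewrite lte_fin.
by move=> [k _ /(_ k (leqnn k))]; exists k.
Unshelve. all: by end_near. Qed.

Let measurable_test chi : test chi -> measurable_fun setT chi.
Proof. by move=> /test_C1/C1_rV_continuous; exact: continuous_measurable_rV. Qed.

Let unit_test chi := test chi /\ forall x, 0 <= chi x <= 1.

Let unit_testM f g : unit_test f -> unit_test g -> unit_test (fun x => f x * g x).
Proof.
move=> [tf f01] [tg g01]; split; first exact: testM.
move=> x; have /andP[f0 f1] := f01 x; have /andP[g0 g1] := g01 x.
by rewrite mulr_ge0// mulr_ile1.
Qed.

Let unit_test_norm f x : unit_test f -> `|f x| <= 1.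
Proof. by move=> [_ /(_ x)/andP[f0 f1]]; rewrite ger0_norm. Qed.

(** For large [k], a cut-off of the interval ]-1/2, 1/2[. *)
Let eta (k : nat) (t : R) : R :=
  S (k%:R * t + k%:R * (1 / 2)) * S (- k%:R * t + k%:R * (1 / 2)).

Let S01 t : 0 <= S t <= 1. Proof. by have [_ _ _ _ []] := stepS. Qed.

Let C1S : C1 S.
Proof. by have [dS C1s _ _ _] := stepS; exists s => //; exact: C1_continuous. Qed.

Let S_norm t : `|S t| <= 1.
Proof. by have /andP[S0 S1] := S01 t; rewrite ger0_norm. Qed.

Let S_cvg0 (a : R) : 0 < a -> S (k%:R * a) @[k --> \oo] --> (1 : R).
Proof.
move=> a0; apply: cvg_near_cst; have [_ _ _ Sr _] := stepS.
exists (Num.truncn (3 / 4 / a)).+1 => // k /= kt; have [|->//] := Sr (k%:R * a).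
rewrite -ler_pdivrMr//; apply/ltW/(lt_le_trans (truncnS_gt _)).
by rewrite ler_nat.
Qed.

Let bump_eta k : bump (eta k).
Proof.
split; first by apply: C1M; apply: C1_affine.
have [_ _ Sl _ _] := stepS.
have k1 : (0 : R) < k.+1%:R by rewrite ltr0n.
exists (1 / 2 - 1 / 4 / k.+1%:R); first by rewrite ltrBlDr ltrDl !divr_gt0.
have H t : 1 / 2 - 1 / 4 / k.+1%:R <= t -> S (- k%:R * t + k%:R * (1 / 2)) = 0.
  move=> ht; have [|->//] := Sl (- k%:R * t + k%:R * (1 / 2)).
  rewrite mulNr addrC -mulrBr; apply: (@le_trans _ _ (k%:R * (1 / 4 / k.+1%:R))).
    by rewrite ler_wpM2l// lerBlDr addrC -lerBlDr.
  by rewrite mulrCA -[leRHS]mulr1 ler_wpM2l ?divr_ge0// ler_pdivrMr// mul1r ler_nat.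
move=> t; rewrite /eta; have [t0|t0] := leP 0 t.
  by rewrite ger0_norm// => /H ->; rewrite mulr0.
rewrite ltr0_norm// => /H; rewrite mulrNN => ->; by rewrite mul0r.
Qed.

Let cutoff (k : nat) : 'rV[R]_n -> R := tensor (fun=> eta k).

Let unit_test_tensor (a : 'I_n -> R -> R) :
  (forall i, bump (a i)) -> (forall i t, 0 <= a i t <= 1) -> unit_test (tensor a).
Proof.
move=> ba a01; split.
  rewrite (_ : tensor a = fun x => 1 * tensor a x); first exact: TensorSpan.
  by apply/funext => x; rewrite mul1r.
move=> x; rewrite /tensor prodr_ge0//=; last by move=> i _; have /andP[] := a01 i (x ord0 i).
by apply: prodr_ile1 => i _; exact: a01.
Qed.

Let eta01 k t : 0 <= eta k t <= 1.
Proof.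
have /andP[f0 f1] := S01 (k%:R * t + k%:R * (1 / 2)).
have /andP[g0 g1] := S01 (- k%:R * t + k%:R * (1 / 2)).
by rewrite /eta mulr_ge0// mulr_ile1.
Qed.

Let unit_cutoff k : unit_test (cutoff k).
Proof. by apply: unit_test_tensor => *; [exact: bump_eta|exact: eta01]. Qed.

Let eta_cvg t : `|t| < 1 / 2 -> eta k t @[k --> \oo] --> (1 : R).
Proof.
rewrite ltr_norml => /andP[t1 t2].
have h1 : 0 < t + 1 / 2 by rewrite -(opprK (1 / 2)) subr_gt0.
have h2 : 0 < 1 / 2 - t by rewrite subr_gt0.
rewrite (_ : (fun k => eta k t) =
    (fun k => S (k%:R * (t + 1 / 2)) * S (k%:R * (1 / 2 - t)))).
  by rewrite -[X in _ --> X](mulr1 1); apply: cvgM; exact: S_cvg0.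
by apply/funext => k; rewrite /eta -mulrDr mulNr [- _ + _]addrC -mulrBr.
Qed.

Let tensor_cvg (a : nat -> 'I_n -> R -> R) (x : 'rV[R]_n) :
  (forall i, a k i (x ord0 i) @[k --> \oo] --> (1 : R)) ->
  tensor (a k) x @[k --> \oo] --> (1 : R).
Proof.
move=> h; rewrite /tensor; elim: (index_enum _) => [|i r IH].
  by under eq_fun do rewrite big_nil; exact: cvg_cst.
under eq_fun do rewrite big_cons.
have h2 := cvgM (h i) IH; rewrite mulr1 in h2; exact: h2.
Qed.

Let cutoff_cvg x : Q0 x -> cutoff k x @[k --> \oo] --> (1 : R).
Proof.
by rewrite Q0E => Qx; apply: (@tensor_cvg (fun k _ => eta k)) => i; exact: eta_cvg.
Qed.

Let approximable A := measurable A /\ forall e, 0 < e ->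
  exists2 chi, unit_test chi & (weight (fun x => chi x - \1_A x)%R < e%:E)%E.

Let norm_indic A x : `|\1_A x : R| <= 1.
Proof. by rewrite indicE; case: (_ \in _); rewrite ?normr1 ?normr0. Qed.

Let approximable_cvg A (chi : nat -> 'rV[R]_n -> R) : measurable A ->
  (forall k, unit_test (chi k)) ->
  (forall x, Q0 x -> chi k x @[k --> \oo] --> (\1_A x : R)) -> approximable A.
Proof.
move=> mA uchi chiA; split => // e e0.
have [||||k ke] := @weight_cvg chi (\1_A) _ _ _ _ chiA e e0.
- by move=> k; exact: measurable_test (uchi k).1.
- exact: measurable_indic.
- by move=> k x; exact: unit_test_norm.
- exact: norm_indic.
by exists (chi k).
Qed.

Let approximableT : approximable setT.
Proof.
apply: (@approximable_cvg _ cutoff) => // x Qx.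
by rewrite indicE in_setT; exact: cutoff_cvg.
Qed.

Let half_space i (a : R) : approximable [set x : 'rV[R]_n | a < x ord0 i].
Proof.
have mA : measurable [set x : 'rV[R]_n | a < x ord0 i].
  rewrite (_ : [set _ | _] = (fun x : 'rV[R]_n => x ord0 i) @^-1` [set` `]a, +oo[]).
    by rewrite -[X in measurable X]setTI; exact: measurable_coord.
  by apply/seteqP; split => x /=; rewrite in_itv/= andbT.
pose f (k : nat) := fun t : R => S (k%:R * t + - (k%:R * a)).
apply: (@approximable_cvg _ (fun k => tensor (fun j t => if j == i then eta k t * f k t else eta k t))) => //.
  move=> k; apply: unit_test_tensor => [j|j t]; case: eqP => _.
  - by apply: bumpMr; [exact: bump_eta|exact: C1_affine].
  - exact: bump_eta.
  - have /andP[f0 f1] := eta01 k t.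
    have /andP[g0 g1] := S01 (k%:R * t + - (k%:R * a)).
    by rewrite /f mulr_ge0// mulr_ile1.
  - exact: eta01.
move=> x Qx; rewrite indicE.
have E k : tensor (fun j t => if j == i then eta k t * f k t else eta k t) x =
    cutoff k x * f k (x ord0 i).
  rewrite /cutoff [LHS](tensor_split _ i) [X in _ = X * _](tensor_split _ i) eqxx [RHS]mulrAC; congr (_ * _).
  by apply: eq_bigr => j /negbTE ->.
under eq_fun do rewrite E.
suff h : f k (x ord0 i) @[k --> \oo] --> ((x \in [set x : 'rV[R]_n | a < x ord0 i])%:R : R).
  by have h2 := cvgM (cutoff_cvg Qx) h; rewrite mul1r in h2; exact: h2.
have [xa|xa] := boolP (x \in _).
  rewrite inE /= -subr_gt0 in xa.
  rewrite (_ : (fun k => f k (x ord0 i)) = (fun k => S (k%:R * (x ord0 i - a)))).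
    exact: S_cvg0.
  by apply/funext => k; rewrite /f mulrBr.
rewrite notin_setE /= in xa.
apply: cvg_near_cst; near=> k; rewrite /f -mulrBr.
have [_ _ Sl _ _] := stepS; have [|->//] := Sl (k%:R * (x ord0 i - a)).
apply: (@le_trans _ _ 0); last by rewrite divr_ge0.
rewrite mulr_ge0_le0// subr_le0 leNgt; exact/negP.
Unshelve. all: by end_near. Qed.

Let approximableC A : approximable A -> approximable (~` A).
Proof.
move=> [mA hA]; split; first exact: measurableC.
move=> e e0; have e2 : 0 < e / 2 by rewrite divr_gt0.
have [chi uchi chiA] := hA _ e2.
have [_ /(_ _ e2) [eta' ueta etaT]] := approximableT.
exists (fun x => eta' x * (1 - chi x)).
  split.
    rewrite (_ : (fun _ => _) = fun x => eta' x + -1 * (eta' x * chi x)).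
      apply: TensorSpanD; first exact: ueta.1.
      by apply: tensor_spanZ; apply: testM; [exact: ueta.1|exact: uchi.1].
    by apply/funext => x; rewrite mulrBr mulr1 mulN1r.
  move=> x; have /andP[f0 f1] := ueta.2 x; have /andP[g0 g1] := uchi.2 x.
  by rewrite mulr_ge0 ?subr_ge0// mulr_ile1// ?subr_ge0// lerBlDr lerDl.
have mchi := measurable_test uchi.1; have meta := measurable_test ueta.1.
have mA1 : measurable_fun setT (\1_A : 'rV[R]_n -> R) by exact: measurable_indic.
have mA1C : measurable_fun setT (\1_(~` A) : 'rV[R]_n -> R).
  by apply: measurable_indic; exact: measurableC.
rewrite [e in X in (_ < X)%E]splitr EFinD.
apply: le_lt_trans (lteD etaT chiA); apply: weight_le.
- apply: measurable_funB => //; apply: measurable_funM => //.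
  by apply: measurable_funB => //; exact: measurable_cst.
- by apply: measurable_funB => //; exact: measurable_indic.
- exact: measurable_funB.
move=> x Qx; have -> : \1_(~` A) x = 1 - \1_A x :> R.
  by rewrite !indicE in_setC; case: (_ \in _); rewrite ?subrr ?subr0.
have -> : \1_setT x = 1 :> R by rewrite indicE in_setT.
have -> : eta' x * (1 - chi x) - (1 - \1_A x) =
    (eta' x - 1) * (1 - chi x) + - (chi x - \1_A x).
  by rewrite [in RHS]mulrBl mul1r -[RHS]addrA -[in RHS]opprD subrKA.
apply: (le_trans (ler_normD _ _)); rewrite normrN lerD// normrM.
rewrite -[leRHS]mulr1 ler_wpM2l//.
have /andP[g0 g1] := uchi.2 x.
by rewrite ger0_norm ?subr_ge0// lerBlDr lerDl.
Qed.

Let approximableI A B : approximable A -> approximable B -> approximable (A `&` B).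
Proof.
move=> [mA hA] [mB hB]; split; first exact: measurableI.
move=> e e0; have e2 : 0 < e / 2 by rewrite divr_gt0.
have [f uf fA] := hA _ e2; have [g ug gB] := hB _ e2.
exists (fun x => f x * g x); first exact: unit_testM.
have mf := measurable_test uf.1; have mg := measurable_test ug.1.
rewrite [e in X in (_ < X)%E]splitr EFinD.
apply: le_lt_trans (lteD fA gB); apply: weight_le.
- apply: measurable_funB; first exact: measurable_funM.
  by apply: measurable_indic; exact: measurableI.
- by apply: measurable_funB => //; exact: measurable_indic.
- by apply: measurable_funB => //; exact: measurable_indic.
move=> x Qx; rewrite indicI.
have -> : f x * g x - (\1_A \* \1_B) x =
    (f x - \1_A x) * g x + \1_A x * (g x - \1_B x).
  by rewrite /= mulrBl mulrBr addrA subrK.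
apply: (le_trans (ler_normD _ _)); rewrite lerD// normrM.
  by rewrite -[leRHS]mulr1 ler_wpM2l// unit_test_norm.
by rewrite -[leRHS]mul1r ler_wpM2r.
Qed.

Let approximable_bigcup (F : nat -> set 'rV[R]_n) :
  (forall k, approximable (F k)) -> approximable (\bigcup_k F k).
Proof.
move=> aF; have mF : measurable (\bigcup_k F k).
  by apply: bigcup_measurable => k _; exact: (aF k).1.
split => // e e0; have e2 : 0 < e / 2 by rewrite divr_gt0.
pose G K := \bigcup_(k in [set k | (k < K)%N]) F k.
have aG K : approximable (G K).
  elim: K => [|K IH].
    rewrite (_ : G 0%N = ~` setT); first exact: approximableC.
    by rewrite setCT; apply/seteqP; split => x // -[].
  rewrite (_ : G K.+1 = ~` (~` G K `&` ~` F K)).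
    by apply: approximableC; apply: approximableI; exact: approximableC.
  rewrite setCI !setCK; apply/seteqP; split => x.
    case=> k /=; rewrite ltnS leq_eqVlt => /predU1P[->|kK] Fx; [by right|].
    by left; exists k.
  case=> [[k /= kK Fx]|Fx]; [exists k => //=|by exists K => /=].
  exact: ltnW.
have [|||||K KE] := @weight_cvg (fun K => \1_(G K)) (\1_(\bigcup_k F k)) _ _ _ _ _ (e / 2) e2.
- by move=> K; apply: measurable_indic; exact: (aG K).1.
- exact: measurable_indic.
- by move=> K x; exact: norm_indic.
- exact: norm_indic.
- move=> x _; apply: cvg_near_cst; have [[k _ Fx]|nF] := pselect ((\bigcup_k F k) x).
    exists k.+1 => // K /= kK; rewrite !indicE !mem_set//; first by exists k.
    by exists k.
  near=> K; rewrite !indicE !memNset// => -[k _ Fx]; apply: nF; by exists k.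
have [chi uchi chiG] := (aG K).2 _ e2.
exists chi => //; have mchi := measurable_test uchi.1.
have mGK := (aG K).1.
rewrite [e in X in (_ < X)%E]splitr EFinD.
apply: le_lt_trans (lteD chiG KE); apply: weight_le.
- by apply: measurable_funB => //; exact: measurable_indic.
- by apply: measurable_funB => //; exact: measurable_indic.
- by apply: measurable_funB; exact: measurable_indic.
by move=> x _; rewrite -[X in `|X - _|](subrK (\1_(G K) x)) -addrA ler_normD.
Unshelve. all: by end_near. Qed.

(** The approximable sets form a sigma-algebra ([approximableC],
    [approximable_bigcup]) that contains the half-spaces ([half_space]). *)
Let approximable_measurable A : measurable A -> approximable A.
Proof.
suff sub : measurable `<=` approximable by exact: sub.
apply: smallest_sub.
  split.
  - by rewrite -setCT; exact: approximableC.
  - by move=> B aB; rewrite setTD; exact: approximableC.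
  - exact: approximable_bigcup.
rewrite -bigcup_seq => B [i _ [Y mY <-]] /=; rewrite setTI.
pose G := [set Y : set R | approximable ((fun v : 'rV[R]_n => v ord0 i) @^-1` Y)].
suff sub' : measurable `<=` G by exact: sub'.
rewrite (RGenOInfty.measurableE R : @measurable _ R = _); apply: smallest_sub.
  split.
  - by rewrite /G/= preimage_set0 -setCT; exact: approximableC.
  - by move=> Z GZ; rewrite /G/= setTD preimage_setC; exact: approximableC.
  - by move=> F GF; rewrite /G/= preimage_bigcup; exact: approximable_bigcup.
move=> _ [a ->]; rewrite /G/=.
rewrite (_ : _ @^-1` _ = [set x : 'rV[R]_n | a < x ord0 i]); first exact: half_space.
by apply/seteqP; split => x /=; rewrite in_itv/= andbT.
Qed.

(** The test function approximates the sign of [w]: it is the difference of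
    approximations of the indicators of {w > 0} and of its complement. *)
Lemma test_norming e : 0 < e -> exists psi, [/\ test psi,
  forall x, `|psi x| <= 1 &
  \int[mu]_(x in Q0) `|w x| <= \int[mu]_(x in Q0) (w x * psi x) + e].
Proof.
move=> e0; have e2 : 0 < e / 2 by rewrite divr_gt0.
pose P := Q0 `&` w @^-1` [set` `]0, +oo[].
have mP : measurable P by exact: mw.
have [_ /(_ _ e2) [f uf fP]] := approximable_measurable mP.
have [_ /(_ _ e2) [g ug gP]] := approximable_measurable (measurableC mP).
have itest chi : test chi -> (forall x, `|chi x| <= 1) ->
    mu.-integrable Q0 (EFin \o (fun x => w x * chi x)).
  move=> tchi chi1; have mchi := measurable_test tchi.
  apply: (@le_integrable _ _ _ mu Q0 mQ0 _ (EFin \o w)) => //.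
    apply/measurable_EFinP; apply: measurable_funM => //.
    exact: measurable_funTS.
  move=> x _; rewrite /= lee_fin normrM -[leRHS]mulr1 ler_wpM2l//.
have iweight chi A : measurable A -> test chi -> (forall x, `|chi x| <= 1) ->
    mu.-integrable Q0 (fun x => (`|chi x - \1_A x| * `|w x|)%:E).
  move=> mA tchi chi1; have mchi := measurable_test tchi.
  apply: (@le_integrable _ _ _ mu Q0 mQ0 _ (fun x => (2 * `|w x|)%:E)).
  - by apply: measurable_weight; apply: measurable_funB => //; exact: measurable_indic.
  - move=> x _; rewrite !abse_EFin lee_fin !normrM !normr_id (@ger0_norm _ 2)//.
    by rewrite ler_wpM2r// (le_trans (ler_normB _ _))// -[2]/(1 + 1) lerD.
  - exact: (integrableZl mQ0 2 (integrable_norm iw)).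
have uf1 x : `|f x| <= 1 by exact: unit_test_norm.
have ug1 x : `|g x| <= 1 by exact: unit_test_norm.
set psi := fun x => f x + -1 * g x.
have tpsi : test psi by apply: TensorSpanD; [exact: uf.1|exact: tensor_spanZ ug.1].
have psi1 x : `|psi x| <= 1.
  have /andP[f0 f1] := uf.2 x; have /andP[g0 g1] := ug.2 x.
  rewrite /psi mulN1r ler_norml; apply/andP; split.
    by rewrite -subr_ge0 opprK addrAC -addrA addr_ge0// subr_ge0.
  by rewrite lerBlDr (le_trans f1)// lerDl.
exists psi; split => //.
have wfin A chi : (weight (fun x => chi x - \1_A x)%R < (e / 2)%:E)%E ->
    \int[mu]_(x in Q0) (`|chi x - \1_A x| * `|w x|) < e / 2.
  by rewrite /Rintegral -/(weight _); case: (weight _) => [r| |]//=; rewrite ?lte_fin// ?divr_gt0.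
apply: (@le_trans _ _ (\int[mu]_(x in Q0) (w x * psi x +
    (`|f x - \1_P x| * `|w x| + `|g x - \1_(~` P) x| * `|w x|)))).
  apply: le_Rintegral => //.
  - exact: integrable_norm.
  - rewrite (_ : EFin \o _ = ((EFin \o (fun x => w x * psi x)%R) \+
        ((fun x => (`|f x - \1_P x| * `|w x|)%R%:E) \+
         (fun x => (`|g x - \1_(~` P) x| * `|w x|)%R%:E)))%E); last by apply/funext.
    apply: integrableD => //; first exact: itest.
    apply: integrableD => //; first exact: iweight uf.1 _.
    by apply: iweight ug.1 _ => //; exact: measurableC.
  move=> x Qx; have /andP[f0 f1] := uf.2 x; have /andP[g0 g1] := ug.2 x.
  have [wx|wx] := ltP 0 (w x).
    have xP : P x by split => //=; rewrite in_itv/= andbT.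
    have -> : \1_P x = 1 :> R by rewrite indicE mem_set.
    have -> : \1_(~` P) x = 0 :> R by rewrite indicE memNset.
    rewrite (gtr0_norm wx) subr0 (ger0_norm g0) distrC ger0_norm ?subr_ge0// /psi.
    apply: eq_refl_le; rewrite mulN1r [w x * _]mulrC -!mulrDl addrACA.
    by rewrite subrKC addNr addr0 mul1r.
  have xP : ~ P x by move=> [_ /=]; rewrite in_itv/= andbT ltNge wx.
  have -> : \1_P x = 0 :> R by rewrite indicE memNset.
  have -> : \1_(~` P) x = 1 :> R by rewrite indicE mem_set.
  rewrite (ler0_norm wx) subr0 (ger0_norm f0) distrC ger0_norm ?subr_ge0// /psi.
  apply: eq_refl_le; rewrite mulN1r [w x * _]mulrC -mulrDl mulrN -mulrBl.
  by rewrite opprD addrACA subrr add0r -opprD subrKC mulN1r.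
have iP := iweight f P mP uf.1 uf1.
have iN := iweight g _ (measurableC mP) ug.1 ug1.
rewrite RintegralD//; last 2 first.
- exact: itest.
- rewrite (_ : EFin \o _ = ((fun x => (`|f x - \1_P x| * `|w x|)%R%:E) \+
         (fun x => (`|g x - \1_(~` P) x| * `|w x|)%R%:E))%E); last by apply/funext.
  exact: integrableD.
rewrite lerD2l RintegralD// [leRHS]splitr lerD// ltW//; exact: wfin.
Qed.

End density.

(** * Integration by parts on the unit cube *)

Section integration_by_parts.
Context {R : realType} {n : nat}.
Notation mu := (@lebesgue_rV R n).
Implicit Types (phi psi g w : 'rV[R]_n -> R) (i : 'I_n) (x v : 'rV[R]_n).

Lemma lebesgue_rV_Q0_lty : (mu Q0 < +oo)%E.
Proof. by rewrite lebesgue_rV_Q0 ltry. Qed.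

Lemma continuous_bounded_Q0 phi : continuous phi ->
  exists2 B, 0 <= B & forall x, Q0 x -> `|phi x| <= B.
Proof.
move=> cphi.
pose K : set 'rV[R]_n := [set x | forall i, [set` `[(-1), 1 : R]] (x ord0 i)].
have cK : compact K.
  by apply: (@rV_compact _ n (fun=> [set` `[(-1), 1 : R]])) => _; exact: segment_compact.
have [] := compact_bounded (continuous_compact (continuous_subspaceT cphi) cK).
move=> M [_ /(_ (`|M| + 1))] MP; exists (`|M| + 1); first by rewrite addr_ge0.
move=> x; rewrite Q0E => Qx; apply: MP; first by rewrite ltr_pwDr// ler_norm.
exists x => // i; rewrite /= in_itv/= -ler_norml (le_trans (ltW (Qx i)))//.
by rewrite ler_pdivrMr// mul1r ler1n.
Qed.

Lemma continuous_integrable_Q0 phi : continuous phi -> mu.-integrable Q0 (EFin \o phi).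
Proof.
move=> cphi; have [B B0 HB] := continuous_bounded_Q0 cphi.
apply: measurable_bounded_integrable; first exact: measurable_Q0.
- exact: lebesgue_rV_Q0_lty.
- by apply: measurable_funTS; exact: continuous_measurable_rV.
- exists B; split; first exact: num_real.
  by move=> M BM x Qx; exact: le_trans (HB x Qx) (ltW BM).
Qed.

Lemma integrable_mul_continuous g phi : mu.-integrable Q0 (EFin \o g) ->
  continuous phi -> mu.-integrable Q0 (EFin \o (fun x => g x * phi x)).
Proof.
move=> ig cphi; have [B B0 HB] := continuous_bounded_Q0 cphi.
have mQ0 := @measurable_Q0 R n.
have /integrableP[/measurable_EFinP mg _] := ig.
apply: (@le_integrable _ _ _ mu Q0 mQ0 _ (fun x => (B%:E * (EFin \o g) x)%E)).
- apply/measurable_EFinP; apply: measurable_funM => //.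
  by apply: measurable_funTS; exact: continuous_measurable_rV.
- move=> x Qx; rewrite /= lee_fin !normrM (ger0_norm B0) mulrC.
  by rewrite ler_wpM2r// HB.
- exact: integrableZl.
Qed.

Lemma test_derive_out phi i x : test phi -> ~ Q0 x ->
  'D_(delta_mx ord0 i) phi x = 0.
Proof.
move=> /test_supp[r r2 rphi] xQ0.
have [j] : exists j, ~ `|x ord0 j| < 1 / 2.
  by apply/existsNP; rewrite Q0E in xQ0.
move=> /negP; rewrite -leNgt => /(lt_le_trans r2) rx.
rewrite (@near_eq_derive _ _ _ _ (cst 0)); first by rewrite derive_cst.
have : nbhs x [set y : 'rV[R]_n | r < `|y ord0 j|].
  apply: (@cvgr_gt _ _ (nbhs x) _ (fun y : 'rV[R]_n => `|y ord0 j|) `|x ord0 j|) => //.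
  apply: cvg_norm; exact: coord_continuous.
by apply: filterS => y /ltW; exact: rphi.
Qed.

Lemma is_derive_line phi i x (t : R) : C1_rV phi ->
  is_derive t 1 (fun u : R => phi (x + u *: delta_mx ord0 i))
    ('D_(delta_mx ord0 i) phi (x + t *: delta_mx ord0 i)).
Proof.
move=> Cphi; set v := delta_mx ord0 i.
have E : (fun h : R => h^-1 *: (((fun u : R => phi (x + u *: v)) \o shift t) (h *: 1) - phi (x + t *: v))) =
    (fun h : R => h^-1 *: ((phi \o shift (x + t *: v)) (h *: v) - phi (x + t *: v))).
  apply/funext => h; rewrite /= [h *: 1]mulr1; congr (_ *: (phi _ - _)).
  by rewrite scalerDl addrCA.
have := @C1_rV_derivable _ _ phi (x + t *: v) v Cphi; rewrite /derivable => D.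
by apply: DeriveDef; rewrite ?/derivable ?/derive E.
Qed.

Lemma test_increment_bound phi i (B : R) x (t : R) : test phi -> 0 <= t ->
  (forall y, `|'D_(delta_mx ord0 i) phi y| <= B) ->
  `|phi (x + t *: delta_mx ord0 i) - phi x| <= B * t.
Proof.
move=> tphi t0 HB; have := @MVT_le _ (fun u => phi (x + u *: delta_mx ord0 i))
  (fun u => 'D_(delta_mx ord0 i) phi (x + u *: delta_mx ord0 i)) 0 t B t0.
rewrite scale0r addr0 subr0; apply => //.
- by move=> s; apply: is_derive_line; exact: test_C1.
- exact: le_trans (HB 0).
Qed.

Lemma integrable_test phi : test phi -> mu.-integrable setT (EFin \o phi).
Proof.
move=> tphi; have cphi := C1_rV_continuous (test_C1 tphi).
rewrite (_ : EFin \o phi = (EFin \o phi) \_ Q0).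
  by apply: (integrable_mkcond _ (@measurable_Q0 R n)).1; exact: continuous_integrable_Q0.
apply/funext => x; rewrite patchE; case: ifPn => //; rewrite notin_setE => xQ.
by rewrite /= (test_out tphi xQ).
Qed.

Lemma integrable_test_shift phi v : test phi ->
  mu.-integrable setT (EFin \o (fun x => phi (x + v))).
Proof.
move=> tphi; have mphi := continuous_measurable_rV (C1_rV_continuous (test_C1 tphi)).
have mv : measurable_fun setT (fun x : 'rV[R]_n => x + v).
  by apply: measurable_rVD => //; exact: measurable_cst.
pose m1 := measure_function_pushforward__canonical__measure_function_Measure mu mv.
apply/integrableP; split.
  by apply/measurable_EFinP; exact: measurableT_comp.
have /integrableP[_] := integrable_test tphi; apply: le_lt_trans.
rewrite [leRHS](@eq_measure_integral _ _ _ _ m1); last first.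
  by move=> A mA _; rewrite /= /pushforward lebesgue_rV_shift.
rewrite /m1/= (@ge0_integral_pushforward _ _ _ _ _ _ mv mu setT (fun x => `|(phi x)%:E|%E))//.
by apply: measurableT_comp => //; exact/measurable_EFinP.
Qed.

Lemma integral_test_shift phi v : test phi ->
  \int[mu]_x phi (x + v) = \int[mu]_x phi x.
Proof.
move=> tphi; have mphi := continuous_measurable_rV (C1_rV_continuous (test_C1 tphi)).
have mv : measurable_fun setT (fun x : 'rV[R]_n => x + v).
  by apply: measurable_rVD => //; exact: measurable_cst.
pose m1 := measure_function_pushforward__canonical__measure_function_Measure mu mv.
rewrite /Rintegral; congr fine.
have -> : (\int[mu]_x (phi x)%:E = \int[m1]_x (phi x)%:E)%E.
  by apply: eq_measure_integral => A mA _; rewrite /= /pushforward lebesgue_rV_shift.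
rewrite (@integral_pushforward _ _ _ _ _ _ mv mu setT (EFin \o phi))//.
  exact/measurable_EFinP.
by rewrite preimage_setT; exact: integrable_test_shift.
Qed.

(** By invariance under translations the difference quotients of [phi] have
    integral 0; they are bounded, and converge to the partial derivative. *)
Lemma integral_test_derive phi i : test phi ->
  \int[mu]_(x in Q0) 'D_(delta_mx ord0 i) phi x = 0.
Proof.
move=> tphi; have C1phi := test_C1 tphi; have cphi := C1_rV_continuous C1phi.
have cD := C1phi.2 i; have mQ0 := @measurable_Q0 R n.
have [B B0 HB] := continuous_bounded_Q0 cD.
have {}HB x : `|'D_(delta_mx ord0 i) phi x| <= B.
  by have [/HB//|xQ] := pselect (Q0 x); rewrite test_derive_out// normr0.
pose h (k : nat) : R := k.+1%:R^-1.
have h0 k : 0 < h k by rewrite invr_gt0.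
have h1 k : h k <= 1 by rewrite invf_le1// ler1n.
pose F k x := (h k)^-1 * (phi (x + h k *: delta_mx ord0 i) - phi x).
have mF k : measurable_fun setT (F k).
  apply: measurable_funM => //; apply: measurable_funB; last exact: continuous_measurable_rV.
  apply: (measurableT_comp (continuous_measurable_rV cphi)).
  by apply: measurable_rVD => //; exact: measurable_cst.
have int0 k : (\int[mu]_x (F k x)%:E = 0)%E.
  have i1 := @integrable_test_shift phi (h k *: delta_mx ord0 i) tphi.
  have i2 := integrable_test tphi.
  have i3 := integrableB measurableT i1 i2.
  have i4 := integrableZl measurableT (h k)^-1 i3.
  have : \int[mu]_x F k x = 0.
    have -> := @RintegralZl _ _ _ mu setT (fun x => phi (x + h k *: delta_mx ord0 i) - phi x)
      (h k)^-1 measurableT i3.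
    by rewrite RintegralB// integral_test_shift// subrr mulr0.
  rewrite /Rintegral => E; rewrite -[LHS]fineK ?E//.
  by apply: integrable_fin_num => //; exact: i4.
have : (\int[mu]_x (F k x)%:E)%E @[k --> \oo] --> (\int[mu]_x ('D_(delta_mx ord0 i) phi x)%:E)%E.
  have [] := @dominated_convergence _ _ _ mu setT measurableT (fun k x => (F k x)%:E)
    (fun x => ('D_(delta_mx ord0 i) phi x)%:E) (fun x => ((EFin \o cst B) \_ (cube 2)) x).
  - by move=> k; exact/measurable_EFinP.
  - by apply/measurable_EFinP; exact: continuous_measurable_rV.
  - apply: aeW => x _; apply: cvg_EFin; first by near=> k.
    have := @C1_rV_derivable _ _ phi x (delta_mx ord0 i) C1phi.
    move=> /cvg_ex[l /= hl].
    have -> : 'D_(delta_mx ord0 i) phi x = l by exact: cvg_lim hl.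
    have /cvgr_dnbhsP/(_ h) H := hl; rewrite (_ : fine \o _ =
        (fun k => (h k)^-1 *: (phi (h k *: delta_mx ord0 i + x) - phi x))).
      apply: H; split; last exact: cvg_harmonic.
      by move=> k; rewrite gt_eqF.
    by apply/funext => k; rewrite /F/= [x + _]addrC.
  - apply: (integrable_mkcond _ (@measurable_cube R n 2)).1.
    apply: measurable_bounded_integrable; first exact: measurable_cube.
    + have : (mu (cube 2) < +oo)%E by rewrite lebesgue_rV_cube// ltry.
      exact.
    + exact: measurable_cst.
    + by exists B; split => [|M BM x Qx]; [exact: num_real|rewrite /= ger0_norm// ltW].
  - apply: aeW => x k _; rewrite patchE; case: ifPn => [_|].
      rewrite /= lee_fin normrM ger0_norm ?invr_ge0 ?(ltW (h0 k))//.
      rewrite mulrC ler_pdivrMr//; apply: test_increment_bound => //; exact: ltW.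
    rewrite notin_setE => xc; have [j] : exists j, ~ `|x ord0 j| < 2.
      by apply/existsNP.
    move=> /negP; rewrite -leNgt => xj.
    have h12 : (1 / 2 : R) <= 1 by rewrite ler_pdivrMr// mul1r ler1n.
    rewrite /F (test_out tphi) ?(test_out tphi) ?subrr ?mulr0 ?abse0//.
    + by rewrite Q0E => /(_ j); rewrite ltNge (le_trans h12)// (le_trans _ xj)// ler1n.
    + rewrite Q0E => /(_ j); rewrite ltNge !mxE (le_trans h12)//.
      rewrite -(lerD2r 1) (le_trans xj)//.
      rewrite -[X in `|X| <= _](addrK (h k * (true && (j == i))%:R)).
      rewrite (le_trans (ler_normB _ _))// lerD2l normrM (ger0_norm (ltW (h0 k))).
      by rewrite mulr_ile1// ?(ltW (h0 k))//; case: (_ == _); rewrite ?normr1 ?normr0.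
  by move=> _ _; exact.
under eq_fun do rewrite int0.
move=> h2; have h3 : (fun=> 0%E : \bar R) x @[x --> \oo] --> (0%E : \bar R) by exact: cvg_cst.
have h4 := @cvg_unique _ (@ereal_hausdorff R) _ _ _ _ h2 h3.
rewrite Rintegral_mkcond (_ : _ \_ _ = 'D_(delta_mx ord0 i) phi).
  by rewrite /Rintegral h4.
apply/funext => x; rewrite patchE; case: ifPn => //.
by rewrite notin_setE => /(test_derive_out i tphi).
Unshelve. all: by end_near. Qed.

End integration_by_parts.

(** * Weak variation and the L^1 norm *)

Section weak_variation.
Context {R : realType} {n : nat}.
Notation mu := (@lebesgue_rV R n).
Implicit Types (phi psi g w : 'rV[R]_n -> R) (i : 'I_n) (x v : 'rV[R]_n) (V B c : R).

Definition pairing g phi : R := \int[mu]_(x in Q0) (g x * phi x).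

Definition L1 g := mu.-integrable Q0 (EFin \o g).

Definition L1norm g : R := \int[mu]_(x in Q0) `|g x|.

Let mQ0 : measurable (@Q0 R n) := @measurable_Q0 R n.

Lemma L1_cst c : L1 (fun=> c).
Proof. by apply: continuous_integrable_Q0; exact: cst_continuous. Qed.

Lemma L1D g w : L1 g -> L1 w -> L1 (fun x => g x + w x).
Proof. by move=> ig iw; exact: (integrableD mQ0 ig iw). Qed.

Lemma L1B g w : L1 g -> L1 w -> L1 (fun x => g x - w x).
Proof. by move=> ig iw; exact: (integrableB mQ0 ig iw). Qed.

Lemma L1Z c g : L1 g -> L1 (fun x => c * g x).
Proof. by move=> ig; exact: (integrableZl mQ0 c ig). Qed.

Lemma L1_norm g : L1 g -> L1 (fun x => `|g x|).
Proof. by move=> ig; exact: (integrable_norm ig). Qed.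

Lemma L1norm_triangle f g w : L1 f -> L1 g -> L1 w ->
  (forall x, Q0 x -> `|f x| <= `|g x| + `|w x|) -> L1norm f <= L1norm g + L1norm w.
Proof.
move=> i_f ig iw fgw; rewrite /L1norm -RintegralD//; try exact: L1_norm.
by apply: le_Rintegral => //; [exact: L1_norm|apply: L1D; exact: L1_norm].
Qed.

Lemma Rintegral_cst_Q0 c : \int[mu]_(x in Q0) c = c.
Proof.
rewrite Rintegral_cst// -[RHS](mulr1 c); congr (c * _).
by have := lebesgue_rV_Q0 (R := R) (n := n) => /= ->.
Qed.

Lemma le_Rintegral_L1norm g : L1 g -> `|\int[mu]_(x in Q0) g x| <= L1norm g.
Proof. by move=> ig; exact: le_normr_Rintegral. Qed.

Lemma pairingDr g phi psi : L1 g -> continuous phi -> continuous psi ->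
  pairing g (fun x => phi x + psi x) = pairing g phi + pairing g psi.
Proof.
move=> ig cphi cpsi; rewrite /pairing -RintegralD//; try exact: integrable_mul_continuous.
by apply: eq_Rintegral => x _; rewrite mulrDr.
Qed.

Lemma pairingZr g c phi : L1 g -> continuous phi ->
  pairing g (fun x => c * phi x) = c * pairing g phi.
Proof.
move=> ig cphi; rewrite /pairing -RintegralZl//; last exact: integrable_mul_continuous.
by apply: eq_Rintegral => x _; rewrite mulrCA.
Qed.

Lemma pairingBl g w phi : L1 g -> L1 w -> continuous phi ->
  pairing (fun x => g x - w x) phi = pairing g phi - pairing w phi.
Proof.
move=> ig iw cphi; rewrite /pairing -RintegralB//; try exact: integrable_mul_continuous.
by apply: eq_Rintegral => x _; rewrite mulrBl.
Qed.

Lemma pairingZl c g phi : L1 g -> continuous phi ->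
  pairing (fun x => c * g x) phi = c * pairing g phi.
Proof.
move=> ig cphi; rewrite /pairing -RintegralZl//; last exact: integrable_mul_continuous.
by apply: eq_Rintegral => x _; rewrite mulrA.
Qed.

Lemma continuous_sum_rV (I : Type) (r : seq I) (F : I -> 'rV[R]_n -> R) :
  (forall j, continuous (F j)) -> continuous (fun x => \sum_(j <- r) F j x).
Proof.
move=> cF; elim: r => [|j r IH].
  by under eq_fun do rewrite big_nil; exact: cst_continuous.
under eq_fun do rewrite big_cons.
by move=> x; have cj : {for x, continuous (F j)} := cF j x; exact: (cvgD cj (IH x)).
Qed.

Lemma pairing_sumr (I : Type) (r : seq I) g (F : I -> 'rV[R]_n -> R) : L1 g ->
  (forall j, continuous (F j)) ->
  pairing g (fun x => \sum_(j <- r) F j x) = \sum_(j <- r) pairing g (F j).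
Proof.
move=> ig cF; elim: r => [|j r IH].
  rewrite big_nil /pairing; under eq_Rintegral do rewrite big_nil mulr0.
  exact: Rintegral_cst_Q0.
rewrite big_cons -IH -pairingDr//; last exact: continuous_sum_rV.
by apply: eq_Rintegral => x _; rewrite big_cons.
Qed.

Lemma pairing_le g phi B : L1 g -> continuous phi -> (forall x, Q0 x -> `|phi x| <= B) ->
  `|pairing g phi| <= B * L1norm g.
Proof.
move=> ig cphi pB; apply: (le_trans (le_normr_Rintegral _ _)) => //.
  exact: integrable_mul_continuous.
rewrite /L1norm -RintegralZl//; last exact: L1_norm.
apply: le_Rintegral => //.
- by apply: L1_norm; exact: integrable_mul_continuous.
- by apply: L1Z; exact: L1_norm.
- by move=> x Qx; rewrite normrM mulrC ler_wpM2r// pB.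
Qed.

(** A form of |Dg|(Q0) <= V that only involves the distributional partial
    derivatives one at a time. *)
Definition weak_variation_le g V := forall i phi B, test phi ->
  (forall x, `|phi x| <= B) -> `|pairing g ('D_(delta_mx ord0 i) phi)| <= V * B.

Lemma weak_variation_cst c : weak_variation_le (fun=> c) 0.
Proof.
move=> i phi B tphi _; rewrite mul0r /pairing RintegralZl//; last first.
  exact/continuous_integrable_Q0/(test_C1 tphi).2.
by rewrite integral_test_derive// mulr0 normr0.
Qed.

Lemma weak_variationB g w V V' : L1 g -> L1 w ->
  weak_variation_le g V -> weak_variation_le w V' ->
  weak_variation_le (fun x => g x - w x) (V + V').
Proof.
move=> ig iw gV wV i phi B tphi pB; rewrite pairingBl//; last exact: (test_C1 tphi).2.
by rewrite (le_trans (ler_normB _ _))// mulrDl lerD; [|exact: gV|exact: wV].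
Qed.

Section estimate.
Variables (S s : R -> R) (C : R).
Hypothesis stepS : is_step S s C.
Let K := Num.max C 1 ^+ n.

Let K0 : 0 <= K.
Proof. by rewrite exprn_ge0// le_max ler01 orbT. Qed.

(** Apply [discretize] to a nearly norming [psi]: the derivatives pair with [w]
    to at most [V] times their size O(1/N), and the rest is a combination of the
    finitely many bumps of the grid. *)
Lemma L1norm_estimate N w V : (0 < N)%N -> L1 w -> weak_variation_le w V ->
  L1norm w <= n%:R * (V * (2 * K / N%:R)) +
    K * \sum_(m : {ffun 'I_n -> 'I_N}) `|pairing w (grid_bump s m)|.
Proof.
move=> N0 iw wV; apply/ler_addgt0Pr => e e0.
have [psi [tpsi psi1 /le_trans]] := test_norming stepS iw e0; apply.
rewrite lerD2r -/(pairing w psi).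
have [J [h [tJ th E bJ bh]]] := discretize stepS N0 tpsi psi1.
have cD i : continuous ('D_(delta_mx ord0 i) (J i)) by exact: (test_C1 (tJ i)).2.
have cg m : continuous (@grid_bump R n s N m).
  exact: C1_rV_continuous (test_C1 (test_grid_bump stepS N0 m)).
have -> : pairing w psi = pairing w (fun x => \sum_i 'D_(delta_mx ord0 i) (J i) x +
    \sum_(m : {ffun 'I_n -> 'I_N}) h (\row_k (node N (m k) + 1 / 2 / N%:R)) * grid_bump s m x).
  by apply: eq_Rintegral => x _; rewrite E -(grid_expansion stepS N0 th).
have cZ (m : {ffun 'I_n -> 'I_N}) : continuous
    (fun x => h (\row_k (node N (m k) + 1 / 2 / N%:R)) * grid_bump s m x).
  move=> x; have cm : {for x, continuous (@grid_bump R n s N m)} := cg m x.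
  exact: (cvgM (cvg_cst _) cm).
rewrite pairingDr//; last 2 first.
- exact: continuous_sum_rV.
- exact: continuous_sum_rV.
rewrite !pairing_sumr//; apply: lerD.
  rewrite -[X in X%:R * _](card_ord n) mulr_natl -sumr_const.
  apply: ler_sum => i _; apply: (le_trans (ler_norm _)); apply: wV => //.
  by move=> x; have := bJ i x; rewrite mulr1.
rewrite mulr_sumr; apply: ler_sum => m _.
rewrite pairingZr// (le_trans (ler_norm _))// normrM ler_wpM2r//.
by have := bh (\row_k (node N (m k) + 1 / 2 / N%:R)); rewrite mulr1.
Qed.

(** A Poincare inequality on the unit cube.  It is the estimate with a single
    cell, applied to [w - c], where [c] is chosen to make the only pairing vanish;
    a mean-zero function is then close to 0 as soon as it is close to a constant. *)
Lemma L1norm_mean0 w V : L1 w -> weak_variation_le w V ->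
  \int[mu]_(x in Q0) w x = 0 -> L1norm w <= 2 * (n%:R * (V * (2 * K))).
Proof.
move=> iw wV w0.
pose m0 : {ffun 'I_n -> 'I_1} := [ffun=> ord0].
pose h0 := grid_bump s m0.
have ch0 : continuous h0 := C1_rV_continuous (test_C1 (test_grid_bump stepS (ltn0Sn 0) m0)).
have est g V' : L1 g -> weak_variation_le g V' ->
    L1norm g <= n%:R * (V' * (2 * K)) + K * `|pairing g h0|.
  move=> ig gV; have := L1norm_estimate (ltn0Sn 0) ig gV.
  rewrite (bigD1 m0)//= big1 ?addr0 ?divr1// => m /eqP mm0; exfalso; apply: mm0.
  by apply/ffunP => k; rewrite ffunE ord1.
(* otherwise the estimate would give norm 0 to the constant 1 *)
have h0neq : pairing (fun=> 1) h0 != 0.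
  apply/eqP => h00; have := est _ _ (L1_cst 1) (weak_variation_cst 1).
  rewrite h00 normr0 !mul0r !mulr0 addr0 /L1norm normr1 Rintegral_cst_Q0.
  by rewrite ler10.
pose c := pairing w h0 / pairing (fun=> 1) h0.
have iwc : L1 (fun x => w x - c) by apply: L1B => //; exact: L1_cst.
have wc : L1norm (fun x => w x - c) <= n%:R * (V * (2 * K)).
  have := est _ _ iwc (weak_variationB iw (L1_cst c) wV (weak_variation_cst c)).
  rewrite addr0 pairingBl//; last exact: L1_cst.
  have -> : pairing (fun=> c) h0 = c * pairing (fun=> 1) h0.
    rewrite -pairingZl//; last exact: L1_cst.
    by apply: eq_Rintegral => x _; rewrite mulr1.
  by rewrite /c divfK// subrr normr0 mulr0 addr0.
have nc : `|c| <= n%:R * (V * (2 * K)).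
  apply: le_trans wc; have := le_Rintegral_L1norm iwc.
  by rewrite RintegralB//; [rewrite w0 sub0r normrN Rintegral_cst_Q0|exact: L1_cst].
rewrite mulr_natl mulr2n (le_trans _ (lerD wc nc))//.
have -> : `|c| = L1norm (fun=> c) by rewrite /L1norm Rintegral_cst_Q0.
apply: L1norm_triangle => //; first exact: L1_cst.
by move=> x _; rewrite -[X in `|X| <= _](subrK c) ler_normD.
Qed.

End estimate.
End weak_variation.

(** * Compactness *)

Section compactness.
Context {R : realType} {n : nat}.
Notation mu := (@lebesgue_rV R n).
Implicit Types (g w u : 'rV[R]_n -> R) (x : 'rV[R]_n).

Let mQ0 : measurable (@Q0 R n) := @measurable_Q0 R n.

Lemma L1norm_fin g : L1 g ->
  (\int[mu]_(x in Q0) `|g x|%:E)%E = (L1norm g)%:E.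
Proof.
move=> ig; rewrite /L1norm /Rintegral fineK//.
apply: integrable_fin_num => //; exact: L1_norm.
Qed.

(** Completeness of L^1.  The sum [T] of the increments is integrable, hence finite
    almost everywhere; there the sequence converges, dominated by |G_0| + T. *)
Lemma L1_complete (G : nat -> 'rV[R]_n -> R) : (forall k, L1 (G k)) ->
  (forall k l, (k <= l)%N -> L1norm (fun x => G k x - G l x) <= (1 / 2) ^+ k) ->
  exists2 u, L1 u &
    (\int[mu]_(x in Q0) `|G k x - u x|%:E)%E @[k --> \oo] --> 0%E.
Proof.
move=> iG dG.
have mG k : measurable_fun Q0 (G k).
  by have /integrableP[/measurable_EFinP] := iG k.
pose D k x : \bar R := (`|G k x - G k.+1 x|)%:E.
have D0 k x : (0 <= D k x)%E by rewrite lee_fin.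
have mD k : measurable_fun Q0 (D k).
  by apply/measurable_EFinP; apply: measurableT_comp => //; exact: measurable_funB.
pose T x : \bar R := (\sum_(0 <= k <oo) D k x)%E.
have T0 x : (0 <= T x)%E by apply: nneseries_ge0 => k _ _; exact: D0.
have mT : measurable_fun Q0 T.
  by apply: ge0_emeasurable_sum => // k x _ _; exact: D0.
have iT : mu.-integrable Q0 T.
  apply/integrableP; split => //.
  under eq_integral => x _ do rewrite gee0_abs//.
  rewrite integral_nneseries//; apply: (@le_lt_trans _ _ 2%:E); last exact: ltry.
  apply: lime_le; first by apply: is_cvg_nneseries => k _ _; exact: integral_ge0.
  apply: nearW => N; apply: (@le_trans _ _ (\sum_(0 <= k < N) ((1 / 2) ^+ k : R)%:E)%E).
    apply: lee_sum => k _; rewrite /D L1norm_fin ?lee_fin; last exact: L1B.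
    exact: dG.
  rewrite sumEFin lee_fin.
  suff -> : \sum_(0 <= k < N) ((1 / 2) ^+ k : R) = 2 - 2 * (1 / 2) ^+ N.
    by rewrite gerBl mulr_ge0// exprn_ge0.
  elim: N => [|N IH]; first by rewrite big_nil expr0 mulr1 subrr.
  rewrite big_nat_recr//= IH exprS mulrA mul1r mulfV ?pnatr_eq0// mul1r.
  by rewrite mulr_natl mulr2n opprD !addrA subrK.
have cG x : T x \is a fin_num -> cvgn (fun k => G k x).
  move=> Tx; have : cvgn (series (fun k => G k.+1 x - G k x)).
    apply: normed_cvg; apply: nondecreasing_is_cvgn.
      by apply: nondecreasing_series => k _ _ /=.
    exists (fine (T x)) => _ [N _ <-] /=.
    rewrite -lee_fin fineK// /series/= -sumEFin.
    rewrite (_ : (\sum_(0 <= k < N) _)%E = \sum_(0 <= k < N) D k x)%E.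
      by apply: nneseries_lim_ge => k _ _; exact: D0.
    by apply: eq_bigr => k _; rewrite /D distrC.
  move=> h; rewrite (_ : (fun k => G k x) =
      (fun k => G 0%N x + series (fun k => G k.+1 x - G k x) k)); last first.
    by apply/funext => k; rewrite /series/= telescope_sumr// addrC subrK.
  exact: is_cvgD (is_cvg_cst _) h.
pose u x : R := fine (limn_esup (fun k => (G k x)%:E)).
have mu_ : measurable_fun Q0 u.
  apply: (measurableT_comp (@fine_measurable R setT measurableT)).
  by apply: measurable_fun_limn_esup => k; exact/measurable_EFinP.
have uE x : T x \is a fin_num -> G k x @[k --> \oo] --> u x.
  move=> /cG cx; have h : (G k x)%:E @[k --> \oo] --> (limn (fun k => G k x))%:E.
    by apply: cvg_EFin; [exact: nearW|exact: cx].
  rewrite /u is_cvg_limn_esupE; last by apply/cvg_ex; eexists; exact: h.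
  by rewrite (cvg_lim _ h).
have [] := @dominated_convergence _ _ _ mu Q0 mQ0 (fun k x => (G k x)%:E)
  (EFin \o u) (fun x => (`|G 0%N x|%:E + T x)%E).
- by move=> k; exact/measurable_EFinP.
- exact/measurable_EFinP.
- have := integrable_ae mQ0 iT; apply: filterS => x h Qx.
  by apply/cvg_EFin; [exact: nearW|exact: uE (h Qx)].
- have i0 : mu.-integrable Q0 (fun x => (`|G 0%N x|)%:E) := L1_norm (iG 0%N).
  exact: (integrableD mQ0 i0 iT).
- apply: aeW => x k Qx /=.
  apply: (@le_trans _ _ (`|G 0%N x|%:E + \sum_(0 <= i < k) D i x)%E); last first.
    by rewrite leeD2l// nneseries_lim_ge.
  rewrite /D sumEFin -EFinD lee_fin.
  elim: k => [|k IH]; first by rewrite big_nil addr0.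
  rewrite big_nat_recr//= addrA -{1}(subKr (G k x) (G k.+1 x)).
  by rewrite (le_trans (ler_normB _ _))// lerD2r.
by move=> iu h _; exists u.
Qed.

Lemma bounded_ultra_cvg (U : set_system nat) (a : nat -> R) (B : R) :
  UltraFilter U -> (forall k, `|a k| <= B) -> exists l : R, a k @[k --> U] --> l.
Proof.
move=> UU aB; have UaU : UltraFilter (a k @[k --> U]).
  split; first exact: fmap_proper_filter.
  move=> G PG sub; apply/seteqP; split => // A GA.
  have [//|UnA] := in_ultra_setVsetC (a @^-1` A) UU.
  have /sub GnA : (a k @[k --> U]) (~` A) by [].
  by have [x [Ax nAx]] := @filter_ex _ G _ _ (filterI GA GnA).
have := @segment_compact R (- B) B; rewrite compact_ultra => /(_ _ UaU)[].
  rewrite (_ : (a k @[k --> U]) _ = U setT); first exact: filterT.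
  by congr U; apply/seteqP; split => // k _; rewrite /= in_itv/= -ler_norml.
by move=> l [_ al]; exists l.
Qed.

(** Along an ultrafilter all the pairings with grid bumps converge at once, for
    every mesh; this replaces a diagonal extraction.  By [L1norm_estimate] the
    sequence is then Cauchy along the ultrafilter, and a subsequence with
    geometrically decaying distances is picked from members of it. *)
Theorem weak_variation_compact (g : nat -> 'rV[R]_n -> R) :
  (forall j, L1 (g j)) -> (forall j, weak_variation_le (g j) 1) ->
  (forall j, \int[mu]_(x in Q0) g j x = 0) ->
  exists (sigma : nat -> nat) u, [/\ forall k, (k <= sigma k)%N, L1 u &
    (\int[mu]_(x in Q0) `|g (sigma k) x - u x|%:E)%E @[k --> \oo] --> 0%E].
Proof.
move=> ig gV g0.
have [S [s [C stepS]]] := @step_exists R.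
pose K := Num.max C 1 ^+ n.
have K1 : 1 <= K by rewrite exprn_ege1// le_max lexx orbT.
have gB j : L1norm (g j) <= 2 * (n%:R * (1 * (2 * K))) by
  exact: (L1norm_mean0 stepS (ig j) (gV j) (g0 j)).
have [U [UU ooU]] := @ultraFilterLemma _ \oo _.
have cauchy (e : R) : 0 < e -> exists2 A, U A & forall j k, A j -> A k ->
    L1norm (fun x => g j x - g k x) <= e.
  move=> e0; pose N := (Num.truncn (n%:R * (2 * (2 * K)) / (e / 2))).+1.
  have N0 : (0 < N)%N by [].
  have NE : n%:R * (2 * (2 * K / N%:R)) <= e / 2.
    have -> : n%:R * (2 * (2 * K / N%:R)) = n%:R * (2 * (2 * K)) / N%:R by rewrite !mulrA.
    rewrite ler_pdivrMr ?ltr0n// -ler_pdivrMl ?divr_gt0// mulrC.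
    by apply: ltW; exact: truncnS_gt.
  have ex_l m : exists l : R, pairing (g j) (@grid_bump R n s N m) @[j --> U] --> l.
    have cm := C1_rV_continuous (test_C1 (test_grid_bump stepS N0 m)).
    have [B B0 BP] := continuous_bounded_Q0 cm.
    apply: (@bounded_ultra_cvg _ _ (B * (2 * (n%:R * (1 * (2 * K)))))) => // k.
    apply: le_trans (pairing_le (ig k) cm BP) _.
    by rewrite ler_wpM2l.
  pose P := #|{: {ffun 'I_n -> 'I_N}}|.
  (* [P] is the size of the grid; its successor is visibly positive *)
  pose d : R := e / 2 / (K * P.+1%:R) / 2.
  have K0 : 0 < K := lt_le_trans ltr01 K1.
  have d0 : 0 < d by rewrite !divr_gt0// mulr_gt0.
  exists [set j | forall m, `|projT1 (cid (ex_l m)) - pairing (g j) (grid_bump s m)| < d].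
    apply: filter_forall => m; case: cid => l /= /cvgrPdist_lt; exact.
  move=> j k Aj Ak.
  have wV : weak_variation_le (fun x => g j x - g k x) 2.
    by rewrite -[2]/(1 + 1); apply: weak_variationB.
  apply: le_trans (L1norm_estimate stepS N0 (L1B (ig j) (ig k)) wV) _.
  rewrite [leRHS]splitr lerD//.
  apply: (@le_trans _ _ (K * \sum_(m : {ffun 'I_n -> 'I_N}) (d + d))).
    rewrite ler_pM2l//; apply: ler_sum => m _; rewrite pairingBl//; last first.
      exact: C1_rV_continuous (test_C1 (test_grid_bump stepS N0 m)).
    rewrite -[X in `|X|](subrKA (projT1 (cid (ex_l m)))) (le_trans (ler_normD _ _))//.
    by rewrite lerD// ltW// 1?distrC.
  have -> : K * \sum_(m : {ffun 'I_n -> 'I_N}) (d + d) = K * (2 * P)%:R * d.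
    by rewrite sumr_const -[X in X *+ _]mulr2n -mulrnA -mulrA mulr_natl.
  apply: (@le_trans _ _ (K * (2 * P.+1)%:R * d)).
    by rewrite ler_pM2r// ler_pM2l// ler_nat leq_mul2l leqnSn.
  have -> : K * (2 * P.+1)%:R * d = e / 2; last by [].
  have X0 : K * P.+1%:R != 0 by rewrite mulf_neq0 ?pnatr_eq0// gt_eqF.
  have cancel2 (X Y : R) : X != 0 -> 2 * X * (Y / X / 2) = Y.
    by move=> Xn; rewrite [LHS]mulrC mulrA divfK ?pnatr_eq0// divfK.
  by rewrite /d natrM [K * (_ * _)]mulrCA cancel2.
have /choice[A AP] (k : nat) : exists A, U A /\ forall i j, A i -> A j ->
    L1norm (fun x => g i x - g j x) <= (1 / 2) ^+ k.
  have h0 : 0 < (1 / 2 : R) ^+ k by rewrite exprn_gt0.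
  by have [A UA HA] := cauchy _ h0; exists A.
have /choice[sigma sP] (k : nat) : exists j, (k <= j)%N /\ forall i, (i <= k)%N -> A i j.
  have UB : U ([set j | (k <= j)%N] `&` [set j | forall i : 'I_k.+1, A i j]).
    apply: filterI; first by apply: ooU; exact: nbhs_infty_ge.
    by apply: filter_forall => i; have [] := AP i.
  have [j [kj Aj]] := @filter_ex _ U _ _ UB.
  by exists j; split => // i ik; exact: (Aj (Ordinal (ik : (i < k.+1)%N))).
have [u iu gu] := @L1_complete (fun k => g (sigma k)) (fun k => ig _)
  (fun k l kl => (AP k).2 _ _ ((sP k).2 _ (leqnn k)) ((sP l).2 _ kl)).
by exists sigma, u; split => // k; have [] := sP k.
Qed.

End compactness.

(** * Rescaled functions *)

Section rescaling.
Context {R : realType} {n : nat}.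
Notation mu := (@lebesgue_rV R n).
Implicit Types (f g u phi : 'rV[R]_n -> R) (Q : ocube R n) (x y v w : 'rV[R]_n) (i : 'I_n).

Lemma differentiable_affine (c : 'rV[R]_n) (M : 'M[R]_n) x :
  differentiable (fun y => c + y *m M) x.
Proof.
rewrite (_ : (fun y => _) = (cst c) + \sum_k (fun y : 'rV[R]_n => y ord0 k *: row k M)).
  apply: differentiableD; first exact: differentiable_cst.
  apply: differentiable_sum => k; apply: differentiableZl.
  exact: differentiable_coord.
by apply/funext => y; rewrite mulmx_sum_row/= fctE fct_sumE.
Qed.

Lemma continuous_ocube_map Q : continuous (ocube_map Q).
Proof.
move=> x; apply: differentiable_continuous; rewrite (_ : ocube_map Q =
  (fun y => center Q + y *m frame Q)); first exact: differentiable_affine.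
by apply/funext => y; rewrite ocube_mapE.
Qed.

Definition unmap_lin Q v : 'rV[R]_n := side Q ^- 2 *: (v *m (frame Q)^T).

Lemma ocube_unmapE Q v x :
  ocube_unmap Q (v + x) = unmap_lin Q v + ocube_unmap Q x.
Proof. by rewrite /ocube_unmap -addrA mulmxDl scalerDr. Qed.

Lemma unmap_linZ Q (h : R) v : unmap_lin Q (h *: v) = h *: unmap_lin Q v.
Proof. by rewrite /unmap_lin -scalemxAl !scalerA mulrC. Qed.

Lemma unmap_lin_frame Q i : unmap_lin Q (row i (frame Q)) = delta_mx ord0 i.
Proof.
rewrite /unmap_lin -row_mul frame_conformal; apply/rowP => k; rewrite !mxE eqxx/=.
case: eqVneq => _; last by rewrite mulr0.
by rewrite mulr1n mulVf// expf_neq0// gt_eqF// side_gt0.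
Qed.

Lemma differentiable_ocube_unmap Q x : differentiable (ocube_unmap Q) x.
Proof.
rewrite (_ : ocube_unmap Q = (fun y => ocube_unmap Q 0 + y *m (side Q ^- 2 *: (frame Q)^T))).
  exact: differentiable_affine.
by apply/funext => y; rewrite -{1}[y]addr0 ocube_unmapE addrC -scalemxAr.
Qed.

Lemma continuous_ocube_unmap Q : continuous (ocube_unmap Q).
Proof. by move=> x; apply: differentiable_continuous; exact: differentiable_ocube_unmap. Qed.

(** The chain rule for an affine map, already valid for difference quotients. *)
Lemma derive_unmap Q phi v x :
  'D_v (phi \o ocube_unmap Q) x = 'D_(unmap_lin Q v) phi (ocube_unmap Q x).
Proof.
rewrite /derive; set F := fun h : R => h^-1 *: _; set G := fun h : R => h^-1 *: _.
suff -> : F = G by [].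
by apply/funext => h; rewrite /F /G /= ocube_unmapE unmap_linZ.
Qed.

Lemma C1_rV_derive_linear phi w x : C1_rV phi ->
  'D_w phi x = \sum_k w ord0 k * 'D_(delta_mx ord0 k) phi x.
Proof.
move=> C1phi; have d := C1phi.1 x; rewrite deriveE//.
rewrite [in LHS](row_sum_delta w) linear_sum; apply: eq_bigr => k _.
by rewrite linearZ/= deriveE.
Qed.

(** A competitor for |Df|(Q): its direction is a unit edge vector of [Q], along
    which differentiation is a partial derivative in the coordinates of the unit
    cube. *)
Definition transported_field Q i phi x : 'rV[R]_n :=
  phi (ocube_unmap Q x) *: ((side Q)^-1 *: row i (frame Q)).

Section transported.
Variables (Q : ocube R n) (i : 'I_n) (phi : 'rV[R]_n -> R).
Hypothesis tphi : test phi.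
Let nu : 'rV[R]_n := (side Q)^-1 *: row i (frame Q).
Let field := transported_field Q i phi.
Let C1phi : C1_rV phi := test_C1 tphi.

Let dpull x : differentiable (phi \o ocube_unmap Q) x.
Proof.
by apply: differentiable_comp; [exact: differentiable_ocube_unmap|exact: C1phi.1].
Qed.

Lemma transported_field_C1c : C1c (carrier Q) field.
Proof.
split=> [x|k|].
- apply: (@differentiableZl _ _ _ (phi \o ocube_unmap Q)); exact: dpull.
- rewrite (_ : 'D_ _ _ = fun x => (\sum_j unmap_lin Q (delta_mx ord0 k) ord0 j *
      'D_(delta_mx ord0 j) phi (ocube_unmap Q x)) *: nu).
    have cD : continuous (fun x : 'rV[R]_n => \sum_j unmap_lin Q (delta_mx ord0 k) ord0 j *
      'D_(delta_mx ord0 j) phi (ocube_unmap Q x)).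
      apply: continuous_sum_rV => j z.
      have h : {for z, continuous ('D_(delta_mx ord0 j) phi \o ocube_unmap Q)}.
        apply: continuous_comp; first exact: continuous_ocube_unmap.
        exact: C1phi.2.
      exact: (cvgM (cvg_cst _) h).
    by move=> x; exact: (cvgZr_tmp (cD x)).
  apply/funext => x; rewrite -C1_rV_derive_linear// -derive_unmap.
  rewrite deriveE; last exact: (@differentiableZl _ _ _ (phi \o ocube_unmap Q)).
  have := @diffZl _ _ _ (phi \o ocube_unmap Q) nu x (dpull x).
  by move=> E; rewrite deriveE//; exact: (congr1 (fun F => F (delta_mx ord0 k)) E).
have [r r2 rP] := test_supp tphi.
exists (ocube_map Q @` [set y : 'rV[R]_n | forall k, [set` `[(- r), r]] (y ord0 k)]); split.
- apply: continuous_compact.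
    by apply: continuous_subspaceT; exact: continuous_ocube_map.
  by apply: (@rV_compact _ n (fun=> [set` `[(- r), r]])) => _; exact: segment_compact.
- move=> _ [y yr <-]; exists y => //; rewrite -/Q0 Q0E => k.
  by have := yr k; rewrite /= in_itv/= -ler_norml => /le_lt_trans; exact.
- move=> x xK; rewrite /field /transported_field.
  suff [k kr] : exists k, ~ `|ocube_unmap Q x ord0 k| <= r.
    rewrite (rP _ k) ?scale0r// ltW//.
    by rewrite ltNge; exact/negP.
  apply/existsNP => h; apply: xK; exists (ocube_unmap Q x); last by rewrite ocube_unmapK.
  by move=> k; rewrite /= in_itv/= -ler_norml.
Qed.

Lemma transported_field_norm x : `|phi (ocube_unmap Q x)| <= 1 ->
  dotr (field x) (field x) <= 1.
Proof.
move=> phi1; rewrite /field /transported_field scalerA.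
set c := phi _ * _; have -> : dotr (c *: row i (frame Q)) (c *: row i (frame Q)) =
    c ^+ 2 * (frame Q *m (frame Q)^T) i i.
  by rewrite [X in _ = _ * X]mxE mulr_sumr; apply: eq_bigr => k _; rewrite !mxE mulrACA -expr2.
rewrite frame_conformal mxE eqxx mulr1n -exprMn /c divfK; last by rewrite gt_eqF// side_gt0.
by rewrite -real_normK ?num_real// exprn_ile1.
Qed.

(** The divergence of a function times a fixed vector is the derivative of the
    function along this vector, and the i-th edge of [Q] corresponds to the
    i-th basis vector under [ocube_map Q]. *)
Lemma divergence_transported_field x :
  divergence field x = (side Q)^-1 * 'D_(delta_mx ord0 i) phi (ocube_unmap Q x).
Proof.
have E : 'D_nu (phi \o ocube_unmap Q) x = divergence field x.
  rewrite deriveE// [in LHS](row_sum_delta nu) linear_sum; apply: eq_bigr => k _.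
  rewrite linearZ/= -deriveE// (_ : (fun y => _) = (nu ord0 k) \*: (phi \o ocube_unmap Q)).
    by rewrite deriveZ//; exact: diff_derivable.
  by apply/funext => y; rewrite /field /transported_field !mxE mulrC.
rewrite -E derive_unmap unmap_linZ unmap_lin_frame.
rewrite deriveE; last exact: C1phi.1.
by rewrite linearZ/= -deriveE//; exact: C1phi.1.
Qed.

End transported.

Lemma integrable_carrier Q (F : 'rV[R]_n -> \bar R) :
  measurable_fun (carrier Q) F -> mu.-integrable Q0 (F \o ocube_map Q) ->
  mu.-integrable (carrier Q) F.
Proof.
move=> mF /integrableP[_ iF]; apply/integrableP; split => //.
rewrite (@ge0_integral_ocube_map _ _ Q (fun x => `|F x|%E))//; last exact: measurableT_comp.
have s0 := exprn_gt0 n (side_gt0 Q).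
move: iF; rewrite /comp; case: (\int[mu]_(x in Q0) _)%E => [r _| //|_].
  exact: ltry.
by rewrite gt0_muleNy ?lte_fin.
Qed.

Lemma EFin_Rintegral g : L1 g -> (\int[mu]_(x in Q0) (g x)%:E)%E = (\int[mu]_(x in Q0) g x)%:E.
Proof.
move=> ig; rewrite /Rintegral fineK//.
by apply: integrable_fin_num => //; exact: measurable_Q0.
Qed.

Lemma osc_Q0 u : L1 u ->
  osc u Q0 = (L1norm (fun y => u y - \int[mu]_(x in Q0) u x))%:E.
Proof.
move=> iu; rewrite /osc /mean.
have -> : mu Q0 = 1%E := lebesgue_rV_Q0.
rewrite /= invr1 mul1e mul1r L1norm_fin//; apply: L1B => //; exact: L1_cst.
Qed.

Section integrable_on_cube.
Variables (Q : ocube R n) (f : 'rV[R]_n -> R) (V : R).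
Hypotheses (n0 : (0 < n)%N) (i_f : mu.-integrable (carrier Q) (EFin \o f)).
Hypotheses (fV : variation f (carrier Q) = V%:E) (V0 : 0 < V).
Let s0 : 0 < side Q := side_gt0 Q.
Let fT y := f (ocube_map Q y).

Let ifT : L1 fT.
Proof. exact: integrable_ocube_map i_f. Qed.

Lemma mean_carrier : mean f (carrier Q) = \int[mu]_(y in Q0) fT y.
Proof.
rewrite /mean.
have -> : mu (carrier Q) = (side Q ^+ n)%:E by exact: lebesgue_rV_carrier.
rewrite {1}/Rintegral (integral_ocube_map i_f) /= EFin_Rintegral// -EFinM/=.
by rewrite mulKf// gt_eqF// exprn_gt0.
Qed.

Let m := \int[mu]_(y in Q0) fT y.
Let iB : L1 (fun y => fT y - m).
Proof. by apply: L1B => //; exact: L1_cst. Qed.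

Lemma rescaleE : rescale f Q = fun y => side Q ^+ n.-1 / V * (fT y - m).
Proof. by apply/funext => y; rewrite /rescale mean_carrier fV. Qed.

Lemma L1_rescale : L1 (rescale f Q).
Proof. by rewrite rescaleE; exact: L1Z. Qed.

Lemma rescale_mean0 : \int[mu]_(y in Q0) rescale f Q y = 0.
Proof.
rewrite rescaleE RintegralZl//; last exact: measurable_Q0.
rewrite RintegralB//; [|exact: measurable_Q0|exact: L1_cst].
by rewrite Rintegral_cst_Q0 subrr mulr0.
Qed.

(** Mean oscillation is invariant under [ocube_map Q] and homogeneous in the
    function, and the factors in the two definitions agree. *)
Lemma poincare_rescale : poincare f Q = osc (rescale f Q) Q0.
Proof.
rewrite osc_Q0; last exact: L1_rescale.
rewrite rescale_mean0 /poincare fV.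
have -> : osc f (carrier Q) = (L1norm (fun y => fT y - m))%:E.
  rewrite /osc mean_carrier.
  have -> : mu (carrier Q) = (side Q ^+ n)%:E by exact: lebesgue_rV_carrier.
  rewrite (@ge0_integral_ocube_map _ _ Q (fun x => `|f x - _|%:E))//.
    rewrite L1norm_fin//= -!EFinM mulrA mulVf ?mul1r//.
    by rewrite gt_eqF// exprn_gt0.
  apply/measurable_EFinP; apply: measurableT_comp => //.
  apply: measurable_funB; last exact: measurable_cst.
  by have /integrableP[/measurable_EFinP] := i_f.
rewrite inver gt_eqF// -!EFinM; congr (_%:E).
have c0 : 0 <= side Q ^+ n.-1 / V by rewrite divr_ge0 ?exprn_ge0// ltW.
transitivity (side Q ^+ n.-1 / V * L1norm (fun y => fT y - m)).
  by rewrite mulrAC.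
rewrite /L1norm -RintegralZl//; last 2 first.
- exact: measurable_Q0.
- exact: L1_norm.
apply: eq_Rintegral => y _; rewrite rescaleE subr0 normrM ger0_norm//.
Qed.

(** The pairing equals, up to the factor 1 / |Df|(Q), the integral of [f] against
    the divergence of the transported field: the subtracted mean pairs to 0 with
    a derivative, and the powers of the side cancel. *)
Lemma pairing_rescale_le1 i phi : test phi -> (forall x, `|phi x| <= 1) ->
  pairing (rescale f Q) ('D_(delta_mx ord0 i) phi) <= 1.
Proof.
move=> tphi phi1; set D := 'D_ _ _.
have cD : continuous D := (test_C1 tphi).2 i.
have iD : L1 D := continuous_integrable_Q0 cD.
have fD : L1 (fun y => fT y * D y) := integrable_mul_continuous ifT cD.
have -> : pairing (rescale f Q) D = side Q ^+ n.-1 / V * pairing fT D.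
  rewrite rescaleE pairingZl// pairingBl//; last exact: L1_cst.
  rewrite (_ : pairing (fun=> m) D = 0) ?subr0//.
  rewrite /pairing RintegralZl//; last exact: measurable_Q0.
  by rewrite integral_test_derive// mulr0.
rewrite mulrAC ler_pdivrMr// mul1r -lee_fin -fV.
apply: ereal_sup_ubound; exists (transported_field Q i phi).
  split; first exact: transported_field_C1c.
  by move=> x; apply: transported_field_norm.
under eq_integral do rewrite divergence_transported_field//.
rewrite (@integral_ocube_map _ _ Q (fun x => (f x * ((side Q)^-1 * D (ocube_unmap Q x)))%:E)).
  under eq_integral do rewrite ocube_mapK mulrCA.
  have iZ := L1Z (side Q)^-1 fD.
  rewrite (EFin_Rintegral iZ) RintegralZl//; last exact: measurable_Q0.
  rewrite -EFinM mulrA; congr (_ * _)%:E.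
  have exprn (a : R) : a ^+ n = a ^+ n.-1 * a by rewrite -exprSr prednK.
  by rewrite exprn mulfK// gt_eqF.
apply: integrable_carrier.
  apply/measurable_EFinP; apply: measurable_funM.
    by have /integrableP[/measurable_EFinP] := i_f.
  apply: measurable_funTS; apply: measurable_funM; first exact: measurable_cst.
  apply: continuous_measurable_rV => x.
  have h : {for x, continuous (D \o ocube_unmap Q)}.
    by apply: continuous_comp; [exact: continuous_ocube_unmap|exact: cD].
  exact: h.
have iZ := L1Z (side Q)^-1 fD.
rewrite (_ : _ \o _ = EFin \o (fun y => (side Q)^-1 * (fT y * D y)))//.
by apply/funext => y /=; rewrite ocube_mapK mulrCA.
Qed.

(** Both signs and all bounds [B] follow from the bound 1 by homogeneity; [B + e]
    covers [B = 0]. *)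
Lemma weak_variation_rescale : weak_variation_le (rescale f Q) 1.
Proof.
move=> i phi B tphi phiB; rewrite mul1r.
have cD : continuous ('D_(delta_mx ord0 i) phi) := (test_C1 tphi).2 i.
have ir := L1_rescale.
suff key (c : R) : (forall x, `|c * phi x| <= 1) ->
    c * pairing (rescale f Q) ('D_(delta_mx ord0 i) phi) <= 1.
  apply/ler_addgt0Pr => e e0.
  have B0 : 0 <= B := le_trans (normr_ge0 _) (phiB 0).
  have Be : 0 < B + e by rewrite ltr_wpDl.
  have cB x : `|(B + e)^-1 * phi x| <= 1.
    rewrite normrM gtr0_norm ?invr_gt0// mulrC ler_pdivrMr// mul1r.
    by rewrite (le_trans (phiB x))// lerDl ltW.
  have := key _ cB; rewrite mulrC ler_pdivrMr// mul1r => h1.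
  have : - (B + e)^-1 * pairing (rescale f Q) ('D_(delta_mx ord0 i) phi) <= 1.
    by apply: key => x; rewrite mulNr normrN.
  rewrite mulNr lerNl mulrC ler_pdivlMr// mulN1r => h2.
  by rewrite ler_norml h1 h2.
move=> c1; have tc : test (fun x => c * phi x) by exact: tensor_spanZ.
have := pairing_rescale_le1 i tc c1.
rewrite (_ : 'D_ _ _ = fun x => c * 'D_(delta_mx ord0 i) phi x) ?pairingZr//.
apply/funext => x; apply: (@deriveZ _ _ _ phi c x).
exact: C1_rV_derivable (test_C1 tphi).
Qed.

End integrable_on_cube.
End rescaling.

(** * Tangents and the Poincare constant *)

Section small_cubes.
Context {R : realType} {n : nat}.
Notation mu := (@lebesgue_rV R n).
Implicit Types (f g u phi : 'rV[R]_n -> R) (Q : ocube R n) (x y v w : 'rV[R]_n) (i : 'I_n).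

Lemma dilate_sub_carrier Q (tau : R) : 0 <= tau -> tau < 1 ->
  dilate tau Q `<=` carrier Q.
Proof.
move=> t0 t1 _ [y yt <-]; exists y => //; rewrite -/Q0 Q0E => i.
move: yt; rewrite /dilate_Q0; case: eqVneq => [_ /= y0|_ /(_ i) yi].
  by have -> : y ord0 i = 0; [rewrite y0|rewrite normr0 divr_gt0].
by rewrite (lt_trans yi)// ltr_pM2r// invr_gt0.
Qed.

Lemma open_cube (r : R) : 0 < r -> open (cube r : set 'rV[R]_n).
Proof.
move=> r0; rewrite (_ : cube r = (fun v : 'rV[R]_n => `|v|) @^-1` [set` `]-oo, r[]).
  by apply: open_comp => [v _|]; [exact: norm_continuous|exact: interval_open].
apply/seteqP; split => v /=; rewrite in_itv/= [`|v|]/Num.Def.normr/= mx_normrE.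
  by move=> vr; apply/bigmax_ltP; split => // -[i j] _ /=; rewrite ord1.
by move=> /bigmax_ltP[_ H] i; exact: (H (ord0, i)).
Qed.

Lemma open_carrier Q : open (carrier Q).
Proof.
rewrite (_ : carrier Q = ocube_unmap Q @^-1` Q0); last first.
  apply/seteqP; split => [x [y y0 <-]|x x0]; first by rewrite /= ocube_mapK.
  by exists (ocube_unmap Q x) => //; rewrite ocube_unmapK.
apply: open_comp => [v _|]; first exact: continuous_ocube_unmap.
by rewrite Q0E; apply: open_cube; rewrite divr_gt0.
Qed.

Lemma frame_le Q i j : `|frame Q i j| <= side Q.
Proof.
rewrite -(ler_pXn2r (_ : (0 < 2)%N)) ?nnegrE ?(ltW (side_gt0 Q))//.
have -> : side Q ^+ 2 = (frame Q *m (frame Q)^T) i i by rewrite frame_conformal mxE eqxx.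
rewrite real_normK ?num_real// [leRHS]mxE (bigD1 j)//= [_^T j i]mxE -expr2 lerDl.
by apply: sumr_ge0 => k _; rewrite [_^T k i]mxE -expr2 sqr_ge0.
Qed.

(** The entries of the edge vectors are bounded by the side; the norm here is the
    sup norm. *)
Lemma carrier_diam Q x y : carrier Q x -> carrier Q y -> `|y - x| <= n%:R * side Q.
Proof.
move=> [a a0 <-] [b b0 <-]; have s0 := ltW (side_gt0 Q).
rewrite !ocube_mapE opprD addrACA subrr add0r -mulmxBl.
apply/rV_norm_leP => [|j]; first by rewrite mulr_ge0.
rewrite mxE (le_trans (ler_norm_sum _ _ _))//.
rewrite -[X in X%:R * _](card_ord n) mulr_natl -sumr_const; apply: ler_sum => i _.
rewrite normrM -[leRHS]mul1r ler_pM//; last exact: frame_le.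
move: a0 b0; rewrite -/Q0 Q0E => /(_ i)/ltW ai /(_ i)/ltW bi.
by rewrite !mxE (le_trans (ler_normB _ _))// [leRHS]splitr addrC lerD.
Qed.

(** By [carrier_diam] the small cubes around [x] lie in a closed sup-norm ball
    contained in the domain; this gives integrability and finiteness, while the
    variation is positive because [x] is in the support. *)
Lemma small_cubes (n0 : (0 < n)%N) (Omega : set 'rV[R]_n) f x :
  open Omega -> BVloc Omega f -> spt_variation Omega f x ->
  exists2 d : R, 0 < d & forall Q, carrier Q `<=` Omega -> carrier Q x ->
    side Q <= d -> mu.-integrable (carrier Q) (EFin \o f) /\
      exists2 V : R, 0 < V & variation f (carrier Q) = V%:E.
Proof.
move=> oO [[mf If] Vf] [Ox sx].
have /nbhs_ballP[e /= e0 eO] : nbhs x Omega by exact: open_nbhs_nbhs.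
have n0' : 0 < n%:R :> R by rewrite ltr0n.
exists (e / 2 / n%:R) => [|Q QO Qx Qd]; first by rewrite !divr_gt0.
pose K := [set y : 'rV[R]_n | forall i,
  [set` `[x ord0 i - e / 2, x ord0 i + e / 2]] (y ord0 i)].
have cK : compact K.
  by apply: (@rV_compact _ n (fun i => [set` `[x ord0 i - e / 2, x ord0 i + e / 2]]))
    => i; exact: segment_compact.
have KE y : K y <-> `|y - x| <= e / 2.
  have e2 : 0 <= e / 2 by rewrite ltW// divr_gt0.
  split=> [yK|/(rV_norm_leP _ e2) H i].
    by apply/(rV_norm_leP _ e2) => i; have := yK i; rewrite /= in_itv/= !mxE ler_distl.
  by have := H i; rewrite /= in_itv/= !mxE ler_distl.
have KO : K `<=` Omega.
  move=> y /KE yK; apply: eO; rewrite -ball_normE /= distrC (le_lt_trans yK)//.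
  by rewrite ltr_pdivrMr// ltr_pMr// ltr1n.
have QK : carrier Q `<=` K.
  move=> y Qy; apply/KE; rewrite (le_trans (carrier_diam Qx Qy))//.
  by rewrite mulrC -ler_pdivlMr.
have oQ := @open_carrier Q.
have QclK : closure (carrier Q) `<=` K.
  rewrite (closure_id K).1; first exact: closure_subset.
  by apply: compact_closed => //; exact: norm_hausdorff.
split.
  have mK : measurable K by apply: (@measurable_coordwise _ _
    (fun i => [set` `[x ord0 i - e / 2, x ord0 i + e / 2]])).
  apply: (@integrableS _ _ _ mu K) => //; first exact: measurable_carrier.
  apply/integrableP; split; last exact: If.
  apply/measurable_EFinP; apply: measurable_funS mf => //.
  exact: open_measurable_rV.
have Vpos := sx _ oQ QO Qx.
have : (variation f (carrier Q) < +oo)%E.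
  apply: Vf => //; last exact: subset_trans KO.
  by apply: subclosed_compact cK QclK; exact: closed_closure.
by move: Vpos; case: variation => // V; rewrite lte_fin => V0 _; exists V.
Qed.

End small_cubes.

Section tangents.
Context {R : realType} {n : nat}.
Notation mu := (@lebesgue_rV R n).
Implicit Types (f g u phi : 'rV[R]_n -> R) (Q : ocube R n) (x y v w : 'rV[R]_n) (i : 'I_n).

(** One unit of the constant comes from the function, the other from its mean. *)
Lemma osc_Q0_lipschitz g u : L1 g -> L1 u ->
  (osc g Q0 <= osc u Q0 + (2 * L1norm (fun y => g y - u y))%:E)%E.
Proof.
move=> ig iu; rewrite !osc_Q0// -EFinD lee_fin.
set a := \int[mu]_(y in Q0) g y; set b := \int[mu]_(y in Q0) u y.
have igu := L1B ig iu.
have ic (c : R) : L1 (fun=> c : R) := L1_cst c.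
apply: (@le_trans _ _ (L1norm (fun y => u y - b) + L1norm (fun y => g y - u y - (a - b)))).
  apply: L1norm_triangle; try exact: L1B.
  move=> y _; rewrite (le_trans _ (ler_normD _ _))// le_eqVlt; apply/orP; left.
  by apply/eqP; congr `|_|; rewrite addrACA subrKC -opprD subrKC.
rewrite lerD2l mulr_natl mulr2n.
apply: (@le_trans _ _ (L1norm (fun y => g y - u y) + L1norm (fun=> a - b))).
  apply: L1norm_triangle => //; first exact: L1B.
  by move=> y _; exact: ler_normB.
rewrite lerD2l; have := le_Rintegral_L1norm igu.
rewrite RintegralB//; last exact: measurable_Q0.
by rewrite /L1norm Rintegral_cst_Q0.
Qed.

Lemma L1_cvg_near (g : nat -> 'rV[R]_n -> R) u (e : R) : 0 < e ->
  (\int[mu]_(y in Q0) `|g j y - u y|%:E)%E @[j --> \oo] --> 0%E ->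
  \forall j \near \oo, (\int[mu]_(y in Q0) `|g j y - u y|%:E < e%:E)%E.
Proof.
move=> e0 gu.
have : nbhs (0%E : \bar R) [set z | (z < e%:E)%E]; last by move=> /gu.
by apply: open_nbhs_nbhs; split; [exact: open_ereal_lt_ereal|rewrite /= lte_fin].
Qed.

Lemma ereal_le_real (a b : \bar R) :
  (forall y : R, (y%:E < a)%E -> (y%:E <= b)%E) -> (a <= b)%E.
Proof.
case: a => [a| |]; case: b => [b| |] H //; rewrite ?leey ?leNye//.
- rewrite lee_fin leNgt; apply/negP => ba.
  have := H ((b + a) / 2); rewrite lte_fin lee_fin midf_lt// => /(_ isT).
  by rewrite leNgt midf_lt.
- by have := H (a - 1); rewrite lte_fin ltrBlDr ltrDl => /(_ ltr01).
- by have := H (b + 1); rewrite ltry lee_fin gerDl leNgt ltr01 => /(_ isT).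
- by have := H 0; rewrite ltry => /(_ isT).
Qed.

(** The supremum is nondecreasing in the size of the cubes. *)
Lemma poincare_limE (Omega : set 'rV[R]_n) f (tau : R) x :
  poincare_lim Omega f tau x =
  ereal_inf [set poincare_sup Omega f tau x e | e in [set e | 0 < e]].
Proof.
rewrite /poincare_lim; apply/cvg_lim => //.
rewrite (_ : [set e | 0 < e] = [set` `]0, +oo[]).
  apply: nondecreasing_at_right_cvge => // a b _ _ ab.
  apply: ereal_sup_le => _ [Q [QO Qx Qa] <-]; exists Q => //; split => //.
  exact: le_trans Qa ab.
by apply/seteqP; split => e /=; rewrite in_itv/= andbT.
Qed.

Section support_point.
Variables (Omega : set 'rV[R]_n) (f : 'rV[R]_n -> R) (tau : R) (x : 'rV[R]_n) (d : R).
Hypotheses (n0 : (0 < n)%N) (tau0 : 0 <= tau) (tau1 : tau < 1) (d0 : 0 < d).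
Hypothesis small : forall Q, carrier Q `<=` Omega -> carrier Q x ->
    side Q <= d -> mu.-integrable (carrier Q) (EFin \o f) /\
      exists2 V : R, 0 < V & variation f (carrier Q) = V%:E.

(** Close to the end of the sequence, [osc u Q0] is nearly [poincare f (Q j)] by
    [poincare_rescale], and [Q j] competes in each supremum. *)
Lemma osc_Tan_le u : Tan Omega f tau x u ->
  (osc u Q0 <= poincare_lim Omega f tau x)%E.
Proof.
move=> [iu [Q [QO Qx Q0_ Qu]]]; rewrite poincare_limE.
apply: le_ereal_inf_tmp => _ [eps /= eps0 <-].
apply/lee_addgt0Pr => e e0.
have e20 : 0 < e / 2 by rewrite divr_gt0.
have sQ : \forall j \near \oo, side (Q j) < Num.min eps d.
  by apply: (@cvgr_lt _ _ _ _ (fun j => side (Q j)) 0 Q0_); rewrite lt_min eps0.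
have [j [dj /ltW]] := @filter_ex _ \oo _ _ (filterI (L1_cvg_near e20 Qu) sQ).
rewrite le_min => /andP[jeps jd].
have Qjx : carrier (Q j) x := dilate_sub_carrier tau0 tau1 (Qx j).
have [ifQ [V V0 fV]] := small (QO j) Qjx jd.
have ir : L1 (rescale f (Q j)) := L1_rescale ifQ fV.
have dj' : L1norm (fun y => u y - rescale f (Q j) y) < e / 2.
  rewrite -lte_fin -L1norm_fin; last exact: L1B.
  by under eq_integral do rewrite distrC.
apply: (le_trans (osc_Q0_lipschitz iu ir)).
rewrite -(poincare_rescale ifQ fV V0) leeD//.
  by apply: ereal_sup_ubound; exists (Q j).
by rewrite lee_fin -ler_pdivlMl// mulrC ltW.
Qed.

(** Cubes of side at most 1/(j+1) with quotient above [y] have rescalings that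
    are compact in L^1; the limit of a subsequence is a tangent, and the strict
    lower bound on the oscillation passes to the limit as a weak one. *)
Lemma lt_poincare_lim_Tan (y : R) : (y%:E < poincare_lim Omega f tau x)%E ->
  exists2 u, Tan Omega f tau x u & (y%:E <= osc u Q0)%E.
Proof.
rewrite poincare_limE => yp.
pose r (j : nat) : R := Num.min d j.+1%:R^-1.
have r0 j : 0 < r j by rewrite lt_min d0 invr_gt0/=.
have /choice[Q QP] (j : nat) : exists Q, [/\ carrier Q `<=` Omega, dilate tau Q x,
    side Q <= r j & (y%:E < poincare f Q)%E].
  have : (y%:E < poincare_sup Omega f tau x (r j))%E.
    by apply: (lt_le_trans yp); apply: ereal_inf_lbound; exists (r j) => //; exact: r0.
  by move=> /ereal_sup_gt[_ [Q [QO Qx Qr] <-] yQ]; exists Q.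
have good j : mu.-integrable (carrier (Q j)) (EFin \o f) /\
    exists2 V : R, 0 < V & variation f (carrier (Q j)) = V%:E.
  have [QO Qx Qr _] := QP j; apply: small => //.
    exact: dilate_sub_carrier Qx.
  by rewrite (le_trans Qr)// ge_min lexx.
have iQ j : L1 (rescale f (Q j)) by have [h [V _ fV]] := good j; exact: L1_rescale fV.
have vQ j : weak_variation_le (rescale f (Q j)) 1.
  by have [h [V V0 fV]] := good j; exact: weak_variation_rescale n0 h fV V0.
have mQ j : \int[mu]_(z in Q0) rescale f (Q j) z = 0.
  by have [h [V V0 fV]] := good j; exact: rescale_mean0 fV.
have [sigma [u [sk iu cu]]] := weak_variation_compact iQ vQ mQ.
exists u.
  split => //; exists (Q \o sigma); split => //.
  - by move=> j; have [] := QP (sigma j).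
  - by move=> j; have [] := QP (sigma j).
  - apply: (@squeeze_cvgr _ _ _ _ (fun=> 0) (fun j => j.+1%:R^-1)).
    + apply: nearW => j /=; rewrite (ltW (side_gt0 _))/=.
      have [_ _ h _] := QP (sigma j); apply: (le_trans h).
      rewrite ge_min lef_pV2 ?posrE ?ltr0n// ler_nat ltnS sk orbT//.
    + exact: cvg_cst.
    + exact: cvg_harmonic.
apply/lee_addgt0Pr => e e0.
have e20 : 0 < e / 2 by rewrite divr_gt0.
have [j dj] := @filter_ex _ \oo _ _ (L1_cvg_near e20 cu).
have [ifQ [V V0 fV]] := good (sigma j).
have [_ _ _ /ltW yQ] := QP (sigma j).
apply: (le_trans yQ); rewrite (poincare_rescale ifQ fV V0).
apply: (le_trans (osc_Q0_lipschitz (iQ (sigma j)) iu)); rewrite leeD2l//.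
move: dj; rewrite L1norm_fin; last exact: L1B.
by rewrite lte_fin => /ltW dj; rewrite lee_fin -ler_pdivlMl// mulrC.
Qed.

End support_point.
End tangents.

Theorem theorem1p3 (R : realType) (n : nat) (n_gt0 : (0 < n)%N)
  (Omega : set 'rV[R]_n) (openOmega : open Omega)
  (f : 'rV[R]_n -> R) (BVf : BVloc Omega f)
  (tau : R) (tau_ge0 : 0 <= tau) (tau_lt1 : tau < 1)
  (x : 'rV[R]_n) (sptx : spt_variation Omega f x) :
  poincare_lim Omega f tau x =
  ereal_sup [set osc u Q0 | u in Tan Omega f tau x].
Proof.
have [d d0 small] := small_cubes n_gt0 openOmega BVf sptx.
apply/eqP; rewrite eq_le; apply/andP; split.
  apply: ereal_le_real => y /(lt_poincare_lim_Tan n_gt0 tau_ge0 tau_lt1 d0 small).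
  move=> [u Tu yu]; apply: (le_trans yu).
  by apply: ereal_sup_ubound; exists u.
apply: ge_ereal_sup => _ [u Tu <-].
exact: (osc_Tan_le tau_ge0 tau_lt1 d0 small Tu).
Qed.
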